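(* There exists $n_0$ such that, for all $n\ge n_0$, $H_n$ is the unique graph (up to isomorphism) on $n$ vertices containing $m(n)$ induced cycles.
   Context: All graphs are finite and simple. $m(n)$ denotes the maximum number of induced cycles (of any length $\ge 3$) that can be contained in a graph on $n$ vertices. $N_B(x)$ denotes the neighbourhood of $x$ in $B$. A graph $B$ is a cyclic braid if there exist $k\ge 3$ and a partition $B_1,\dots,B_k$ of $V(B)$ such that for every $1\le i\le k$ and every $x\in B_i$ we have $B_{i-1}\cup B_{i+1}\subseteq N_B(x)\subseteq B_{i-1}\cup B_i\cup B_{i+1}$, indices modulo $k$. The sets $B_i$ are the clusters, and $k$ is the length. A cyclic braid is empty if it has no edges inside its clusters. For $n\ge 8$ the $n$-vertex graph $H_n$ is defined as follows, where $k\ge 3$: $H_{3k}$ is the empty cyclic braid of length $k$ in which every cluster has size 3; $H_{3k+1}$ is the empty cyclic braid of length $k$ with $k-1$ clusters of size 3 and one cluster of size 4; $H_{3k-1}$ is the empty cyclic braid of length $k$ with $k-1$ clusters of size 3 and one cluster of size 2. *)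

(* Defs.v *)
From HB Require Import structures.
From mathcomp Require Import all_boot.

Set Implicit Arguments.
Unset Strict Implicit.
Unset Printing Implicit Defensive.

Record sgraph := SGraph {
  vertex :> finType;
  edge : rel vertex;
  edge_sym : symmetric edge;
  edge_irrefl : irreflexive edge }.

Definition isomorphic (G H : sgraph) : Prop :=
  exists2 f : G -> H, bijective f & forall x y, edge (f x) (f y) = edge x y.

Definition nbhd (G : sgraph) (x : G) : {set G} := [set y | edge x y].

(* Adjacency in the cycle 0, 1, ..., l - 1; it has no loops once 2 <= l. *)
Definition cyclic_adj (l : nat) : rel 'I_l :=
  fun i j => (ordS i == j) || (ordS j == i).

(* An induced cycle is determined by its vertex set, so induced cycles are
   counted as vertex sets: f lists S in a cyclic order. *)
Definition induced_cycle (G : sgraph) (S : {set G}) : bool :=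
  (3 <= #|S|) &&
  [exists f : {ffun 'I_#|S| -> G},
    [&& injectiveb f, f @: [set: 'I_#|S|] == S
      & [forall i, forall j, edge (f i) (f j) == cyclic_adj i j]]].

Definition num_induced_cycles (G : sgraph) : nat :=
  #|[set S : {set G} | induced_cycle S]|.

Section GraphOfPairs.
Variables (V : finType) (E : {set V * V}).

(* Orientation and loops are discarded, so that every E gives a simple graph;
   every simple graph on V arises in this way. *)
Definition pair_edge : rel V :=
  fun x y => (x != y) && (((x, y) \in E) || ((y, x) \in E)).

Lemma pair_edge_sym : symmetric pair_edge.
Proof. by move=> x y; rewrite /pair_edge eq_sym orbC. Qed.

Lemma pair_edge_irrefl : irreflexive pair_edge.
Proof. by move=> x; rewrite /pair_edge eqxx. Qed.

Definition graph_of_pairs : sgraph := SGraph pair_edge_sym pair_edge_irrefl.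
End GraphOfPairs.

Definition m (n : nat) : nat :=
  \max_(E : {set 'I_n * 'I_n}) num_induced_cycles (graph_of_pairs E).

Definition cyclic_braid (G : sgraph) (k : nat) (B : 'I_k -> {set G}) : Prop :=
  [/\ 3 <= k,
      forall i, B i != set0,
      forall i j, i != j -> [disjoint B i & B j],
      \bigcup_i B i = [set: G]
    & forall i x, x \in B i ->
        B (ord_pred i) :|: B (ordS i) \subset nbhd x /\
        nbhd x \subset B (ord_pred i) :|: B i :|: B (ordS i)].

Definition empty_braid (G : sgraph) (k : nat) (B : 'I_k -> {set G}) : Prop :=
  cyclic_braid B /\ forall i x y, x \in B i -> y \in B i -> ~~ edge x y.

Section BraidGraph.
Variables (k : nat) (s : 'I_k -> nat).

(* The vertex (i, a) is the a-th vertex of the i-th cluster, which has size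
   s i. The first conjunct matters only for k = 1. *)
Definition braid_edge : rel {i : 'I_k & 'I_(s i)} :=
  fun x y => (tag x != tag y) && cyclic_adj (tag x) (tag y).

Lemma braid_edge_sym : symmetric braid_edge.
Proof. by move=> x y; rewrite /braid_edge /cyclic_adj eq_sym orbC. Qed.

Lemma braid_edge_irrefl : irreflexive braid_edge.
Proof. by move=> x; rewrite /braid_edge eqxx. Qed.

Definition braid_graph : sgraph := SGraph braid_edge_sym braid_edge_irrefl.

Definition cluster (i : 'I_k) : {set braid_graph} := [set x | tag x == i].

Lemma card_cluster i : #|cluster i| = s i.
Proof.
have inj : injective (fun a : 'I_(s i) => Tagged (fun j => 'I_(s j)) a : braid_graph).
  by move=> a b /eqP; rewrite eq_Tagged => /eqP.
rewrite -[RHS]card_ord -cardsT -(card_imset _ inj); apply: eq_card => -[j a].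
rewrite inE /=; apply/eqP/imsetP => [e | [b _ /(congr1 tag)]] //.
by case: i / e {inj}; exists a.
Qed.

Lemma braid_graphP :
  3 <= k -> (forall i, 0 < s i) -> empty_braid cluster.
Proof.
move=> k3 s0.
have ordS_neq (i : 'I_k) : ordS i != i.
  apply/eqP => /(congr1 val) /=.
  have [ltk | gek] := ltnP i.+1 k; first by rewrite modn_small // => /esym /n_Sn.
  have -> : i.+1 = k by apply/eqP; rewrite eqn_leq gek ltn_ord.
  by rewrite modnn => i0; move: gek; rewrite -i0 leqNgt (leq_trans _ k3).
have adjE (x y : braid_graph) :
    edge x y = (tag y == ordS (tag x)) || (tag y == ord_pred (tag x)).
  rewrite /edge /= /braid_edge /cyclic_adj.
  rewrite [ordS _ == _]eq_sym (can2_eq (@ordSK _) (@ord_predK _)).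
  have [-> | //] := eqVneq (tag x) (tag y).
  rewrite eq_sym (negbTE (ordS_neq _)).
  by rewrite -(can2_eq (@ordSK _) (@ord_predK _)) (negbTE (ordS_neq _)).
split; last first.
  move=> i x y; rewrite !inE => /eqP <- /eqP exy.
  by rewrite /edge /= /braid_edge exy eqxx.
split=> //.
- by move=> i; rewrite -card_gt0 card_cluster.
- move=> i j nij; rewrite -setI_eq0; apply/eqP/setP => x; rewrite !inE.
  by apply/andP => -[/eqP xi /eqP xj]; rewrite -xi -xj eqxx in nij.
- by apply/setP => x; rewrite inE; apply/bigcupP; exists (tag x); rewrite ?inE.
- move=> i x; rewrite inE => /eqP <-; split; apply/subsetP => y; rewrite !inE adjE.
    by rewrite orbC.
  by case/orP=> ->; rewrite ?orbT.
Qed.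
End BraidGraph.

Definition is_H (n : nat) (G : sgraph) : Prop :=
  exists k (B : 'I_k -> {set G}), empty_braid B /\
  [\/ n = 3 * k /\ (forall i, #|B i| = 3),
      n = 3 * k + 1 /\
        (exists i0, #|B i0| = 4 /\ forall i, i != i0 -> #|B i| = 3)
    | n = 3 * k - 1 /\
        (exists i0, #|B i0| = 2 /\ forall i, i != i0 -> #|B i| = 3)].

(* n is 3k, 3k + 1 or 3k - 1 with k = (n + 1) %/ 3; the exceptional cluster,
   if any, is the one of index 0. *)
Definition H_size (n : nat) (i : 'I_(n.+1 %/ 3)) : nat :=
  if (n %% 3 == 0) || (i != 0 :> nat) then 3
  else if n %% 3 == 1 then 4 else 2.

Definition H (n : nat) : sgraph := braid_graph (@H_size n).

Lemma H_is_H n : 8 <= n -> is_H n (H n).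
Proof.
move=> n8; have k3 : 3 <= n.+1 %/ 3 by rewrite (leq_div2r 3 (n8 : 9 <= n.+1)).
exists (n.+1 %/ 3), (cluster (@H_size n)); split.
  by apply: braid_graphP => // i; rewrite /H_size; case: ifP => // _; case: ifP.
pose i0 := Ordinal (ltn_trans (isT : 0 < 2) k3).
have sE i : i != i0 -> #|cluster (@H_size n) i| = 3.
  by rewrite card_cluster /H_size -val_eqE /= => ->; rewrite orbT.
have := divn_eq n.+1 3; have := ltn_pmod n (isT : 0 < 3).
have -> : n.+1 %% 3 = (n %% 3).+1 %% 3 by rewrite -addn1 -modnDml addn1.
case e: (n %% 3) => [|[|[|//]]] _ n1E.
- apply: Or31; split; last by move=> i; rewrite card_cluster /H_size e.
  by apply: succn_inj; rewrite {1}n1E addn1 mulnC.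
- apply: Or32; split; last by exists i0; split; rewrite ?card_cluster ?/H_size ?e.
  by apply: succn_inj; rewrite {1}n1E mulnC -[RHS]addnS.
- apply: Or33; split; last by exists i0; split; rewrite ?card_cluster ?/H_size ?e.
  by rewrite mulnC -[_ * 3]addn0 -n1E subn1.
Qed.

(* Main.v *)
(* Let p(n) be the largest product of positive integers with sum n; this is also the number of
   cycles of H_n meeting every cluster once. When an induced path is explored vertex by vertex,
   a step with d choices removes d vertices from those still available, so at most p(r) induced
   paths lead through r available vertices to a given target. Hence a graph on n vertices has
   at most 60 p(n) induced cycles, and a vertex of large degree lies on few of them.

   Suppose first that G has at least p(n) cycles and that each vertex lies on at least a sixth
   of them. Then degrees are bounded, and on most cycles all but a bounded number of steps have
   exactly three choices. By averaging, some stage of the exploration has no such defect nearby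
   on most of its continuations; rerouting these shows that G looks there like a long stretch of
   a braid with clusters of size 3. Almost all cycles run along the stretch, so the number of
   paths leaving one end and returning at the other is nearly maximal, which forces the vertices
   adjacent to the last cluster to form a new one. The stretch can thus be extended until it
   closes up, and G is a cyclic braid.

   A vertex on fewer than a sixth of the cycles can be deleted, which increases the ratio of
   the number of cycles to p(n) by a factor 10/9. As this ratio is bounded by 60, and is 1 + o(1)
   once no such vertex is left, large graphs with p(n) cycles have no such vertex.

   In a braid with small clusters the cycles of length at least 5 are the sets meeting each
   cluster once. The product of the cluster sizes is therefore nearly p(n), so that all sizes are
   3 except for one 4, one 2 or two 2s. Comparing the numbers of triangles and squares excludes
   edges inside clusters as well as two clusters of size 2. *)

Require Import Defs.
From mathcomp Require Import all_boot zify.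

Set Implicit Arguments.
Unset Strict Implicit.
Unset Printing Implicit Defensive.

(** * Maximal products *)

(** That defects are rare is the quantitative heart. Measured by p, a factor 2 or 4 may cost
    nothing, so the exploration is weighed with [smoothprod], which is within a constant factor of p
    but loses at least 1/42 of its value at every factor other than 3. By induction the total number
    of defects over F paths through r vertices is at most 84 times the square root of F * smoothprod
    r. When F is a constant fraction of p(r), this is a bounded number per path. A step with three
    choices of which one is almost dead also counts as a defect, so at every other step each choice
    carries a constant proportion of the paths.

    The exploration controls only edges to vertices still available. Edges back to discarded
    vertices are controlled by exploring the same cycle in the reverse direction as well.

    When the stretch is extended, the relative loss must not accumulate along the cycle: a best
    choice at each step keeps it below 1/2000, and any other choice multiplies it by at most 4. *)

Lemma ind3 (P : nat -> Prop) :
  P 0 -> P 1 -> P 2 -> (forall n, P n -> P n.+3) -> forall n, P n.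
Proof.
move=> P0 P1 P2 PS n; suff [] : [/\ P n, P n.+1 & P n.+2] by [].
by elim: n => // n [Pn Pn1 Pn2]; split=> //; apply: PS.
Qed.

(* The largest product of positive integers with sum n. *)
Fixpoint maxprod (n : nat) : nat :=
  if n is m.+3 then
    match m with 0 => 3 | 1 => 4 | _ => 3 * maxprod m end
  else maxn n 1.

Lemma maxprod3 n : 1 < n -> maxprod n.+3 = 3 * maxprod n.
Proof. by case: n => [|[]]. Qed.

Lemma maxprod3_le n : 3 * maxprod n <= maxprod n.+3.
Proof. by case: n => [|[|n]] //=; rewrite leqnn. Qed.

Lemma maxprod_gt0 n : 0 < maxprod n.
Proof. by elim/ind3: n => // n IH; have := maxprod3_le n; lia. Qed.

Lemma maxprodE n : 1 < n ->
  [\/ maxprod n = 3 * 3 ^ (n %/ 3).-1 /\ n %% 3 = 0, maxprod n = 4 * 3 ^ (n %/ 3).-1 /\ n %% 3 = 1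
    | maxprod n = 2 * 3 ^ (n %/ 3) /\ n %% 3 = 2].
Proof.
elim/ind3: n => //; first by constructor 3.
move=> n IH _; have [n1|n1] := leqP n 1.
  by case: n n1 IH => [|[|//]] _ _; [constructor 1 | constructor 2].
rewrite maxprod3 //; have -> : n.+3 %/ 3 = (n %/ 3).+1 by lia.
have -> : n.+3 %% 3 = n %% 3 by lia.
rewrite succnK; have [[-> e]|[-> e]|[-> e]] := IH n1; [constructor 1|constructor 2|constructor 3];
  split=> //; [| | by rewrite expnS; lia];
  by case E : (n %/ 3) => [|k] /=; rewrite ?expnS; lia.
Qed.

(** The ratio of consecutive values is 4/3 at positive multiples of 3 and at least 3/2 at other
    positive n, but it is 1 at 0. *)
Lemma maxprod_step n : 0 < n -> 4 * maxprod n <= 3 * maxprod n.+1.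
Proof.
elim/ind3: n => // n IH _; case: n IH => [|[|n]] IH //.
by rewrite (@maxprod3 n.+2) // (@maxprod3 n.+3) //; have := IH isT; lia.
Qed.

Lemma maxprod_mono m n : m <= n -> maxprod m <= maxprod n.
Proof.
move=> /subnKC <-; elim: (n - m) => [|d IH]; first by rewrite addn0.
rewrite addnS; apply: leq_trans IH _; case: (m + d) => // k.
by have := @maxprod_step k.+1 isT; lia.
Qed.

Lemma mul2_maxprod s : 2 * maxprod s <= maxprod s.+2.
Proof.
elim/ind3: s => // s IH; case: s IH => [|[|s]] // IH.
by rewrite (@maxprod3 s.+2) // (@maxprod3 s.+4) //; lia.
Qed.

(** A factor d >= 4 splits into 2 and d - 2 without loss, which leaves the factors up to 3. Thus a
    step with d choices is paid for by the d vertices that it removes. *)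
Lemma mul_maxprod d s : d * maxprod s <= maxprod (d + s).
Proof.
have [n] := ubnP d; elim: n d s => // n IH [|[|[|[|d]]]] s dn //.
- by rewrite mul1n; apply: maxprod_mono; lia.
- exact: mul2_maxprod.
- exact: maxprod3_le.
apply: leq_trans (_ : d.+2 * (2 * maxprod s) <= _); first by lia.
apply: leq_trans (leq_mul (leqnn _) (mul2_maxprod s)) _.
by have := IH d.+2 s.+2 _; rewrite !addSn !addnS; apply; lia.
Qed.

(** The same splitting gains here, because d / (2 (d - 2)) is at most 5/6 for d >= 5. *)
Lemma mul_maxprod_big d s : 4 < d -> 6 * (d * maxprod s) <= 5 * maxprod (d + s).
Proof.
move=> d5; have := mul_maxprod d.-2 s.+2; have := mul2_maxprod s.
have -> : d.-2 + s.+2 = d + s by lia.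
nia.
Qed.

(* A smoothed version of 20 * 3^(n/3): unlike for [maxprod], a factor d other
   than 3 always costs a constant factor. *)
Fixpoint smoothprod (n : nat) : nat :=
  match n with 0 => 20 | 1 => 28 | 2 => 41 | m.+3 => 3 * smoothprod m end.

Lemma smoothprod3 n : smoothprod n.+3 = 3 * smoothprod n.
Proof. by []. Qed.

Lemma smoothprod_le n : smoothprod n <= 28 * maxprod n.
Proof.
by elim/ind3: n => //= n IH; case: n IH => [|[|n]] //= IH; lia.
Qed.

Lemma maxprod_le_smooth n : maxprod n <= smoothprod n.
Proof. by elim/ind3: n => //= n IH; case: n IH => [|[|n]] //= IH; lia. Qed.

Lemma smoothprod_gt0 n : 0 < smoothprod n.
Proof. exact: leq_trans (maxprod_gt0 n) (maxprod_le_smooth n). Qed.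

(** For the ends of paths: n wasted vertices cost n, which has to be at most the square root of the
    smoothed product. *)
Lemma sqr_smoothprod n : n ^ 2 <= smoothprod n.
Proof.
suff H k : k.+4.+1 ^ 2 <= smoothprod k.+4.+1.
  by case: n => [|[|[|[|[|n]]]]] //; apply: H.
elim/ind3: k => // k IH; rewrite (smoothprod3 k.+4.+1).
by move: IH; rewrite !expnS expn0; move: (smoothprod _) => x; nia.
Qed.

(** The extreme case is d = 2 with s congruent to 2 modulo 3, where the ratio is 2 * 41 / (3 * 28) =
    41/42. For d >= 4 one splits off a factor 2 as before. *)
Lemma mul_smoothprod_aux d s :
  42 * (d * smoothprod s) <= 41 * smoothprod (d + s) \/
  d = 3 /\ d * smoothprod s <= smoothprod (d + s).
Proof.
have H1 t : 42 * smoothprod t <= 41 * smoothprod t.+1.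
  elim/ind3: t => // t IH; rewrite (smoothprod3 t) (smoothprod3 t.+1); lia.
have H2 t : 42 * (2 * smoothprod t) <= 41 * smoothprod t.+2.
  elim/ind3: t => // t IH; rewrite (smoothprod3 t) (smoothprod3 t.+2); lia.
have [n] := ubnP d; elim: n d s => // n IH [|[|[|[|d]]]] s dn.
- by left.
- by left; rewrite mul1n; apply: H1.
- by left; apply: H2.
- by right.
left; have := H2 s; have : d.+2 * smoothprod s.+2 <= smoothprod (d.+4 + s).
  have -> : d.+4 + s = d.+2 + s.+2 by lia.
  have [||[-> //]] := IH d.+2 s.+2 _; lia.
nia.
Qed.

Lemma mul_smoothprod d s : d * smoothprod s <= smoothprod (d + s).
Proof. by have [H|[_ H]] := mul_smoothprod_aux d s; last exact: H; move: (d * _) H => x; lia. Qed.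

Lemma mul_smoothprod_gap d s : d != 3 ->
  42 * (d * smoothprod s) <= 41 * smoothprod (d + s).
Proof. by have [|[->]] := mul_smoothprod_aux d s. Qed.

Lemma maxprod_grow j n : 0 < n -> 4 ^ j * maxprod n <= 3 ^ j * maxprod (j + n).
Proof.
move=> n0; elim: j => // j IH; have := @maxprod_step (j + n) (ltn_addl _ n0).
rewrite addSn !expnS; have : 0 < 3 ^ j by rewrite expn_gt0.
move: (3 ^ j) (4 ^ j) (maxprod n) (maxprod (j + n)) (maxprod _.+1) IH => a b c x y; nia.
Qed.

Lemma maxprod_drop3 j n : 3 ^ j * maxprod n <= maxprod (3 * j + n).
Proof.
elim: j => [|j IH]; first by rewrite expn0 mul1n muln0.
have -> : 3 * j.+1 + n = (3 * j + n).+3 by lia.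
by have := maxprod3_le (3 * j + n); rewrite expnS; lia.
Qed.

Lemma sqr_pow_le d : 2 * d ^ 2 * 3 ^ d <= 14 * 4 ^ d.
Proof.
suff H k : 2 * (k + 8) ^ 2 * 3 ^ (k + 8) <= 14 * 4 ^ (k + 8).
  have [d8|d8] := leqP 8 d; first by have := H (d - 8); rewrite subnK.
  by case: d d8 => [|[|[|[|[|[|[|[|//]]]]]]]] _; lia.
elim: k => [|k]; first by rewrite !add0n; lia.
rewrite addSn !(expnS 3) !(expnS 4) !(expnS _ 1) !expn1; move: (3 ^ _) (4 ^ _) => x y; nia.
Qed.

(** With n = d + 2, this compares the term C(n, 3) 3^(n - 3) in the expansion of (3 + 1)^n with 4^n;
    162 is 6 * 27. *)
Lemma cube_pow_le d : d.+2 * d.+1 * d * 3 ^ d.+2 <= 162 * 4 ^ d.+2.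
Proof.
suff H k : (k + 11) * (k + 10) * (k + 9) * 3 ^ (k + 11) <= 162 * 4 ^ (k + 11).
  have [d8|d8] := leqP 9 d.
    by have := H (d - 9); congr (_ * _ * _ * _ ^ _ <= _ * _ ^ _); lia.
  by case: d d8 => [|[|[|[|[|[|[|[|[|//]]]]]]]]] _; lia.
elim: k => [|k]; first by rewrite !add0n; lia.
rewrite !addSn !(expnS 3) !(expnS 4); move: (3 ^ _) (4 ^ _) => x y; nia.
Qed.

Lemma sqr_pow_lt c d : 162 * c + 10 <= d -> c * d ^ 2 * 3 ^ d < 4 ^ d.
Proof.
move=> cd; have := cube_pow_le d.-2; have : 0 < 3 ^ d by rewrite expn_gt0.
have -> : d.-2.+2 = d by lia.
have -> : d.-2.+1 = d.-1 by lia.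
rewrite (expnS _ 1) expn1; move: (3 ^ d) (4 ^ d) => x y x0.
suff : 162 * (c * (d * d)) < d * d.-1 * d.-2 by nia.
have : (162 * c + 1) * d < d.-1 * d.-2 by nia.
nia.
Qed.

(** Passing from n to n + 3 multiplies the left side by at most 3/2 once n >= 30, and the right side
    by at least 3. This makes the cycles of length at most 4 negligible. *)
Lemma quartic_lt_maxprod c : exists n0, forall n, n0 <= n -> c * n.+1 ^ 4 < maxprod n.
Proof.
have sq k : 29 < k -> 2 * k.+4 ^ 4 <= 3 * k.+1 ^ 4.
  move=> k29; rewrite -(subnK k29); move: (k - 30) => i.
  have -> : (i + 30).+4 = i + 34 by lia.
  have -> : (i + 30).+1 = i + 31 by lia.
  by rewrite !(expnS _ 3) !(expnS _ 2) !(expnS _ 1) !expn1; nia.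
have H j n : 30 <= n -> 2 ^ j * (c * (n + 3 * j).+1 ^ 4) <= 3 ^ j * (c * n.+1 ^ 4).
  move=> n30; elim: j => [|j IH]; first by rewrite muln0 addn0.
  have -> : n + 3 * j.+1 = (n + 3 * j).+3 by lia.
  have := sq (n + 3 * j) (leq_trans n30 (leq_addr _ _)); rewrite (expnS 2) (expnS 3).
  move: (2 ^ j) (3 ^ j) (_ ^ 4) ((n + _).+1 ^ 4) (n.+1 ^ 4) IH => a b x y z IH xy.
  have : a * c * (2 * x) <= a * c * (3 * y) by rewrite leq_mul2l xy orbT.
  nia.
exists (33 + 3 * (c * 33 ^ 4)) => n ngt.
(* [r] is the number among 30, 31, 32 that is congruent to n modulo 3. *)
set r := 30 + n %% 3; set j := (n - r) %/ 3.
have r33 : r < 33 by rewrite /r; have := ltn_pmod n (isT : 0 < 3); lia.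
have -> : n = r + 3 * j by rewrite /j /r; lia.
have jc : c * 33 ^ 4 < 2 ^ j.
  apply: leq_trans (ltn_expl (c * 33 ^ 4) (isT : 1 < 2)) _; rewrite leq_pexp2l //.
  by rewrite /j; move: (c * 33 ^ 4) ngt => u ngt; lia.
have := H j r (leq_addr _ _); have := maxprod_drop3 j r; rewrite [3 * j + r]addnC.
have : c * r.+1 ^ 4 <= c * 33 ^ 4 by rewrite leq_mul2l leq_exp2r // r33 orbT.
have := maxprod_gt0 r; have : 0 < 2 ^ j by rewrite expn_gt0.
have e3 : 0 < 3 ^ j by rewrite expn_gt0.
move: (2 ^ j) (3 ^ j) (maxprod r) (maxprod _) jc e3 => a b x y.
move: (c * _ ^ 4) (c * r.+1 ^ 4) (c * _) => u v w; nia.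
Qed.

(** * Induced cycles and induced paths *)

(** [cyclic_adj] on natural numbers, for indices into sequences of varying length. *)
Definition cyc_adj (l i j : nat) : bool := (i.+1 %% l == j) || (j.+1 %% l == i).

Lemma succ_modE l i : i < l -> i.+1 %% l = if i.+1 == l then 0 else i.+1.
Proof. by move=> il; case: eqP => [->|ne]; rewrite ?modnn // modn_small //; lia. Qed.

Lemma cyc_adjE l i j : i < l -> j < l ->
  cyc_adj l i j = [|| j == i.+1, i == j.+1, (i == 0) && (j.+1 == l) | (j == 0) && (i.+1 == l)].
Proof. by move=> il jl; rewrite /cyc_adj !succ_modE //; case: (i.+1 =P l) => ?; case: (j.+1 =P l) => ?; lia. Qed.

Section Cycles.
Variable G : sgraph.
Implicit Types (S T R : {set G}) (u v w x y : G) (c s : seq G).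

(** As a sequence, a cycle can be started at any vertex by rotation, run backwards and cut open into
    an induced path. *)
Definition icycle c : Prop :=
  [/\ 2 < size c, uniq c & forall x0 i j, i < size c -> j < size c ->
      edge (nth x0 c i) (nth x0 c j) = cyc_adj (size c) i j].

Lemma edgeC x y : edge x y = edge y x. Proof. exact: edge_sym. Qed.
Lemma edgexx x : edge x x = false. Proof. exact: edge_irrefl. Qed.

Lemma induced_cycleP S :
  reflect (exists2 c, icycle c & S = [set x in c]) (induced_cycle S).
Proof.
apply: (iffP andP) => [[S3 /existsP [f /and3P [/injectiveP injf /eqP fS /forallP adj]]]|].
  exists (codom f); last first.
    apply/setP => x; have /setP/(_ x) := fS; rewrite inE => <-.
    by apply/imsetP/codomP => [[i _ ->]|[i ->]]; exists i.
  have sz : size (codom f) = #|S| by rewrite size_codom card_ord.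
  split; rewrite ?sz //; first exact/injectiveP.
  move=> x0 i j il jl; pose i' := Ordinal il; pose j' := Ordinal jl.
  have nthE (k : 'I_#|S|) : nth x0 (codom f) k = f k.
    by rewrite codomE (nth_map k) ?size_enum_ord // nth_ord_enum.
  by rewrite (nthE i') (nthE j'); move/forallP: (adj i') => /(_ j') /eqP ->.
case=> c [c3 uc adj] defS.
have cS : #|S| = size c by rewrite defS cardsE; apply/card_uniqP.
split; first by rewrite cS.
have x0 : G by case: c c3 {uc adj defS cS}.
apply/existsP; exists [ffun i : 'I_#|S| => nth x0 c i]; apply/and3P; split.
- apply/injectiveP => i j; rewrite !ffunE => /eqP.
  rewrite nth_uniq -?cS ?ltn_ord // => /eqP; exact: val_inj.
- have inS y : (y \in S) = (y \in c) by rewrite defS inE.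
  apply/eqP/setP => x; rewrite inS; apply/imsetP/idP => [[i _ ->]|xc].
    by rewrite ffunE mem_nth // -cS.
  have xi : index x c < #|S| by rewrite cS index_mem.
  by exists (Ordinal xi); rewrite // ffunE /= nth_index.
- apply/forallP => i; apply/forallP => j; rewrite !ffunE adj -?cS //.
Qed.

Lemma icycle_rot1 c : icycle c -> icycle (rot 1 c).
Proof.
case=> c3 uc adj; split; rewrite ?size_rot ?rot_uniq // => x0 i j il jl.
have nthE k : k < size c -> nth x0 (rot 1 c) k = nth x0 c (k.+1 %% size c).
  case: c {c3 uc adj il jl} => // a c kl; rewrite succ_modE //= rot1_cons nth_rcons eqSS.
  move: kl; rewrite ltnS leq_eqVlt => /predU1P [->|kl]; first by rewrite ltnn eqxx.
  by rewrite kl (ltn_eqF kl).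
have lt k : k < size c -> k.+1 %% size c < size c by move=> kl; rewrite ltn_mod; lia.
rewrite !nthE // adj ?lt // !cyc_adjE ?lt // !succ_modE //.
move: c3 il jl; move: (size c) => l l3 il jl; clear -l3 il jl.
by case: (i.+1 =P l) => ?; case: (j.+1 =P l) => ?; lia.
Qed.

Lemma icycle_rot k c : icycle c -> icycle (rot k c).
Proof.
have [kl|kl] := leqP k (size c); last by rewrite rot_oversize // ltnW.
elim: k kl => [|k IH] kl ic; first by rewrite rot0.
by rewrite -addn1 addnC rotD ?addn1 //; apply/icycle_rot1/IH => //; apply: ltnW.
Qed.

Lemma icycle_rev c : icycle c -> icycle (rev c).
Proof.
case=> c3 uc adj; split; rewrite ?size_rev ?rev_uniq // => x0 i j il jl.
rewrite !nth_rev // adj; try lia.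
by rewrite !cyc_adjE; lia.
Qed.

Lemma icycle_from S x : induced_cycle S -> x \in S ->
  exists2 c, icycle (x :: c) & S = [set y in x :: c].
Proof.
move=> /induced_cycleP [c ic ->]; rewrite inE => xc.
have := icycle_rot (index x c) ic; set k := index x c.
have rotE : rot k c = x :: (drop k.+1 c ++ take k c) := rot_index xc.
rewrite rotE => icr; exists (drop k.+1 c ++ take k c) => //.
by apply/setP => y; rewrite !inE -(mem_rot k c) rotE inE.
Qed.

(** In the cycle cut open at x, a neighbour of x stands at one of the two ends; reversing the rest
    exchanges them. *)
Lemma icycle_from_last S x y : induced_cycle S -> x \in S -> y \in S -> edge x y ->
  exists c, [/\ icycle (x :: c), S = [set z in x :: c] & last x c = y].
Proof.
move=> icS xS yS xy; have [c ic SE] := icycle_from icS xS.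
have [c3 uc adj] := ic; have ne : x != y by apply: contraTneq xy => ->; rewrite edgexx.
have yc : y \in c by move: yS; rewrite SE !inE eq_sym (negPf ne).
have il : (index y c).+1 < size (x :: c) by rewrite /= ltnS index_mem.
have := adj x 0 (index y c).+1 isT il; rewrite /= nth_index // xy => /esym.
rewrite cyc_adjE // => H.
have [e|e] : index y c = 0 \/ (index y c).+1 = size c by move: H; rewrite /=; lia.
  exists (rev c); split.
  - have -> : x :: rev c = rotr 1 (rev (x :: c)) by rewrite rev_cons rotr1_rcons.
    by rewrite /rotr; apply/icycle_rot/icycle_rev.
  - by rewrite SE; apply/setP => z; rewrite !inE mem_rev.
  - case: c yc e {ic SE c3 uc adj il H} => //= a c _.
    by case: eqP => // <- _; rewrite rev_cons last_rcons.
exists c; split=> //.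
by rewrite (last_nth x) -e /= nth_index.
Qed.

Definition ipath c : Prop := uniq c /\
  forall x0 i j, i < j -> j < size c -> edge (nth x0 c i) (nth x0 c j) = (j == i.+1).

Lemma ipath1 x : ipath [:: x].
Proof. by split=> // x0 [|i] [|j]. Qed.

Lemma ipath_cons u a s :
  ipath [:: u, a & s] <-> [/\ u \notin a :: s, edge u a, (forall y, y \in s -> ~~ edge u y) & ipath (a :: s)].
Proof.
split=> [[/= /andP [us uas] adj]|[us ua nus [uas adj]]].
  split=> //; first by apply: (adj u 0 1).
    move=> y ys; have := adj u 0 (index y s).+2 isT.
    by rewrite /= nth_index // !ltnS index_mem => ->.
  by split=> // x0 i j ij jl; have := adj x0 i.+1 j.+1 ij jl; rewrite /= eqSS.
split; first by rewrite cons_uniq us.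
move=> x0 [|i] [|j] //=; last by rewrite !ltnS eqSS; apply: adj.
move=> _; case: j => [|j] //=; rewrite !ltnS => jl.
by apply/negbTE/nus/mem_nth.
Qed.

Lemma ipath_rev c : ipath c -> ipath (rev c).
Proof.
case=> uc adj; split; rewrite ?rev_uniq // => x0 i j ij; rewrite size_rev => jl.
rewrite !nth_rev //; try lia.
rewrite edgeC adj; try lia.
Qed.

(** * Induced paths into a target set *)

(** Discarding all of [nbhd u] when leaving u keeps the path induced. The choice a is among the
    discarded vertices, so #|R| is enough fuel. *)
Fixpoint ipaths_fuel k T R u : seq (seq G) :=
  if k is k'.+1 then
    flatten [seq (if a \in T then [:: [:: a]]
                  else [seq a :: s | s <- ipaths_fuel k' T (R :\: nbhd u) a])
            | a <- enum (nbhd u :&: R)]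
  else [::].

(* The induced paths u, s_1, .., s_m whose vertices other than u lie in R, and
   whose only vertex in T, besides possibly u, is s_m. *)
Definition ipaths T R u := ipaths_fuel #|R| T R u.

Definition npaths T R u := size (ipaths T R u).

Definition npaths_via T R u a := if a \in T then 1 else npaths T (R :\: nbhd u) a.

Lemma card_residual R u a : a \in nbhd u :&: R -> #|R :\: nbhd u| < #|R|.
Proof.
rewrite inE => /andP [au aR]; apply/proper_card/properP.
by split; [apply: subsetDl | exists a; rewrite // inE au].
Qed.

Lemma ipaths_fuelE k T R u : #|R| <= k -> ipaths_fuel k T R u = ipaths T R u.
Proof.
rewrite /ipaths; have [n] := ubnP k; elim: n k R u => // n IH [|k] R u kn Rk.
  by move: Rk; rewrite leqn0 => /eqP ->.
case E: #|R| => [|r] /=.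
  by move/eqP: E; rewrite cards_eq0 => /eqP ->; rewrite setI0 enum_set0.
congr flatten; apply/eq_in_map => a; rewrite mem_enum => aA.
have lt := card_residual aA.
case: ifP => // _; congr map; rewrite IH; [|lia|lia].
by rewrite [RHS]IH //; lia.
Qed.

Lemma ipathsE T R u :
  ipaths T R u =
  flatten [seq (if a \in T then [:: [:: a]] else [seq a :: s | s <- ipaths T (R :\: nbhd u) a])
          | a <- enum (nbhd u :&: R)].
Proof.
rewrite -(@ipaths_fuelE #|R|.+1) //=; congr flatten; apply/eq_in_map => a.
rewrite mem_enum => aA; case: ifP => // _.
by rewrite ipaths_fuelE // ltnW // (card_residual aA).
Qed.

Lemma big_ipaths (X : seq G -> nat) T R u :
  \sum_(s <- ipaths T R u) X s =
  \sum_(a in nbhd u :&: R) (if a \in T then X [:: a]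
                            else \sum_(s <- ipaths T (R :\: nbhd u) a) X (a :: s)).
Proof.
rewrite ipathsE big_flatten /= big_map -[RHS]big_enum /=; apply: eq_bigr => a _.
by case: ifP => _; rewrite ?big_seq1 // big_map.
Qed.

Lemma npathsE T R u : npaths T R u = \sum_(a in nbhd u :&: R) npaths_via T R u a.
Proof.
rewrite /npaths -sum1_size big_ipaths; apply: eq_bigr => a _.
by rewrite /npaths_via /npaths -(sum1_size (ipaths _ _ a)); case: ifP.
Qed.

Lemma mem_ipaths_cons T R u a s :
  (a :: s \in ipaths T R u) =
  (a \in nbhd u :&: R) && (if a \in T then s == [::] else s \in ipaths T (R :\: nbhd u) a).
Proof.
rewrite ipathsE; apply/flatten_mapP/andP => [[b]|[aA H]].
  rewrite mem_enum => bA; case: ifP => bT.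
    by rewrite inE => /eqP [-> ->]; rewrite bT.
  by case/mapP => t ts [-> ->]; rewrite bT.
exists a; rewrite ?mem_enum //; case: ifP H => _ H; first by rewrite (eqP H) inE.
by apply/mapP; exists s.
Qed.

Lemma nil_ipaths T R u : ([::] \in ipaths T R u) = false.
Proof.
rewrite ipathsE; apply/flatten_mapP => -[a _]; case: ifP => _ //.
by case/mapP.
Qed.

Lemma ipaths_uniq T R u : uniq (ipaths T R u).
Proof.
have [n] := ubnP #|R|; elim: n R u => // n IH R u Rn; rewrite ipathsE.
have H a t : t \in (if a \in T then [:: [:: a]]
    else [seq a :: s | s <- ipaths T (R :\: nbhd u) a]) -> exists s, t = a :: s.
  by case: ifP => _; [rewrite inE => /eqP ->; exists [::] | case/mapP => s _ ->; exists s].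
have {}IH a : a \in enum (nbhd u :&: R) -> uniq (if a \in T then [:: [:: a]]
    else [seq a :: s | s <- ipaths T (R :\: nbhd u) a]).
  rewrite mem_enum => aA; case: ifP => _ //; rewrite map_inj_uniq; last by move=> ? ? [].
  by apply: IH; have := card_residual aA; lia.
have := enum_uniq (nbhd u :&: R); elim: (enum _) IH => //= a l IHl IH /andP [al ul].
rewrite cat_uniq IH ?mem_head // IHl ?andbT //=; last by move=> b bl; apply: IH; rewrite inE bl orbT.
apply/hasPn => t /flatten_mapP [b bl /H [s ->]]; apply/negP => /H [s' [ba _]].
by move: al; rewrite -ba bl.
Qed.

(** If u were available, an enumerated sequence could return to it, as u is not in [nbhd u]. *)
Lemma mem_ipaths T R u s : u \notin R ->
  s \in ipaths T R u <->
  [/\ s != [::], {subset s <= R}, (forall x, x \in s -> (x \in T) = (x == last u s)) & ipath (u :: s)].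
Proof.
elim: s R u => [|a s IH] R u uR; first by rewrite nil_ipaths; split=> [//|[]].
rewrite mem_ipaths_cons.
have aR' : a \in nbhd u :&: R -> a \notin R :\: nbhd u by rewrite !inE => /andP [->].
split=> [/andP [aA]|[_ sR sT /ipath_cons [us ua nus ips]]].
  have : a \in R by case/setIP: aA.
  have ua : edge u a by move: aA; rewrite !inE => /andP [].
  move=> aR; case: ifP => aT.
    move/eqP => ->; split=> //= [x|x|]; try by rewrite inE => /eqP ->; rewrite ?aT ?eqxx.
    apply/ipath_cons; split=> //; last exact: ipath1.
    by rewrite inE; apply: contraTneq ua => ->; rewrite edgexx.
  move=> /(IH _ _ (aR' aA)) [sn sR' sT ips].
  have sR x : x \in s -> (x \in R) /\ ~~ edge u x by move=> /sR'; rewrite !inE => /andP [].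
  split=> // [x|x|].
  - by rewrite inE => /predU1P [-> //|/sR []].
  - rewrite inE => /predU1P [->|]; last exact: sT.
    rewrite aT; case: s sn {sT sR sR' IH} ips => //= b s _ [/= /andP [+ _] _].
    by case: eqP => // ->; rewrite mem_last.
  - apply/ipath_cons; split=> //; last by move=> y /sR [].
    by apply: contra uR; rewrite inE => /predU1P [-> //|/sR []].
have aA : a \in nbhd u :&: R by rewrite !inE ua sR // mem_head.
rewrite aA /=; case: ifP => aT.
  move: (sT a (mem_head _ _)); rewrite aT /=; case: s ips {sT nus us IH sR} => //= b s [/= /andP [+ _] _].
  by move=> nab /esym /eqP e; move: nab; rewrite e mem_last.
apply/IH; first exact: aR'.
split=> //.
- by apply: contraFneq aT => s0; rewrite sT ?mem_head // s0.
- by move=> x xs; rewrite !inE sR ?inE ?xs ?orbT // nus.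
- by move=> x xs; apply: sT; rewrite inE xs orbT.
Qed.

(** The bound b is abstract in order to serve both [maxprod] and [smoothprod]. *)
Lemma npaths_le (b : nat -> nat) T R u :
  (forall r, 0 < b r) -> (forall d r, d * b r <= b (d + r)) -> npaths T R u <= b #|R|.
Proof.
move=> b0 bM; have [n] := ubnP #|R|; elim: n R u => // n IH R u Rn.
rewrite npathsE -(cardsID (nbhd u) R) [R :&: _]setIC; apply: leq_trans (bM _ _).
rewrite -sum_nat_const; apply: leq_sum => a aA; rewrite /npaths_via; case: ifP => // _.
by apply: IH; have := card_residual aA; lia.
Qed.

Lemma npaths_via_le (b : nat -> nat) T R u a :
  (forall r, 0 < b r) -> (forall d r, d * b r <= b (d + r)) ->
  npaths_via T R u a <= b #|R :\: nbhd u|.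
Proof. by move=> b0 bM; rewrite /npaths_via; case: ifP => // _; apply: npaths_le. Qed.

Lemma npaths_maxprod T R u : npaths T R u <= maxprod #|R|.
Proof. by apply: npaths_le; [apply: maxprod_gt0 | apply: mul_maxprod]. Qed.

Lemma npaths_smooth T R u : npaths T R u <= smoothprod #|R|.
Proof. by apply: npaths_le; [apply: smoothprod_gt0 | apply: mul_smoothprod]. Qed.

End Cycles.

Lemma card_le_list (T : finType) (A : {set T}) (U : Type) (l : seq U) (g : U -> T) :
  (forall x, x \in A -> x \in [seq g t | t <- l]) -> #|A| <= size l.
Proof.
move=> H; rewrite cardE -(size_map g); apply: uniq_leq_size; first exact: enum_uniq.
by move=> x; rewrite mem_enum; apply: H.
Qed.

(** * Defective steps *)

(** The inequality for all p and q is X <= 84 sqrt(F b) written without roots. For p F > q b it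
    follows from the instance p = b, q = F, because (p - q)(p F - q b) >= 0. *)
Lemma amgm_extend F b X : 0 < F -> F <= b ->
  (forall p q, p * F <= q * b -> 2 * p * q * X <= 84 * (p ^ 2 * F + q ^ 2 * b)) ->
  forall p q, 2 * p * q * X <= 84 * (p ^ 2 * F + q ^ 2 * b).
Proof.
move=> F0 Fb H p q; have [|lt] := leqP (p * F) (q * b); first exact: H.
have X42 : X <= 42 * (b + F).
  have := H b F; rewrite mulnC leqnn => /(_ isT); rewrite !expnS !expn0 => H1.
  have : b * F * (2 * X) <= b * F * (2 * (42 * (b + F))) by lia.
  by rewrite leq_pmul2l ?muln_gt0; lia.
have qp : q <= p.
  rewrite leqNgt; apply/negP => pq.
  by move: lt; rewrite ltnNge (leq_mul (ltnW pq) Fb).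
have : p * q * (b + F) <= p ^ 2 * F + q ^ 2 * b.
  rewrite !expnS !expn0; have [k pE] : exists k, p = q + k by exists (p - q); lia.
  have : k * (q * b) <= k * (p * F) by rewrite leq_mul2l ltnW ?orbT.
  by rewrite pE; nia.
have : p * q * X <= p * q * (42 * (b + F)) by rewrite leq_mul2l X42 orbT.
lia.
Qed.

Section Cost.
Variable G : sgraph.
Implicit Types (S T R : {set G}) (u v w x y : G) (c s : seq G).

(* A step of the path exploration that cannot be repeated often: it offers a
   number of choices other than 3, or a choice with few completions. *)
Definition defective T R u : bool :=
  (#|nbhd u :&: R| != 3) ||
  [exists a in nbhd u :&: R, 100 * npaths_via T R u a < npaths T R u].

(* Weighted count of the defective steps of a path and of the vertices that
   are neither on it nor adjacent to one of its vertices before the last. *)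
Fixpoint cost (om : G -> nat) T R u s : nat :=
  if s is a :: s' then
    defective T R u * om u +
    (if a \in T then \sum_(w in R :\: nbhd u) om w else cost om T (R :\: nbhd u) a s')
  else 0.

Definition tcost om T R u := \sum_(s <- ipaths T R u) cost om T R u s.

Definition tcost_via om T R u a :=
  if a \in T then \sum_(w in R :\: nbhd u) om w else tcost om T (R :\: nbhd u) a.

Lemma tcostE om T R u :
  tcost om T R u = defective T R u * om u * npaths T R u + \sum_(a in nbhd u :&: R) tcost_via om T R u a.
Proof.
rewrite /tcost big_ipaths npathsE big_distrr -big_split; apply: eq_bigr => a _ /=.
rewrite /tcost_via /npaths_via; case aT: (a \in T); first by rewrite muln1.
by rewrite big_split /= big_const_seq count_predT iter_addn_0.
Qed.

(** In root form the bound is 84 sqrt(F b). Using the same p and q for all choices amounts to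
    Cauchy-Schwarz and preserves it. At a defect with other than 3 choices, the factor 41/42 turns
    84 q^2 b into 82 q^2 b, and the remaining 2 q^2 b pays for the defect; hence 84 = 2 * 42. *)
Lemma tcost_smooth T R u p q :
  2 * p * q * tcost (fun=> 1) T R u <= 84 * (p ^ 2 * npaths T R u + q ^ 2 * smoothprod #|R|).
Proof.
have [n] := ubnP #|R|; elim: n R u p q => // n IH R u p q Rn.
set A := nbhd u :&: R; set b' := smoothprod #|R :\: nbhd u|; set b := smoothprod #|R|.
set F := npaths T R u; set F_ := npaths_via T R u; set t_ := tcost_via (fun=> 1) T R u.
have FE : F = \sum_(a in A) F_ a := npathsE T R u.
have child a (x y : nat) : a \in A -> 2 * x * y * t_ a <= 84 * (x ^ 2 * F_ a + y ^ 2 * b').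
  move=> aA; rewrite /t_ /F_ /tcost_via /npaths_via; case: ifP => _; last first.
    by apply: IH; have := card_residual aA; lia.
  rewrite sum1_card; have := sqr_smoothprod #|R :\: nbhd u|; rewrite -/b'.
  move: #|_| => r rb; have : y ^ 2 * r ^ 2 <= y ^ 2 * b' by rewrite leq_mul2l rb orbT.
  have := (nat_Cauchy x (y * r)).1; rewrite expnMn; lia.
have cardR : #|A| + #|R :\: nbhd u| = #|R| by rewrite -(cardsID (nbhd u) R) /A setIC.
have db : #|A| * b' <= b by rewrite /b -cardR mul_smoothprod.
have sums (x y : nat) : 2 * x * y * (\sum_(a in A) t_ a) <= 84 * (x ^ 2 * F + y ^ 2 * (#|A| * b')).
  rewrite big_distrr /= FE; apply: (@leq_trans (\sum_(a in A) 84 * (x ^ 2 * F_ a + y ^ 2 * b'))).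
    by apply: leq_sum => a aA; apply: child.
  by rewrite -big_distrr /= big_split /= -big_distrr /= sum_nat_const; lia.
have := tcostE (fun=> 1) T R u; rewrite muln1 -/F => ->.
have Fb : F <= b := npaths_smooth T R u.
case def: (defective T R u); last first.
  rewrite mul0n add0n; apply: leq_trans (sums p q) _.
  by rewrite leq_mul2l leq_add2l leq_mul2l db !orbT.
rewrite mul1n; have [F0|F0] := posnP F.
  have A0 a : a \in A -> t_ a = 0.
    move=> aA; have Fa0 : F_ a = 0.
      by apply/eqP; rewrite -leqn0 -F0 FE (bigD1 a) //= leq_addr.
    have := child a (84 * b').+1 1 aA; rewrite Fa0 muln0 add0n exp1n; nia.
  by rewrite F0 add0n big1 ?muln0.
(* The restriction to p F <= q b bounds the price 2 p q F of the defect at u by 2 q^2 b. *)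
apply: amgm_extend => // {}p {}q pq.
have pqF : 2 * p * q * F <= 2 * (q ^ 2 * b).
  have : q * (p * F) <= q * (q * b) by rewrite leq_mul2l pq orbT.
  by rewrite !expnS expn0; lia.
rewrite mulnDr; set Sm := \sum_(a in A) t_ a.
suff : 2 * p * q * Sm <= 84 * (p ^ 2 * F) + 82 * (q ^ 2 * b) by lia.
have [d3|d3] := eqVneq #|A| 3; last first.
  have := sums p q; rewrite -/Sm; have : 42 * (#|A| * b') <= 41 * b.
    by rewrite /b -cardR; apply: mul_smoothprod_gap.
  move=> gap; have : q ^ 2 * (42 * (#|A| * b')) <= q ^ 2 * (41 * b) by rewrite leq_mul2l gap orbT.
  lia.
move: def; rewrite /defective -/A d3 /= => /existsP [a1 /andP [a1A small]].
have F1 : F = F_ a1 + \sum_(a in A | a != a1) F_ a by rewrite FE (bigD1 a1).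
have S1 : Sm = t_ a1 + \sum_(a in A | a != a1) t_ a by rewrite /Sm (bigD1 a1).
(* Uneven weights exploit the small choice [a1]: since it has fewer than F / 100 paths, the p-terms
   add up to at most 84 (1/11 + 10/11) p^2 F, and the q-terms to at most 84 * 0.77 q^2 b. *)
set x := 10 * p; set y := 11 * q.
have c1 := child a1 (10 * x) y a1A.
have c2 : 2 * x * y * (\sum_(a in A | a != a1) t_ a)
          <= 84 * (x ^ 2 * (\sum_(a in A | a != a1) F_ a) + y ^ 2 * (2 * b')).
  rewrite big_distrr /=.
  apply: (@leq_trans (\sum_(a in A | a != a1) 84 * (x ^ 2 * F_ a + y ^ 2 * b'))).
    by apply: leq_sum => a /andP [aA _]; apply: child.
  rewrite -big_distrr /= big_split /= -big_distrr /= sum_nat_const.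
  have -> : #|[pred a in A | a != a1]| = 2; last by lia.
  have := cardsD1 a1 A; rewrite a1A d3 => -[e]; rewrite [RHS]e; apply: eq_card => a.
  by rewrite !inE andbC.
rewrite S1; move: F1 small c1 c2; rewrite -/F -/(F_ a1).
rewrite d3 in db; move: (\sum_(a in A | _) F_ a) (\sum_(a in A | _) t_ a) (t_ a1) (F_ a1).
rewrite /x /y !expnS !expn0 => Fo to t1 f1 F1 small c1 c2.
have h1 : p * p * (100 * f1) <= p * p * F by rewrite leq_mul2l ltnW ?orbT.
have h2 : q * q * (3 * b') <= q * q * b by rewrite leq_mul2l db orbT.
lia.
Qed.

(** Take p = k and q = 1. F is only an upper bound for the number of paths, so that one F serves all
    starting vertices. *)
Lemma tcost_le T R u k F : npaths T R u <= F ->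
  smoothprod #|R| <= k ^ 2 * F -> tcost (fun=> 1) T R u <= 84 * k * F.
Proof.
have [->|k0] := posnP k; first by have := smoothprod_gt0 #|R|; lia.
have := tcost_smooth T R u k 1; rewrite exp1n mul1n muln1.
move: (tcost _ _ _ _) (npaths _ _ _) (smoothprod _) => t F' b h1 hF h2.
have h3 : k ^ 2 * F' <= k ^ 2 * F by rewrite leq_mul2l hF orbT.
have : 2 * k * t <= 2 * k * (84 * k * F) by rewrite !expnS expn0 in h1 h2 h3 *; lia.
by rewrite leq_pmul2l; lia.
Qed.

End Cost.

(** * Prefixes of explored paths *)

Section Prefixes.
Variable G : sgraph.
Implicit Types (S T R : {set G}) (u v w x y : G) (c s : seq G).

Lemma npaths_defective T R u a :
  ~~ defective T R u -> a \in nbhd u :&: R -> npaths T R u <= 100 * npaths_via T R u a.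
Proof.
rewrite negb_or => /andP [_ /existsPn /(_ a)] + aA.
by rewrite aA /= -leqNgt.
Qed.

Lemma card_defective T R u : ~~ defective T R u -> #|nbhd u :&: R| = 3.
Proof. by rewrite negb_or negbK => /andP [/eqP]. Qed.

(* The vertices available after the path s has been followed from u. *)
Fixpoint residual R u s : {set G} :=
  if s is a :: s' then residual (R :\: nbhd u) a s' else R.

Lemma mem_residual R u s w : (w \in residual R u s) = (w \in R) && ~~ has (edge w) (belast u s).
Proof.
elim: s R u => [|a s IH] R u /=; first by rewrite andbT.
by rewrite IH !inE negb_or [edge u w]edgeC andbCA andbA.
Qed.

Lemma ipaths_cat T R u s t : s ++ t \in ipaths T R u -> t != [::] ->
  t \in ipaths T (residual R u s) (last u s).
Proof.
elim: s R u => //= a s IH R u; rewrite mem_ipaths_cons => /andP [_].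
case: ifP => _; last by apply: IH.
by rewrite -size_eq0 size_cat addn_eq0 !size_eq0 => /andP [_ ->].
Qed.

Lemma cost_cat om T R u s t : s ++ t \in ipaths T R u -> t != [::] ->
  cost om T (residual R u s) (last u s) t <= cost om T R u (s ++ t).
Proof.
elim: s R u => //= a s IH R u; rewrite mem_ipaths_cons => /andP [_].
case: ifP => [_|_ H tn].
  by rewrite -size_eq0 size_cat addn_eq0 !size_eq0 => /andP [_ ->].
by apply: leq_trans (IH _ _ H tn) (leq_addl _ _).
Qed.

Lemma leq_cost om om' T R u s : (forall w, om w <= om' w) ->
  cost om T R u s <= cost om' T R u s.
Proof.
move=> le; elim: s R u => //= a s IH R u; apply: leq_add; first by rewrite leq_mul2l le orbT.
by case: ifP => _ //; apply: leq_sum.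
Qed.

Lemma cost_sum (I : Type) (l : seq I) (om : I -> G -> nat) T R u s :
  \sum_(i <- l) cost (om i) T R u s = cost (fun w => \sum_(i <- l) om i w) T R u s.
Proof.
elim: s R u => [|a s IH] R u /=; first by rewrite big1.
rewrite big_split /= -big_distrr /=; congr (_ + _); case: ifP => _ //.
by rewrite exchange_big.
Qed.

Lemma cost_scale k T R u s : cost (fun=> k) T R u s = k * cost (fun=> 1) T R u s.
Proof.
elim: s R u => [|a s IH] R u /=; first by rewrite muln0.
by rewrite mulnDr muln1 IH mulnC; case: ifP => _ //; rewrite !sum_nat_const muln1 [#|_| * k]mulnC.
Qed.

Section Degree.
Variables (D : nat) (degD : forall x, #|nbhd x| <= D).

Lemma card_step T R u : #|R| <= #|R :\: nbhd u| + 3 + D * defective T R u.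
Proof.
have := cardsID (nbhd u) R; rewrite setIC; case def: (defective T R u) => /=; last first.
  by rewrite (card_defective (negbT def)); lia.
have := subset_leq_card (subsetIl (nbhd u) R); have := degD u; lia.
Qed.

Lemma residual_card_le T R u s t : s ++ t \in ipaths T R u ->
  #|R| <= #|residual R u s| + 3 * size s + D * cost (fun=> 1) T R u (s ++ t).
Proof.
elim: s R u => [|a s IH] R u /=; first by lia.
rewrite mem_ipaths_cons => /andP [_]; have := card_step T R u; case: (a \in T) => [h|h /IH]; last by lia.
rewrite -size_eq0 size_cat addn_eq0 !size_eq0 => /andP [/eqP -> _] /=.
by rewrite sum1_card; lia.
Qed.

End Degree.

(** Together with [residual_card_le] and [residual_waste] this fixes the length of a path as a third
    of #|R|, up to a multiple of its cost. *)
Lemma size_ipaths_le T R u s : s \in ipaths T R u ->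
  3 * size s <= #|R| + 3 * cost (fun=> 1) T R u s.
Proof.
elim: s R u => [|a s IH] R u //=; rewrite mem_ipaths_cons => /andP [_] H.
have {}IH : 3 * size s <= #|R :\: nbhd u| +
    3 * (if a \in T then \sum_(w in R :\: nbhd u) 1 else cost (fun=> 1) T (R :\: nbhd u) a s).
  by move: H; case: ifP => _; [move/eqP-> | apply: IH].
have := cardsID (nbhd u) R; rewrite setIC; case def: (defective T R u) => /=; last first.
  by rewrite (card_defective (negbT def)); lia.
by lia.
Qed.

Lemma residual_waste T R u s : s \in ipaths T R u ->
  #|residual R u s| <= cost (fun=> 1) T R u s.
Proof.
elim: s R u => [|a s IH] R u; first by rewrite nil_ipaths.
rewrite mem_ipaths_cons /= => /andP [_]; case: ifP => [_ /eqP ->|_ /IH h].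
  by rewrite sum1_card leq_addl.
exact: leq_trans h (leq_addl _ _).
Qed.

(** * Paths through a vertex *)

(* Appending v0 to v1 :: s turns these paths into the induced cycles through v0 with
   first edge v0 v1. *)
Definition cpaths v0 v1 := ipaths (nbhd v0) (~: [set v0; v1]) v1.

Definition ends_at v0 c : Prop :=
  [/\ 1 < size c, v0 \notin c, forall x, x \in c -> edge v0 x = (x == head v0 c) || (x == last v0 c)
    & ipath c].

Lemma cpathsP v0 v1 s : v1 \in nbhd v0 ->
  s \in cpaths v0 v1 <-> ends_at v0 (v1 :: s).
Proof.
rewrite inE => v01; rewrite /cpaths; have v1R : v1 \notin ~: [set v0; v1] by rewrite !inE eqxx orbT.
rewrite (mem_ipaths _ _ v1R); split=> [[sn sR sT ips]|[sz v0s sT ips]].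
  have sR' x : x \in s -> x != v0 /\ x != v1.
    by move=> /sR; rewrite !inE negb_or => /andP [].
  split=> //=; first by case: s sn {sR sT ips sR'}.
    rewrite inE negb_or; apply/andP; split.
      by apply: contraTneq v01 => ->; rewrite edgexx.
    by apply/negP => /sR' []; rewrite eqxx.
  move=> x; rewrite inE => /predU1P [->|xs]; first by rewrite v01 eqxx.
  by have := sT x xs; rewrite inE => ->; case: eqP (sR' x xs).2.
have [uc _] := ips; have [v1s _] := andP uc.
split=> //; first by case: s sz {v0s sT ips uc v1s}.
  move=> x xs; rewrite !inE negb_or; apply/andP; split; apply: contraTneq xs => ->.
    by move: v0s; rewrite inE negb_or => /andP [].
  exact: v1s.
move=> x xs; rewrite inE sT ?inE ?xs ?orbT //=.
by have -> : (x == v1) = false by apply: contraTF xs => /eqP ->.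
Qed.

Lemma ends_at_rev v0 c : ends_at v0 c -> ends_at v0 (rev c).
Proof.
case=> sz v0c ends ip; split; rewrite ?size_rev ?mem_rev //; last exact: ipath_rev.
move=> x; rewrite mem_rev => xc; rewrite ends // orbC.
case: (lastP c) sz {v0c ends ip xc} => // c' y _; rewrite rev_rcons last_rcons /=.
by case: c' => [|z c'] /=; rewrite ?rev_cons ?last_rcons.
Qed.

Lemma icycle_ends_at v0 c : icycle (v0 :: c) -> ends_at v0 c.
Proof.
case=> c3 /= /andP [v0c uc] adj; split=> //.
  move=> x xc; have ix : (index x c).+1 < size (v0 :: c) by rewrite /= ltnS index_mem.
  have := adj v0 0 (index x c).+1 isT ix; rewrite /= nth_index // => ->.
  have c0 : 0 < size c by case: (c) xc.
  have hE : (x == head v0 c) = (index x c == 0) by case: (c) c0 => //= a c' _; rewrite eq_sym; case: eqP.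
  have lE : (x == last v0 c) = ((index x c).+1 == size c).
    rewrite -nth_last -[X in X == _](nth_index v0 xc) nth_uniq ?index_mem ?prednK //; lia.
  by rewrite cyc_adjE // hE lE /=; move: ix => /=; lia.
split=> // x0 i j ij jc.
have := adj x0 i.+1 j.+1 (leq_ltn_trans (ltnW ij) jc) jc; rewrite /= => ->.
by rewrite cyc_adjE /=; move: c3 => /=; lia.
Qed.

Lemma icycle_cpaths v0 c : icycle (v0 :: c) ->
  exists v1 s, [/\ c = v1 :: s, v1 \in nbhd v0 & s \in cpaths v0 v1].
Proof.
move/icycle_ends_at => ends; have [sz _ e _] := ends; case: c ends sz e => // v1 s ends _ e.
have v01 : v1 \in nbhd v0 by rewrite inE e ?mem_head //= eqxx.
by exists v1, s; split=> //; apply/cpathsP.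
Qed.

Definition rev_tail v1 s : seq G := rev (belast v1 s).

Lemma rev_tailE v1 s : last v1 s :: rev_tail v1 s = rev (v1 :: s).
Proof. by rewrite [v1 :: s]lastI rev_rcons. Qed.

(** Running the cycle backwards exchanges the two neighbours of v0 on it. The reversed path has its
    own exploration and its own cost. *)
Lemma rev_cpaths v0 v1 s : v1 \in nbhd v0 -> s \in cpaths v0 v1 ->
  last v1 s \in nbhd v0 /\ rev_tail v1 s \in cpaths v0 (last v1 s).
Proof.
move=> v01 /(cpathsP _ v01) ends; have [sz _ e _] := ends.
have lv0 : last v1 s \in nbhd v0 by rewrite inE e ?mem_last //= eqxx orbT.
by split=> //; apply/(cpathsP _ lv0); rewrite rev_tailE; apply: ends_at_rev.
Qed.

Definition ccost v1 v0 s := cost (fun=> 1) (nbhd v0) (~: [set v0; v1]) v1 s.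

Section Crossing.
Variables (D : nat) (degD : forall x, #|nbhd x| <= D).

Definition crossing c t := [set w | has (edge w) (take t c) && has (edge w) (drop t c)].

Lemma touched_prefix v0 v1 s t : s \in cpaths v0 v1 -> t <= size s ->
  #|[set w | has (edge w) (take t (v1 :: s))]| <= 2 + 3 * t + D * ccost v1 v0 s.
Proof.
move=> sO ts; set R := ~: [set v0; v1].
have := @residual_card_le D degD (nbhd v0) R v1 (take t s) (drop t s).
rewrite cat_take_drop size_takel // => /(_ sO); rewrite -/(ccost v1 v0 s).
have bE : belast v1 (take t s) = take t (v1 :: s).
  case: t ts => [|t] ts; first by rewrite take0.
  by rewrite /= (take_nth v1) // belast_rcons.
set Q := [set w | _]; have : #|Q| <= 2 + #|Q :&: R|.
  rewrite -(cardsID R Q) addnC leq_add2r; apply: leq_trans (_ : #|[set v0; v1]| <= _).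
    by apply/subset_leq_card/subsetP => w; rewrite !inE negbK => /andP [].
  by rewrite cards2; case: eqP.
have : #|Q :&: R| + #|residual R v1 (take t s)| <= #|R|.
  rewrite -(cardsID Q R) [Q :&: R]setIC leq_add2l; apply/subset_leq_card/subsetP => w.
  by rewrite mem_residual bE !inE andbC.
by lia.
Qed.

(** Inclusion-exclusion: up to costs, the two parts of the cut path touch at most 3 t and 3 (|c| -
    t) vertices, the latter by exploring backwards, while together they touch nearly all vertices,
    of which there are about 3 |c| or more. *)
Lemma card_crossing v0 v1 s t : v1 \in nbhd v0 -> s \in cpaths v0 v1 -> 0 < t <= size s ->
  #|crossing (v1 :: s) t| <=
  7 + (D + 4) * (ccost v1 v0 s + ccost (last v1 s) v0 (rev_tail v1 s)).
Proof.
move=> v01 sO /andP [t0 ts]; set c := v1 :: s.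
have [_ rO] := rev_cpaths v01 sO; have X := touched_prefix sO ts.
have rs : size (rev_tail v1 s) = size s by rewrite size_rev size_belast.
have := @touched_prefix v0 (last v1 s) (rev_tail v1 s) (size c - t) rO.
have tc : t <= size c := leqW ts.
have le : size c - t <= size s by rewrite /=; lia.
rewrite rs rev_tailE take_rev -/c (subKn tc) => /(_ le) Y.
set P := [set w | has (edge w) (take t c)]; set S := [set w | has (edge w) (rev (drop t c))].
have -> : crossing c t = P :&: S by apply/setP => w; rewrite !inE has_rev.
have uni : #|~: [set v0; v1]| <= #|P :|: S| + ccost v1 v0 s.
  apply: leq_trans (leq_add (leqnn _) (residual_waste sO)).
  rewrite -[leqLHS](cardsID (P :|: S)); apply: leq_add; apply/subset_leq_card.
    exact: subsetIr.
  apply/subsetP => w; rewrite mem_residual !inE has_rev -has_cat cat_take_drop => /andP [h ->] /=.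
  by apply: contra h => /hasP [x xb wx]; apply/hasP; exists x => //; apply: mem_belast.
have := cardsUI P S; have := size_ipaths_le sO; rewrite -/(ccost v1 v0 s).
move: X Y uni; rewrite -/c -/P -/S; move: (ccost _ _ _) (ccost _ _ _) => a b.
by rewrite /c /=; nia.
Qed.

End Crossing.

End Prefixes.

(** * Local structure of typical paths *)

Section Local.
Variable G : sgraph.
Implicit Types (S T R B Z : {set G}) (u v w x y a : G) (c s : seq G).

Fixpoint ball r v : {set G} :=
  if r is r'.+1 then \bigcup_(x in ball r' v) (x |: nbhd x) else [set v].

Lemma ball_step r v x y : x \in ball r v -> edge x y -> y \in ball r.+1 v.
Proof. by move=> xb xy; apply/bigcupP; exists x; rewrite // !inE xy orbT. Qed.

Lemma ball_sub r v : ball r v \subset ball r.+1 v.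
Proof. by apply/subsetP => x xb; apply/bigcupP; exists x; rewrite // !inE eqxx. Qed.

Lemma ball_center r v : v \in ball r v.
Proof. by elim: r => [|r IH]; rewrite ?inE // (subsetP (ball_sub r v)). Qed.

Lemma ball_leq r r' v : r <= r' -> ball r v \subset ball r' v.
Proof.
move=> /subnK <-; elim: (r' - r) => // k IH.
exact: subset_trans IH (ball_sub _ _).
Qed.

Lemma ball_trans r r' v x y : x \in ball r v -> y \in ball r' x -> y \in ball (r + r') v.
Proof.
elim: r' y => [|r' IH] y xb; first by rewrite inE addn0 => /eqP ->.
case/bigcupP => z zb; rewrite !inE addnS => /predU1P [->|zy].
  by rewrite (subsetP (ball_sub _ _)) // IH.
by apply: ball_step zy; apply: IH.
Qed.

Lemma ball_sym r v x : x \in ball r v -> v \in ball r x.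
Proof.
elim: r x => [|r IH] x; first by rewrite !inE eq_sym.
case/bigcupP => z /IH vz; rewrite !inE => /predU1P [->|zx].
  exact: (subsetP (ball_sub _ _)).
rewrite -[r.+1]add1n; apply: ball_trans vz.
by apply: ball_step (ball_center 0 x) _; rewrite edgeC.
Qed.

Lemma ball_edge r v x : edge v x -> ball r x \subset ball r.+1 v.
Proof.
move=> vx; apply/subsetP => y; rewrite -[r.+1]add1n; apply: ball_trans.
exact: ball_step (ball_center 0 v) vx.
Qed.

Lemma card_bigcup_le (A : {set G}) (F : G -> {set G}) : #|\bigcup_(x in A) F x| <= \sum_(x in A) #|F x|.
Proof.
elim/big_rec2: _ => [|x m U _ IH]; first by rewrite cards0.
by apply: leq_trans (leq_card_setU _ _) _; rewrite leq_add2l.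
Qed.

Lemma card_ball D r v : (forall x, #|nbhd x| <= D) -> #|ball r v| <= D.+1 ^ r.
Proof.
move=> degD; elim: r => [|r IH] /=; first by rewrite cards1.
apply: leq_trans (card_bigcup_le _ _) _; rewrite expnS mulnC.
apply: leq_trans (_ : #|ball r v| * D.+1 <= _); last by rewrite leq_mul2r IH orbT.
rewrite -sum_nat_const; apply: leq_sum => x _.
by rewrite cardsU1; have := degD x; case: (_ \notin _) => /=; lia.
Qed.

Definition ind B w : nat := w \in B.

(** While y is available, the exploration either reaches a neighbour u of y, where 1/100 of the
    paths turn to y unless u is defective, or it ends and wastes y. Both exceptions are charged to
    B. *)
Lemma ipaths_usage T R u y B : y \in R -> y \in B -> nbhd y \subset B ->
  npaths T R u <= 100 * \sum_(s <- ipaths T R u) (y \in s) + 100 * tcost (ind B) T R u.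
Proof.
move=> + yB NB; have [n] := ubnP #|R|; elim: n R u => // n IH R u Rn yR.
rewrite tcostE big_ipaths; have [uy|uy] := boolP (edge u y).
  have uB : u \in B by apply: (subsetP NB); rewrite inE edgeC.
  have yA : y \in nbhd u :&: R by rewrite !inE uy.
  case def: (defective T R u); first by rewrite /ind uB; lia.
  apply: leq_trans (npaths_defective (negbT def) yA) _.
  rewrite (bigD1 y) //= /npaths_via; case: (y \in T); first by rewrite mem_head; lia.
  rewrite (eq_bigr (fun=> 1)); last by move=> s _; rewrite mem_head.
  by rewrite sum1_size /npaths; lia.
rewrite npathsE !mulnDr addnCA !big_distrr /= -big_split /=.
apply: leq_trans (leq_addl _ _); apply: leq_sum => a aA.
have yR' : y \in R :\: nbhd u by rewrite !inE uy.
rewrite /npaths_via /tcost_via; case: (a \in T).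
  by rewrite (bigD1 y) //= /ind yB; lia.
apply: leq_trans (IH _ _ _ yR') _; first by have := card_residual aA; lia.
rewrite leq_add2r leq_mul2l; apply/orP; right; apply: leq_sum => s _.
by rewrite inE; case: (y \in s); rewrite ?orbT.
Qed.

(* The vertices available after two prefixes are compared along a common suffix: without
   local defects, every vertex removed for only one of them is compensated. *)
Lemma card_rerouted T R1 R2 v s B Z : s \in ipaths T R1 v -> s \in ipaths T R2 v ->
  (forall w, w \in Z -> w \in B) -> (forall w x, w \in Z -> edge w x -> x \in B) ->
  (forall w, w \notin Z -> (w \in R1) = (w \in R2)) ->
  cost (ind B) T R1 v s = 0 -> cost (ind B) T R2 v s = 0 -> #|R1| = #|R2|.
Proof.
move=> s1 s2 ZB NZB; elim: s v R1 R2 s1 s2 => [|a s IH] v R1 R2; first by rewrite nil_ipaths.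
rewrite !mem_ipaths_cons /= => /andP [_ s1] /andP [_ s2] ZR.
move=> /eqP; rewrite addn_eq0 => /andP [/eqP d1 /eqP c1].
move=> /eqP; rewrite addn_eq0 => /andP [/eqP d2 /eqP c2].
have cA : #|nbhd v :&: R1| = #|nbhd v :&: R2|.
  have [vB|vB] := boolP (v \in B).
    move: d1 d2; rewrite /ind vB !muln1 => d1 d2.
    by rewrite !(@card_defective _ T) //; [case: defective d2 | case: defective d1].
  congr #|pred_of_set _|; apply/setP => w; rewrite !inE.
  case vw: (edge v w) => //=; apply: ZR; apply: contra vB => wZ.
  by apply: NZB wZ _; rewrite edgeC.
have ZR' w : w \notin Z -> (w \in R1 :\: nbhd v) = (w \in R2 :\: nbhd v) by move=> wZ; rewrite !inE ZR.
suff cR : #|R1 :\: nbhd v| = #|R2 :\: nbhd v|.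
  by rewrite -(cardsID (nbhd v) R1) -(cardsID (nbhd v) R2) cR setIC cA setIC.
move: s1 s2 c1 c2; case: (a \in T) => [_ _ c1 c2|s1 s2 c1 c2]; last exact: IH s1 s2 ZR' c1 c2.
congr #|pred_of_set _|; apply/setP => w; have [wZ|] := boolP (w \in Z); last exact: ZR'.
have no R' : \sum_(x in R' :\: nbhd v) ind B x = 0 -> (w \in R' :\: nbhd v) = false.
  by apply: contra_eqF => wR'; rewrite (bigD1 w) //= /ind ZB.
by rewrite !no.
Qed.

(** The exact form of [residual_card_le] in the absence of defects in B. *)
Lemma card_nodes T R u s t B : s ++ t \in ipaths T R u -> t != [::] ->
  cost (ind B) T R u (s ++ t) = 0 -> {subset belast u s <= B} ->
  #|R| = #|residual R u s| + 3 * size s.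
Proof.
elim: s R u => [|a s IH] R u /=; first by rewrite addn0.
rewrite mem_ipaths_cons => /andP [_ H] tn.
move=> /eqP; rewrite addn_eq0 => /andP [/eqP d /eqP c] sB.
have uB : u \in B by apply: sB; rewrite mem_head.
have [aT st c'] : [/\ a \in T = false, s ++ t \in ipaths T (R :\: nbhd u) a
    & cost (ind B) T (R :\: nbhd u) a (s ++ t) = 0].
  move: H c; case: (a \in T) => //.
  by rewrite -size_eq0 size_cat addn_eq0 !size_eq0 (negPf tn) andbF.
rewrite -(cardsID (nbhd u) R) setIC (@card_defective _ T); last first.
  by move: d; rewrite /ind uB muln1; case: defective.
rewrite (IH _ _ st tn c'); first by lia.
by move=> x xs; apply: sB; rewrite inE xs orbT.
Qed.

Lemma ipaths_sub T R u s : s \in ipaths T R u -> {subset s <= R}.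
Proof.
elim: s u R => [|b s IH] u R; first by rewrite nil_ipaths.
rewrite mem_ipaths_cons => /andP [bA H] z; rewrite inE => /predU1P [->|zs].
  by case/setIP: bA.
move: H; case: (b \in T) => [/eqP e|H]; first by rewrite e in zs.
by have := IH _ _ H z zs; rewrite inE => /andP [].
Qed.

Lemma ipaths_transfer T R1 R2 v s : s \in ipaths T R1 v -> {subset s <= R2} -> s \in ipaths T R2 v.
Proof.
elim: s v R1 R2 => [|a s IH] v R1 R2; first by rewrite nil_ipaths.
rewrite !mem_ipaths_cons => /andP [aA H] sR2.
have -> : a \in nbhd v :&: R2 by move: aA; rewrite !inE => /andP [-> _]; rewrite sR2 ?mem_head.
move: H; case: (a \in T) => //= H; apply: IH (H) _ => x xs.
rewrite inE sR2 ?andbT; last by rewrite inE xs orbT.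
by have := ipaths_sub H xs; rewrite inE => /andP [].
Qed.

(* Replacing the stretch s1 of a path by the single vertex a removes 3 vertices per vertex of
   s1 but only 3 vertices for a, so one of the two paths has a local defect. *)
Lemma reroute T R u s1 v s2 a B : s1 ++ v :: s2 \in ipaths T R u -> s1 != [::] ->
  a \in nbhd u :&: R -> a \notin T -> edge a v -> ~~ has (edge a) s2 ->
  {subset u :: s1 <= B} -> a \in B ->
  (forall w, has (edge w) (a :: s1) -> w \in B) ->
  (forall w x, has (edge w) (a :: s1) -> edge w x -> x \in B) ->
  cost (ind B) T R u (s1 ++ v :: s2) = 0 ->
  a :: v :: s2 \in ipaths T R u /\
  (cost (ind B) T R u (a :: v :: s2) = 0 -> size s1 = 1).
Proof.
move=> sP s1n aA aT av as2 sB aB ZB NZB c0.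
have vP := ipaths_cat sP isT.
set R1 := residual R u s1 :\: nbhd (last u s1).
have vs : v \in nbhd (last u s1) :&: residual R u s1 /\
          (if v \in T then s2 == [::] else s2 \in ipaths T R1 v).
  by move: vP; rewrite mem_ipaths_cons => /andP [].
have [vA s2P] := vs.
have subR1 R' u' s' x : x \in residual R' u' s' -> x \in R'.
  by rewrite mem_residual => /andP [].
have R1E w : (w \in R1) = [&& w \in R, ~~ edge u w & ~~ has (edge w) s1].
  have : has (edge w) (u :: s1) = edge w (last u s1) || has (edge w) (belast u s1).
    by rewrite lastI has_rcons.
  rewrite !inE mem_residual [edge (last u s1) w]edgeC [edge u w]edgeC /=.
  case: (edge w u); case: (has _ s1); case: (edge w _); case: (has _ _); case: (w \in R) => //.
have vR2 : v \in R :\: nbhd u.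
  case: s1 s1n {sP sB ZB NZB c0 s2P vs R1 R1E} vA vP => // b s1 _ /=.
  by rewrite inE => /andP [_ /subR1].
set R2 := R :\: nbhd u :\: nbhd a.
have s2R2 : {subset s2 <= R2}.
  move=> x xs; rewrite !inE; have nax : ~~ edge a x by apply: contra as2 => ax; apply/hasP; exists x.
  rewrite nax /=; move: s2P; case: (v \in T) => [/eqP e|]; first by rewrite e in xs.
  by move=> s2P; have := ipaths_sub s2P xs; rewrite R1E => /and3P [-> -> _].
have s2P' : if v \in T then s2 == [::] else s2 \in ipaths T R2 v.
  by move: s2P; case: (v \in T) => // H; apply: ipaths_transfer H s2R2.
have aP : a :: v :: s2 \in ipaths T R u.
  by rewrite !mem_ipaths_cons aA (negPf aT) /= s2P' andbT inE vR2 andbT inE.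
split=> // c0'.
have cR1 : #|R| = #|R1| + 3 * (size s1).+1.
  rewrite (card_nodes sP isT c0); last first.
    by move=> x xs; apply: sB; apply: mem_belast.
  have cv : cost (ind B) T (residual R u s1) (last u s1) (v :: s2) = 0.
    by apply/eqP; rewrite -leqn0 -c0; apply: cost_cat.
  rewrite -(cardsID (nbhd (last u s1)) (residual R u s1)) -/R1 setIC (@card_defective _ T).
    by rewrite mulnS addnA [_ + 3]addnC.
  move: cv => /= /eqP; rewrite addn_eq0 => /andP [/eqP + _].
  by rewrite /ind sB ?mem_last // muln1; case: defective.
have uB : u \in B by apply: sB; rewrite mem_head.
have [du da cT] : [/\ ~~ defective T R u, ~~ defective T (R :\: nbhd u) a
    & if v \in T then \sum_(w in R2) ind B w = 0 else cost (ind B) T R2 v s2 = 0].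
  move: c0'; rewrite /= (negPf aT) /ind uB aB !muln1 -/R2 => /eqP.
  rewrite !addn_eq0 => /and3P [/eqP d1 /eqP d2 /eqP d3]; split.
  - by case: defective d1.
  - by case: defective d2.
  - by move: d3; case: (v \in T).
have cR2 : #|R| = #|R2| + 6.
  rewrite -(cardsID (nbhd u) R) setIC (card_defective du) -(cardsID (nbhd a) (R :\: nbhd u)).
  by rewrite [_ :&: nbhd a]setIC (card_defective da) -/R2 addnA addnC.
suff cR12 : #|R1| = #|R2|.
  move: cR1; rewrite cR2 cR12 => /eqP; rewrite eqn_add2l (_ : 6 = 3 * 2) // eqn_pmul2l //.
  by move=> /eqP [].
pose Z := [set w | has (edge w) (a :: s1)].
have ZR w : w \notin Z -> (w \in R1) = (w \in R2).
  rewrite inE /= negb_or R1E !inE [edge u w]edgeC [edge a w]edgeC => /andP [-> ->] /=.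
  by rewrite andbT andbC.
have cT1 : if v \in T then \sum_(w in R1) ind B w = 0 else cost (ind B) T R1 v s2 = 0.
  have : cost (ind B) T (residual R u s1) (last u s1) (v :: s2) = 0.
    by apply/eqP; rewrite -leqn0 -c0; apply: cost_cat.
  by move=> /= /eqP; rewrite addn_eq0 => /andP [_ /eqP]; case: (v \in T).
move: s2P s2P' cT cT1; case: (v \in T) => [_ _ c2 c1|p1 p2 c2 c1].
  congr #|pred_of_set _|; apply/setP => w; have [wZ|] := boolP (w \in Z); last exact: ZR.
  have no R' : \sum_(x in R') ind B x = 0 -> (w \in R') = false.
    by apply: contra_eqF => wR'; rewrite (bigD1 w) //= /ind ZB //; move: wZ; rewrite inE.
  by rewrite !no.
apply: (@card_rerouted T R1 R2 v s2 B Z) => //; first by move=> w; rewrite inE; apply: ZB.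
by move=> w x; rewrite inE; apply: NZB.
Qed.

End Local.

(** * Good stages of the exploration *)

Section Good.
Variable G : sgraph.
Implicit Types (S T R B Z : {set G}) (u v w x y a : G) (c s : seq G).

(* The number of vertices of s between the first and the last neighbour of w on u :: s. *)
Definition gap u s w : nat :=
  \sum_(k < size s) (has (edge w) (u :: take k s) && has (edge w) (drop k s)).

(* Most completions of the path ending at u have no defect near u, and the gaps of the
   vertices near u are bounded on average. *)
Definition good (L1 L2 r r0 m0 : nat) T R u : Prop :=
  [/\ 0 < npaths T R u,
      L1 * (\sum_(s <- ipaths T R u) (cost (ind (ball r u)) T R u s + (size s < m0)))
        <= npaths T R u
    & \sum_(s <- ipaths T R u) \sum_(w in R :&: ball r0 u) gap u s w <= L2 * npaths T R u].

Lemma gap_cons u a s w : gap a s w <= gap u (a :: s) w.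
Proof.
rewrite /gap /= big_ord_recl /=; apply: leq_trans (leq_addl _ _); apply: leq_sum => k _ /=.
by case: (edge w a || _); case: (has _ _); rewrite ?orbT.
Qed.

Lemma sum_ipaths_child (X : seq G -> nat) T R u a : a \in nbhd u :&: R -> a \notin T ->
  \sum_(s <- ipaths T (R :\: nbhd u) a) X (a :: s) <= \sum_(s <- ipaths T R u) X s.
Proof. by move=> aA aT; rewrite [leqRHS]big_ipaths [leqRHS](bigD1 a) //= (negPf aT) leq_addr. Qed.

(** A defect at u itself would be counted on every path. *)
Lemma good_nondefective L1 L2 r r0 m0 T R u : 1 < L1 ->
  good L1 L2 r r0 m0 T R u -> ~~ defective T R u.
Proof.
move=> L1gt [F0 C _]; apply/negP => def; move: C; rewrite big_split /= mulnDr.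
set x := \sum_(s <- _) _; set y := \sum_(s <- _) _.
have h : npaths T R u <= x.
  by rewrite /x -/(tcost _ _ _ _) tcostE def /ind ball_center !mul1n leq_addr.
have : 2 * x <= L1 * x by rewrite leq_mul2r L1gt orbT.
by move: (L1 * x) (L1 * y) => z t; lia.
Qed.

(** Each choice at a good u carries 1/100 of the paths, so averages grow at most by a factor 100,
    and balls around a lie in balls around u of radius larger by one. The condition on short paths
    rules out a in T. *)
Lemma good_child L1 L2 r r0 m0 T R u a : 1 < L1 -> 0 < m0 ->
  good (100 * L1) L2 r.+1 r0.+1 m0.+1 T R u -> a \in nbhd u :&: R ->
  a \notin T /\ good L1 (100 * L2) r r0 m0 T (R :\: nbhd u) a.
Proof.
move=> L1gt m0gt gd aA; have nd := good_nondefective (leq_trans L1gt (leq_pmull _ (isT : 0 < 100))) gd.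
have [F0 C g] := gd; have Fa := npaths_defective nd aA.
have aT : a \notin T.
  apply/negP => aT; move: Fa; rewrite /npaths_via aT.
  have : 1 <= \sum_(s <- ipaths T R u) (cost (ind (ball r.+1 u)) T R u s + (size s < m0.+1)).
    by rewrite big_ipaths (bigD1 a) // aT ltnS m0gt addn1.
  move: C; move: (\sum_(s <- _) _) => x; nia.
split=> //; move: Fa; rewrite /npaths_via (negPf aT) => Fa; split.
- by lia.
- have := sum_ipaths_child (fun s => cost (ind (ball r.+1 u)) T R u s + (size s < m0.+1)) aA aT.
  move=> /= le; have : \sum_(s <- ipaths T (R :\: nbhd u) a)
     (cost (ind (ball r a)) T (R :\: nbhd u) a s + (size s < m0)) <=
     \sum_(s <- ipaths T R u) (cost (ind (ball r.+1 u)) T R u s + (size s < m0.+1)).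
    apply: leq_trans le; apply: leq_sum => s _; rewrite (negPf aT) ltnS leq_add2r.
    apply: leq_trans (leq_addl _ _); apply: leq_cost => w; rewrite /ind.
    have := ball_edge r (_ : edge u a); case: (boolP (w \in ball r a)) => // wb /(_ _) /subsetP -> //.
    by move: aA; rewrite !inE => /andP [].
  set y := \sum_(s <- ipaths T (R :\: nbhd u) a) _.
  move: C; set x := \sum_(s <- ipaths T R u) _ => C yx.
  have : L1 * y <= L1 * x by rewrite leq_mul2l yx orbT.
  by lia.
apply: leq_trans (_ : L2 * npaths T R u <= _); last by rewrite -mulnA mulnCA leq_mul2l Fa orbT.
apply: leq_trans g; apply: leq_trans (sum_ipaths_child _ aA aT); apply: leq_sum => s _.
rewrite [leqRHS](bigID (mem ((R :\: nbhd u) :&: ball r0 a))) /=; apply: leq_trans (leq_addr _ _).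
rewrite [leqRHS](eq_bigl (mem ((R :\: nbhd u) :&: ball r0 a))); last first.
  move=> w; rewrite !inE; apply/andP/idP => [[]//|h]; split=> //.
  case/andP: h => /andP [_ ->] wb /=; apply: (subsetP (ball_edge r0 _)) wb.
  by move: aA; rewrite !inE => /andP [].
by apply: leq_sum => w _; apply: gap_cons.
Qed.

Lemma good_mono L1 L1' L2 r r' r0 m0 T R u : L1 <= L1' -> r <= r' ->
  good L1' L2 r' r0 m0 T R u -> good L1 L2 r r0 m0 T R u.
Proof.
move=> LL rr [F0 C g]; split=> //; apply: leq_trans C; apply: leq_mul => //.
apply: leq_sum => s _; rewrite leq_add2r; apply: leq_cost => w; rewrite /ind.
by case: (boolP (w \in ball r u)) => // /(subsetP (ball_leq u rr)) ->.
Qed.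

(** The number of walks bounds in how many ways a stretch cut out by rerouting can be restored. *)
Fixpoint walks J u : seq (seq G) :=
  [::] :: (if J is J'.+1 then flatten [seq [seq a :: t | t <- walks J' a] | a <- enum (nbhd u)] else [::]).

Lemma mem_walks J u s : path (@edge G) u s -> size s <= J -> s \in walks J u.
Proof.
elim: J u s => [|J IH] u [|a s] //= /andP [ua ps] sJ; rewrite inE /=.
apply/flatten_mapP; exists a; first by rewrite mem_enum inE.
by apply/mapP; exists s; rewrite // IH.
Qed.

Fixpoint walk_bound D J := if J is J'.+1 then 1 + D * walk_bound D J' else 1.

Lemma size_walks D J u : (forall x, #|nbhd x| <= D) -> size (walks J u) <= walk_bound D J.
Proof.
move=> degD; elim: J u => [|J IH] u //=.
rewrite size_flatten /shape -map_comp sumnE big_map big_enum /= -add1n leq_add2l.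
apply: leq_trans (_ : \sum_(a in nbhd u) walk_bound D J <= _).
  by apply: leq_sum => a _; rewrite size_map.
by rewrite sum_nat_const leq_mul2r degD orbT.
Qed.

Lemma ipaths_path T R u s : s \in ipaths T R u -> path (@edge G) u s.
Proof.
elim: s R u => //= a s IH R u; rewrite mem_ipaths_cons !inE => /andP [/andP [-> _]] /=.
by case: (a \in T) => [/eqP -> //|]; apply: IH.
Qed.

Lemma path_ball u s x r : path (@edge G) u s -> x \in s -> size s <= r -> x \in ball r u.
Proof.
elim: s u r => //= a s IH u [|r] // /andP [ua ps]; rewrite inE ltnS => /predU1P [->|xs] sr.
  exact: (subsetP (ball_edge r ua)) _ (ball_center r a).
by apply: (subsetP (ball_edge r ua)); apply: IH.
Qed.

Lemma split_last (P : pred G) s : has P s ->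
  exists s1 v s2, [/\ s = s1 ++ v :: s2, P v & ~~ has P s2].
Proof.
elim: s => //= a s IH; have [/IH [s1 [v [s2 [-> Pv ns]]]]|ns] := boolP (has P s).
  by exists (a :: s1), v, s2.
by rewrite orbF => Pa; exists [::], a, s.
Qed.

Lemma gap_ge u s1 v s2 w : edge w u -> edge w v -> size s1 < gap u (s1 ++ v :: s2) w.
Proof.
move=> wu wv; rewrite /gap size_cat /= addnS -addSn.
rewrite -(big_mkord predT (fun k => (has (edge w) (u :: take k (s1 ++ v :: s2)) && has (edge w) (drop k (s1 ++ v :: s2))) : nat)).
rewrite (@big_cat_nat _ _ _ (size s1).+1) ?leq_addr //=; apply: leq_trans (leq_addr _ _).
apply: leq_trans (_ : \sum_(0 <= k < (size s1).+1) 1 <= _); first by rewrite sum_nat_const_nat subn0 muln1.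
rewrite [leqLHS]big_nat [leqRHS]big_nat; apply: leq_sum => k /andP [_ kl].
rewrite wu /= drop_cat; have [kl'|kl'] := ltnP k (size s1).
  by rewrite has_cat /= wv orbT.
have -> : k - size s1 = 0 by lia.
by rewrite drop0 /= wv.
Qed.

End Good.

Lemma sum_mem_le (U : eqType) (l l' : seq U) : uniq l -> \sum_(x <- l) (x \in l' : nat) <= size l'.
Proof.
move=> ul; rewrite -big_mkcond /= sum1_count -size_filter; apply: uniq_leq_size.
  exact: filter_uniq.
by move=> x; rewrite mem_filter => /andP [].
Qed.

(** k = 100^3 because three vertices in turn each carry 1/100 of the paths. The hypotheses bound k g
    by F / 4 and k (2 + W) t by F / 8, so F <= 3 F / 8. *)
Lemma reroute_arith k J Q W L2 F F1 F2 t t2 c g p :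
  k = 100 * (100 * 100) -> 0 < J -> 4 * k * L2 <= J -> 8 * k * (2 + W) <= Q ->
  F <= 100 * F1 -> F1 <= 100 * F2 -> F2 <= 100 * c + 100 * t2 -> t2 <= t ->
  c <= g + (1 + W) * p -> p <= t -> J * g <= L2 * F -> 100 * (100 * Q) * t <= F -> F = 0.
Proof.
move=> kE J0 kJ kQ hF hF1 hF2 ht2 hc hp hg ht.
have Fle : F <= k * (g + (2 + W) * t).
  have : (1 + W) * p <= (1 + W) * t by rewrite leq_mul2l hp orbT.
  by move: hc; rewrite kE; move: (_ * p) => x; lia.
have Q1 : Q * t <= F by apply: leq_trans ht; rewrite (mulnA 100) -(mulnA _ Q t) leq_pmull ?muln_gt0.
have Q2 : 8 * k * (2 + W) * t <= F by apply: leq_trans Q1; rewrite leq_mul2r kQ orbT.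
have h1 : 4 * k * (J * g) <= J * F.
  apply: leq_trans (_ : 4 * k * (L2 * F) <= _); first by rewrite leq_mul2l hg orbT.
  by rewrite mulnA leq_mul2r kJ orbT.
have h2 : 4 * (J * F) <= 4 * (J * (k * (g + (2 + W) * t))) by rewrite !leq_mul2l Fle !orbT.
have h3 : J * (8 * k * (2 + W) * t) <= J * F by rewrite leq_mul2l Q2 orbT.
have JF : J * F = 0.
  set y := J * (k * ((2 + W) * t)); have e1 : J * (8 * k * (2 + W) * t) = 8 * y by rewrite /y; lia.
  have e2 : J * (k * (g + (2 + W) * t)) = k * (J * g) + y by rewrite /y; lia.
  by move: h1 h2 h3; rewrite e1 e2 -mulnA; lia.
by move: J0; move/eqP: JF; rewrite muln_eq0 => /orP [/eqP ->|/eqP].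
Qed.

Section Local.
Variables (G : sgraph) (D : nat) (degD : forall x : G, #|nbhd x| <= D).
Implicit Types (S T R B Z : {set G}) (u v w x y a : G) (c s : seq G).

(** Let s start with a1, x, visit y later and have no local defect. Going from u via a2 to the last
    neighbour of a2 on s skips at least a1 and x, so by [reroute] the new path has a local defect.
    If the gap of a2 is below J, the skipped part is one of boundedly many walks, so each defective
    path arises from boundedly many s. *)
Lemma count_reroutable T R u a1 a2 x y J r : let B := ball r u in
  J.+2 <= r -> a2 \in nbhd u :&: R -> a2 \notin T -> edge a2 y ->
  \sum_(s <- ipaths T R u) ((take 2 s == [:: a1; x]) && (y \in drop 2 s))
  <= \sum_(s <- ipaths T R u) (J <= gap u s a2) +
     (1 + walk_bound D J) * \sum_(s <- ipaths T R u) (0 < cost (ind B) T R u s).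
Proof.
move=> B rJ a2A a2T a2y; set P := fun s => 0 < cost (ind B) T R u s.
pose img := [seq t ++ drop 1 s | t <- walks J u, s <- [seq s <- ipaths T R u | P s]].
have step s : s \in ipaths T R u -> (take 2 s == [:: a1; x]) && (y \in drop 2 s) <=
    (J <= gap u s a2) + P s + (s \in img).
  move=> sP; case: andP => // -[/eqP s12 ys]; rewrite lt0n.
  have [gJ|gJ] := leqP J (gap u s a2); first by [].
  rewrite add0n; have [cs|] := boolP (P s); first by [].
  rewrite /P lt0n negbK => /eqP c0; suff -> : s \in img by [].
  have hs : has (edge a2) s by apply/hasP; exists y; rewrite // (mem_drop ys).
  have [al [v [be [sE a2v nbe]]]] := split_last hs.
  have al2 : 1 < size al.
    have ybe : y \notin be by apply: contra nbe => ybe; apply/hasP; exists y.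
    move: ys; rewrite sE; case: al {sE} => [|b [|b' al]] //=; rewrite ?drop0.
      by move/mem_drop => ybe'; rewrite ybe' in ybe.
    by move=> ybe'; rewrite ybe' in ybe.
  have alJ : size al < J.
    apply: leq_ltn_trans _ gJ; rewrite sE; apply: ltnW; apply: gap_ge => //.
    by move: a2A; rewrite !inE edgeC => /andP [].
  have pal : path (@edge G) u al.
    by have := ipaths_path sP; rewrite sE cat_path => /andP [].
  have inB z : z \in a2 :: al -> z \in ball J u.
    rewrite inE => /predU1P [->|zal]; last by apply: path_ball pal zal (ltnW alJ).
    case: (J) alJ => // J' _; apply: ball_step (ball_center _ _) _.
    by move: a2A; rewrite !inE => /andP [].
  have BJ k : k <= J.+2 -> ball k u \subset B by move=> kJ; apply: ball_leq; lia.
  have nb w : has (edge w) (a2 :: al) -> w \in ball J.+1 u.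
    by case/hasP => z /inB zJ; rewrite edgeC; apply: ball_step.
  have [] := @reroute G T R u al v be a2 B; rewrite -?sE //.
  - by case: (al) al2.
  - move=> z; rewrite inE => /predU1P [->|zal]; first exact: ball_center.
    by apply: (subsetP (BJ J _)) (inB z _); rewrite ?leqW // inE zal orbT.
  - by apply: (subsetP (BJ J _)) (inB _ (mem_head _ _)); lia.
  - by move=> w /nb; apply/subsetP/BJ.
  - by move=> w z /nb wJ wz; apply: (subsetP (BJ J.+2 _)); rewrite ?(ball_step wJ).
  move=> rP; case E: (cost _ _ _ _ (a2 :: _)) => [|k].
    by move=> /(_ erefl) e; rewrite e in al2.
  move=> _; apply/allpairsP; exists (al, a2 :: v :: be); split=> //=.
  - by apply: mem_walks; rewrite // ltnW.
  - by rewrite mem_filter rP /P E.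
apply: leq_trans (_ : \sum_(s <- ipaths T R u) ((J <= gap u s a2) + P s + (s \in img)) <= _).
  by rewrite big_seq [leqRHS]big_seq; apply: leq_sum.
rewrite !big_split /= -addnA leq_add2l mulnDl mul1n leq_add2l.
apply: leq_trans (sum_mem_le _ (ipaths_uniq T R u)) _; rewrite size_allpairs.
apply: leq_mul; first exact: size_walks.
by rewrite size_filter -sum1_count big_mkcond.
Qed.

Lemma sum_lt_le J (X : seq G -> nat) (l : seq (seq G)) :
  J * \sum_(s <- l) (J <= X s) <= \sum_(s <- l) X s.
Proof.
rewrite big_distrr; apply: leq_sum => s _ /=.
by case: (leqP J (X s)) => h; rewrite ?muln1 ?muln0.
Qed.

(** Both a1 and a2 have three available neighbours, so a neighbour x of a1 alone comes with a
    neighbour y of a2 alone. As y stays available after a1 and x, a constant proportion of the paths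
    starts with a1, x and uses y later; by [count_reroutable] such paths are too few. *)
Lemma good_nbhd_sub J Q L2 r r0 m0 T R u a1 a2 :
  0 < J -> 1 < Q -> 4 * (100 * (100 * 100)) * L2 <= J ->
  8 * (100 * (100 * 100)) * (2 + walk_bound D J) <= Q ->
  good (100 * (100 * Q)) L2 (J + r).+2 r0.+2 m0.+3 T R u ->
  a1 \in nbhd u :&: R -> a2 \in nbhd u :&: R ->
  nbhd a1 :&: (R :\: nbhd u) \subset nbhd a2 :&: (R :\: nbhd u).
Proof.
move=> J0 Qgt LJ WQ gd a1A a2A.
have Q1 : 1 < 100 * Q by apply: leq_trans Qgt _; rewrite leq_pmull.
have [a1T gd1] := good_child Q1 (ltn0Sn _) gd a1A.
have [a2T gd2] := good_child Q1 (ltn0Sn _) gd a2A.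
apply/subsetPn => -[x xX xY]; set X := nbhd a1 :&: _ in xX *; set Y := nbhd a2 :&: _ in xY *.
have [y yY yX] : exists2 y, y \in Y & y \notin X.
  apply/subsetPn; apply/negP => YX; case/negP: xY.
  have /eqP -> : Y == X; last by [].
  rewrite eqEcard YX /X /Y !(@card_defective _ T) //.
    exact: good_nondefective gd2.
  exact: good_nondefective gd1.
have [xT gdx] := good_child Qgt (ltn0Sn _) gd1 xX.
have [F0 C g] := gd; set F := npaths T R u in F0 C g.
set B := ball (J + r).+2 u; set tc := tcost (ind B) T R u.
have nd := good_nondefective (leq_trans Q1 (leq_pmull _ (isT : 0 < 100))) gd.
have F1 := npaths_defective nd a1A; rewrite /npaths_via (negPf a1T) in F1.
have F2 := npaths_defective (good_nondefective Q1 gd1) xX; rewrite /npaths_via (negPf xT) in F2.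
set R2 := R :\: nbhd u :\: nbhd a1 in F2 gdx.
have a2y : edge a2 y by move: yY; rewrite !inE => /andP [].
have yR2 : y \in R2.
  by move: yY yX; rewrite !inE => /andP [_ ->]; rewrite andbT => ->.
have ua2 : edge u a2 by move: a2A; rewrite !inE => /andP [].
have yb : y \in ball 2 u by apply: ball_step a2y; apply: ball_step ua2; apply: ball_center.
have yB : y \in B by apply: (subsetP (ball_leq _ _)) yb.
have NyB : nbhd y \subset B.
  apply/subsetP => z; rewrite inE => yz; apply: (subsetP (@ball_leq _ 3 _ _ _)) (ball_step yb yz).
  by rewrite !ltnS (leq_trans J0) ?leq_addr.
have use := ipaths_usage T x yR2 yB NyB.
have tcs : tcost (ind B) T R2 x <= tc.
  apply: leq_trans (sum_ipaths_child _ a1A a1T).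
  apply: leq_trans (sum_ipaths_child _ xX xT).
  by apply: leq_sum => s _ /=; rewrite (negPf a1T) (negPf xT) addnA leq_addl.
have cnt := @count_reroutable T R u a1 a2 x y J (J + r).+2 _ a2A a2T a2y.
have : \sum_(s <- ipaths T R2 x) (y \in s) <=
       \sum_(s <- ipaths T R u) ((take 2 s == [:: a1; x]) && (y \in drop 2 s)).
  apply: leq_trans (sum_ipaths_child _ a1A a1T).
  apply: leq_trans (sum_ipaths_child _ xX xT).
  by apply: leq_sum => s _ /=; rewrite take0 drop0 eqxx.
move/leq_trans/(_ (cnt ltac:(by rewrite /= leq_addr))) => {}cnt.
have pos : \sum_(s <- ipaths T R u) (0 < cost (ind B) T R u s) <= tc.
  by apply: leq_sum => s _; case: (cost _ _ _ _ _).
have gapJ : J * \sum_(s <- ipaths T R u) (J <= gap u s a2) <= L2 * F.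
  apply: leq_trans (sum_lt_le _ _ _) _; apply: leq_trans g; apply: leq_sum => s _.
  rewrite (bigD1 a2) ?leq_addr //= inE (subsetP (ball_leq u (isT : 1 <= r0.+2))).
    by case/setIP: a2A => _ ->.
  exact: ball_step (ball_center 0 u) ua2.
have ctc : 100 * (100 * Q) * tc <= F.
  apply: leq_trans C; rewrite leq_mul2l; apply/orP; right.
  by apply: leq_sum => s _; apply: leq_addr.
have F0' := reroute_arith erefl J0 LJ WQ F1 F2 use tcs cnt pos gapJ ctc.
by rewrite /F F0' in F0.
Qed.

End Local.

(** * Chains of clusters *)

Section Stretch.
Variable G : sgraph.
Implicit Types (S T R B Z A : {set G}) (u v w x y a : G) (l : seq {set G}).

(* An induced piece of a braid; the clusters B 0 and B L may have further neighbours. *)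
Definition stretch L (B : nat -> {set G}) : Prop :=
  [/\ forall i, i <= L -> B i != set0,
      forall i j, i < j <= L -> [disjoint B i & B j],
      forall i x y, i < L -> x \in B i -> y \in B i.+1 -> edge x y
    & forall i x y, 0 < i < L -> x \in B i -> edge x y -> y \in B i.-1 :|: B i :|: B i.+1].

(** A stretch as seen by the exploration: neighbours are prescribed only among the available
    vertices, and edges leaving the initial R are not controlled. *)
Fixpoint chain R l : Prop :=
  if l is A :: l' then
    [/\ A \subset R, #|A| = 3,
        (if l' is B :: _ then forall a, a \in A -> nbhd a :&: (R :\: A) = B else True)
      & chain (R :\: A) l']
  else True.

Lemma chain_sub R l i : chain R l -> i < size l -> nth set0 l i \subset R.
Proof.
elim: l R i => [|A l IH] R [|i] // [AR _ _ c] il //.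
exact: subset_trans (IH _ _ c il) (subsetDl _ _).
Qed.

Lemma chain_card R l i : chain R l -> i < size l -> #|nth set0 l i| = 3.
Proof. by elim: l R i => [|A l IH] R [|i] // [_ A3 _ c] il //; apply: IH c il. Qed.

Lemma chain_disjoint R l i j : chain R l -> i < j < size l -> [disjoint nth set0 l i & nth set0 l j].
Proof.
elim: l R i j => [|A l IH] R i [|j] //; first by rewrite ltn0 andbF.
move=> c ij; have [_ _ _ c'] := c; case: i ij => [|i] ij; last exact: IH c' ij.
have := chain_sub c' (proj2 (andP ij) : j < size l); rewrite subsetD => /andP [_].
by rewrite disjoint_sym.
Qed.

Lemma chain_edge R l i j a b : chain R l -> i < j < size l ->
  a \in nth set0 l i -> b \in nth set0 l j -> edge a b = (j == i.+1).
Proof.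
elim: l R i j => [|A l IH] R i [|j] //; first by rewrite ltn0 andbF.
move=> c ij; have [_ _ cA c'] := c; case: i ij => [|i] ij; last exact: IH c' ij.
case: l c c' cA ij {IH} => // B l c c' cA ij aA bj.
have nB : nbhd a :&: (R :\: A) = B := cA a aA.
have jl : j < size (B :: l) by case/andP: ij.
have bRA : b \in R :\: A := subsetP (@chain_sub (R :\: A) (B :: l) j c' jl) b bj.
have : (b \in nbhd a :&: (R :\: A)) = (b \in B) by rewrite nB.
rewrite inE bRA andbT inE => ->; case: j bj ij {jl bRA} => //= j bj ij.
have := @chain_disjoint (R :\: A) (B :: l) 0 j.+1 c' ij; rewrite disjoint_sym => /disjointFr; exact.
Qed.

Lemma chain_nbhd R l i a w : chain R l -> i.+1 < size l -> a \in nth set0 l i -> edge a w -> w \in R ->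
  exists2 j, j < size l & w \in nth set0 l j.
Proof.
elim: l R i => [|A l IH] R i // [_ _ cA c] il ai aw wR.
have [wA|wA] := boolP (w \in A); first by exists 0.
have wRA : w \in R :\: A by rewrite inE wA.
case: i il ai => [|i] il ai; last by have [j jl wj] := IH _ _ c il ai aw wRA; exists j.+1.
case: l il cA c ai {IH} => // B l _ cA _ ai; exists 1 => //=.
by rewrite -(cA a ai) inE wRA inE aw.
Qed.

Lemma chain_ball R u l i x : chain R l -> nth set0 l 0 \subset nbhd u -> i < size l ->
  x \in nth set0 l i -> x \in ball i.+1 u.
Proof.
move=> c l0; elim: i x => [|i IH] x il xi.
  by apply: ball_step (ball_center 0 u) _; move: (subsetP l0 _ xi); rewrite inE.
have il' := ltnW il; have [a ai] : exists a, a \in nth set0 l i.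
  by apply/set0Pn; rewrite -card_gt0 (chain_card c).
by apply: ball_step (IH a il' ai) _; rewrite (chain_edge c _ ai xi) // ltnSn.
Qed.

End Stretch.

(** By [good_nbhd_sub] all vertices of the first cluster have the same available neighbours, so it
    suffices to continue from one of them. Each cluster weakens the constants, hence [L1] and [r]
    are built up from the far end of the chain. *)
Lemma good_chain D M L2 : exists L1 r, forall (G : sgraph) (T R : {set G}) u,
  (forall x : G, #|nbhd x| <= D) -> good L1 L2 r M.+2 M.+3 T R u ->
  exists l, [/\ size l = M.+1, nth set0 l 0 = nbhd u :&: R & chain R l].
Proof.
elim: M L2 => [|M IH] L2.
  exists 2, 0 => G T R u degD gd; exists [:: nbhd u :&: R]; split=> //; split=> //; first exact: subsetIr.
  by apply: card_defective; apply: good_nondefective gd.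
have [L1 [r ext]] := IH (100 * L2).
pose k := 100 * (100 * 100); pose J := (4 * k * L2).+1; pose Q := (8 * k * (2 + walk_bound D J)).+2.
exists (100 * (100 * (Q + L1))), (J + r).+2 => G T R u degD gd.
have gdQ : good (100 * (100 * Q)) L2 (J + r).+2 M.+3 M.+4 T R u.
  by apply: good_mono gd => //; rewrite !leq_mul2l leq_addr.
have nbE a1 a2 : a1 \in nbhd u :&: R -> a2 \in nbhd u :&: R ->
    nbhd a1 :&: (R :\: nbhd u) = nbhd a2 :&: (R :\: nbhd u).
  move=> a1A a2A; apply/eqP; rewrite eqEsubset.
  by rewrite !(good_nbhd_sub degD _ _ _ _ gdQ) // ?leqnSn // (leq_trans (leqnSn _)).
have L1gt : 1 < 100 * (Q + L1) by apply: leq_trans (leq_pmull _ _); rewrite // addSn.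
have A3 : #|nbhd u :&: R| = 3.
  apply: (@card_defective _ T); apply: good_nondefective gd.
  by apply: leq_trans L1gt (leq_pmull _ _).
have [a aA] : exists a, a \in nbhd u :&: R by apply/set0Pn; rewrite -card_gt0 A3.
have [aT gda] := good_child L1gt (ltn0Sn _) gd aA.
have [l [sl l0 cl]] : exists l, [/\ size l = M.+1, nth set0 l 0 = nbhd a :&: (R :\: nbhd u) & chain (R :\: nbhd u) l].
  apply: (ext G T _ _ degD); apply: good_mono gda; last by rewrite leqW // leq_addl.
  by apply: leq_trans (leq_pmull _ _); rewrite // leq_addl.
have RE : R :\: (nbhd u :&: R) = R :\: nbhd u by rewrite setDIr setDv setU0.
exists (nbhd u :&: R :: l); rewrite /= sl; split=> //; split=> //; rewrite ?subsetIr ?RE //.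
case: l sl l0 cl => // B l _ /= -> _ a' a'A; exact: nbE.
Qed.

(* The vertices outside R adjacent to the chain are few, since each of them is adjacent to a
   constant proportion of the paths; hence some run of clusters avoids their neighbourhoods. *)
Lemma good_stretch D L L2 L3 : let M := L.+1 * (200 * L3 * D).+1 in
  exists L1 r, forall (G : sgraph) (T R : {set G}) u,
    (forall x : G, #|nbhd x| <= D) -> good L1 L2 r M.+2 M.+3 T R u ->
    \sum_(s <- ipaths T R u) #|[set w | (w \notin R) && has (edge w) s]| <= L3 * npaths T R u ->
    exists2 B : nat -> {set G}, stretch L B & forall i, i <= L -> #|B i| = 3.
Proof.
move=> M; have [L1 [r ext]] := good_chain D M L2; exists (200 + L1), (r + M.+3) => G T R u degD gd out.
have gd' : good L1 L2 r M.+2 M.+3 T R u by apply: good_mono gd; rewrite ?leq_addl ?leq_addr.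
have [l [sl l0 cl]] := ext G T R u degD gd'; have [F0 C _] := gd.
have l0u : nth set0 l 0 \subset nbhd u by rewrite l0 subsetIl.
set B0 := ball (r + M.+3) u; set F := npaths T R u in F0 C out.
pose A i := nth set0 l i.
have AB i x : i <= M -> x \in A i -> x \in B0 /\ nbhd x \subset B0.
  move=> iM xi; have xb : x \in ball i.+1 u by apply: chain_ball cl l0u _ xi; rewrite sl ltnS.
  split; first by apply: (subsetP (ball_leq u _)) xb; lia.
  by apply/subsetP => y; rewrite inE => /(ball_step xb) yb; apply: (subsetP (ball_leq u _)) yb; lia.
have tcF : 200 * tcost (ind B0) T R u <= F.
  apply: leq_trans C; apply: leq_mul; first exact: leq_addr.
  by apply: leq_sum => s _; apply: leq_addr.
have use i x : i <= M -> x \in A i -> F <= 200 * \sum_(s <- ipaths T R u) (x \in s).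
  move=> iM xi; have [xB NB] := AB _ _ iM xi.
  have xR : x \in R by apply: (subsetP (chain_sub cl _)) xi; rewrite sl ltnS.
  by have := ipaths_usage T u xR xB NB; rewrite -/F; lia.
pose O := [set w | (w \notin R) && [exists x, edge w x && [exists i : 'I_M.+1, x \in A i]]].
have cO : #|O| <= 200 * L3.
  rewrite -(leq_pmul2r F0) -mulnA -sum_nat_const.
  apply: leq_trans (_ : 200 * \sum_(s <- ipaths T R u) \sum_(w in O) has (edge w) s <= _); last first.
    rewrite leq_mul2l; apply: leq_trans out; apply: leq_sum => s _.
    rewrite -big_mkcondr sum1_card; apply/subset_leq_card/subsetP => w.
    by rewrite inE => /andP [wO hs]; move: wO; rewrite !inE hs => /andP [-> _].
  rewrite exchange_big big_distrr /=; apply: leq_sum => w wO; move: (wO); rewrite inE => /andP [_ /existsP [x]].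
  case/andP => wx /existsP [i xi]; apply: leq_trans (use i x _ xi) _; first by rewrite -ltnS.
  rewrite leq_mul2l; apply: leq_sum => s _; case: (boolP (x \in s)) => // xs.
  by rewrite lt0b; apply/hasP; exists x.
(* A chain vertex outside [Vb] has no neighbour outside R. *)
pose Vb := \bigcup_(w in O) nbhd w.
have cVb : #|Vb| <= 200 * L3 * D.
  apply: leq_trans (card_bigcup_le _ _) _; apply: leq_trans (_ : \sum_(w in O) D <= _).
    exact: leq_sum.
  by rewrite sum_nat_const leq_mul2r cO orbT.
pose q := 200 * L3 * D.
have idx (k : 'I_q.+1) i : i <= L -> k * L.+1 + i <= M.
  by move=> iL; have := ltn_ord k; rewrite /M -/q; nia.
have disj i j x : i <= M -> j <= M -> x \in A i -> x \in A j -> i = j.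
  move=> iM jM xi xj; have [lt|lt|//] := ltngtP i j.
    have dj : [disjoint A i & A j] by apply: (chain_disjoint cl); rewrite sl ltnS lt.
    by rewrite (disjointFr dj xi) in xj.
  have dj : [disjoint A j & A i] by apply: (chain_disjoint cl); rewrite sl ltnS lt.
  by rewrite (disjointFr dj xj) in xi.
pose bad (k : 'I_q.+1) x := (x \in Vb) && [exists i : 'I_L.+1, x \in A (k * L.+1 + i)].
(* Pigeonhole: there are q + 1 disjoint blocks of L + 1 clusters, and [Vb] has at most q
   vertices. *)
have [k free] : exists k : 'I_q.+1, forall i x, i <= L -> x \in A (k * L.+1 + i) -> x \notin Vb.
  case: (pickP (fun k => [forall x, ~~ bad k x])) => [k /forallP nb|none].
    exists k => i x iL xi; move: (nb x); rewrite negb_and => /orP [//|/existsPn].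
    by move=> /(_ (Ordinal (iL : i < L.+1))); rewrite xi.
  have ex k : exists x, bad k x by move/negbT/forallPn: (none k) => [x]; rewrite negbK; exists x.
  pose f k := xchoose (ex k); have fP k : bad k (f k) := xchooseP (ex k).
  have injf : injective f.
    move=> k k' e; have /andP [_ /existsP [i xi]] := fP k; have /andP [_ /existsP [j xj]] := fP k'.
    have iL := ltn_ord i; have jL := ltn_ord j; rewrite !ltnS in iL jL.
    have := disj _ _ _ (idx k i iL) (idx k' j jL) xi; rewrite e => /(_ xj) eq.
    apply: val_inj; have := congr1 (fun m => m %/ L.+1) eq.
    by rewrite !divnMDl // !divn_small // !addn0.
  have := max_card (mem [set: 'I_q.+1]); rewrite cardsT card_ord => _.
  have : #|f @: [set: 'I_q.+1]| <= #|Vb|.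
    by apply/subset_leq_card/subsetP => _ /imsetP [k _ ->]; case/andP: (fP k).
  by rewrite card_imset // cardsT card_ord ltnNge cVb.
have inA i : i <= L -> k * L.+1 + i < size l by move=> iL; rewrite sl; exact: idx _ _ iL.
exists (fun i => A (k * L.+1 + i)); last by move=> i iL; apply: chain_card cl (inA i iL).
split.
- by move=> i iL; rewrite -card_gt0 (chain_card cl (inA i iL)).
- by move=> i j /andP [ij jL]; apply: (chain_disjoint cl); rewrite ltn_add2l ij inA.
- move=> i x y iL xi yi; rewrite (chain_edge cl _ xi yi) ?addnS //.
  by rewrite ltnSn -addnS inA.
move=> i x y /andP [i0 iL] xi xy; have nVx := free i x (ltnW iL) xi.
have ik : k * L.+1 + i < size l := inA i (ltnW iL).
have yR : y \in R.
  apply: contraR nVx => yR; apply/bigcupP; exists y; last by rewrite inE edgeC.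
  rewrite inE yR /=; apply/existsP; exists x; rewrite edgeC xy /=; apply/existsP.
  by rewrite sl in ik; exists (Ordinal ik).
have [j jl yj] : exists2 j, j < size l & y \in A j.
  by apply: chain_nbhd cl _ xi xy yR; rewrite -addnS inA.
have eqA m : m = j -> y \in A m by move=> ->.
rewrite !inE; have [lt|lt|e] := ltngtP j (k * L.+1 + i).
- have := chain_edge cl (_ : j < k * L.+1 + i < size l) yj xi; rewrite lt ik edgeC xy.
  by move=> /(_ isT) /esym/eqP e; rewrite eqA //; lia.
- have := chain_edge cl (_ : k * L.+1 + i < j < size l) xi yj; rewrite lt jl xy.
  by move=> /(_ isT) /esym/eqP e; rewrite (eqA (k * L.+1 + i.+1)) ?orbT //; lia.
- by rewrite (eqA (k * L.+1 + i)) ?orbT.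
Qed.

Lemma sum_const_seq (U : Type) (l : seq U) k : \sum_(x <- l) k = size l * k.
Proof. by rewrite big_const_seq count_predT iter_addn_0 mulnC. Qed.

Lemma sum_mem (U : finType) (A : {set U}) : \sum_x (x \in A) = #|A|.
Proof. by rewrite -sum1_card [RHS]big_mkcond. Qed.

Lemma sum_sub_uniq (U : eqType) (l l' : seq U) (f : U -> nat) :
  uniq l -> {subset l <= l'} -> \sum_(x <- l) f x <= \sum_(x <- l') f x.
Proof.
elim: l l' => [|x l IH] l' /=; first by rewrite big_nil.
case/andP=> xl ul sub; have xl' : x \in l' by apply: sub; rewrite mem_head.
rewrite big_cons (big_rem x xl') /= leq_add2l; apply: IH => // y yl.
have : y \in l' by apply: sub; rewrite inE yl orbT.
rewrite (perm_mem (perm_to_rem xl')) inE => /predU1P [e|//].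
by rewrite e (negPf xl) in yl.
Qed.

Lemma card_uniq_le (U : finType) (I : eqType) (l : seq I) (f : I -> U) (A : {set U}) :
  uniq l -> {in l &, injective f} -> \sum_(i <- l) (f i \in A) <= #|A|.
Proof.
move=> ul injf; rewrite -big_mkcond sum1_count -size_filter /= -(size_map f) cardE.
apply: uniq_leq_size.
  rewrite map_inj_in_uniq ?filter_uniq // => i j; rewrite !mem_filter => /andP [_ il] /andP [_ jl].
  exact: injf.
by move=> x /mapP [i]; rewrite mem_filter mem_enum => /andP [fA _] ->.
Qed.

(** * Averaging over the stages of the exploration *)

Section Averaging.
Variable G : sgraph.
Implicit Types (S T R B Z A : {set G}) (u v w x y a : G) (s : seq G).

(** Grouping the paths longer than j by their first j vertices, each group consists of all
    completions from one node. *)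
Lemma depth_avg (X : {set G} -> G -> seq G -> nat) j Xi T R u :
  (forall al be, al ++ be \in ipaths T R u -> be != [::] -> size al = j ->
     Xi * npaths T (residual R u al) (last u al) <=
     \sum_(s <- ipaths T (residual R u al) (last u al)) X (residual R u al) (last u al) s) ->
  Xi * \sum_(s <- ipaths T R u) (j < size s) <=
  \sum_(s <- ipaths T R u) (j < size s) * X (residual R u (take j s)) (last u (take j s)) (drop j s).
Proof.
elim: j R u => [|j IH] R u H.
  have s0 s : s \in ipaths T R u -> 0 < size s by case: s => //; rewrite nil_ipaths.
  have [->|] := eqVneq (ipaths T R u) [::]; first by rewrite !big_nil muln0.
  case E : (ipaths T R u) => [|s l] // _; rewrite -E.
  have sP : s \in ipaths T R u by rewrite E mem_head.
  have := H [::] s sP _ erefl; rewrite -size_eq0 -lt0n => /(_ (s0 s sP)) /= h.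
  rewrite (eq_big_seq (fun=> 1)) => [|t /s0 -> //]; rewrite sum1_size.
  rewrite (eq_big_seq (X R u)) // => t /s0 t0.
  by rewrite take0 drop0 t0 mul1n.
rewrite !big_ipaths big_distrr; apply: leq_sum => a aA /=; case aT : (a \in T); first by rewrite muln0.
apply: (IH (R :\: nbhd u) a) => al be sP be0 sal; apply: (H (a :: al) be) => //=; last by rewrite sal.
by rewrite mem_ipaths_cons aA aT.
Qed.

Lemma card_cycles_through v0 :
  #|[set S : {set G} | induced_cycle S && (v0 \in S)]| <= \sum_(v1 in nbhd v0) size (cpaths v0 v1).
Proof.
pose l := flatten [seq [seq (v1, s) | s <- cpaths v0 v1] | v1 <- enum (nbhd v0)].
have -> : \sum_(v1 in nbhd v0) size (cpaths v0 v1) = size l.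
  rewrite size_flatten /shape -map_comp sumnE big_map big_enum /=.
  by apply: eq_bigr => v1 _; rewrite size_map.
apply: (card_le_list (g := fun vs => [set x in v0 :: vs.1 :: vs.2])) => S.
rewrite inE => /andP [icS vS]; have [c ic ->] := icycle_from icS vS.
have [v1 [s [-> v1N sP]]] := icycle_cpaths ic.
apply/mapP; exists (v1, s) => //; apply/flatten_mapP; exists v1; rewrite ?mem_enum //.
by apply/mapP; exists s.
Qed.

Section Degree.
Variables (D : nat) (degD : forall x : G, #|nbhd x| <= D).

(** Reversal is injective, so the reversed paths form a subfamily of all the paths around v0. *)
Lemma sum_rev_cost v0 v1 : v1 \in nbhd v0 ->
  \sum_(s <- cpaths v0 v1) ccost (last v1 s) v0 (rev_tail v1 s) <=
  \sum_(v2 in nbhd v0) \sum_(s <- cpaths v0 v2) ccost v2 v0 s.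
Proof.
move=> v01; pose l := flatten [seq [seq (v2, s) | s <- cpaths v0 v2] | v2 <- enum (nbhd v0)].
have -> : \sum_(v2 in nbhd v0) \sum_(s <- cpaths v0 v2) ccost v2 v0 s =
    \sum_(vs <- l) ccost vs.1 v0 vs.2.
  rewrite big_flatten /= big_map big_enum /=.
  by apply: eq_bigr => v2 _; rewrite big_map.
rewrite -(big_map (fun s => (last v1 s, rev_tail v1 s)) predT (fun vs => ccost vs.1 v0 vs.2)).
apply: sum_sub_uniq.
  rewrite map_inj_in_uniq ?ipaths_uniq // => s t _ _ [e1 e2].
  have := congr1 rev (rev_tailE v1 s); rewrite e1 e2 rev_tailE !revK => -[->] //.
move=> _ /mapP [s sP ->]; have [lv rP] := rev_cpaths v01 sP.
by apply/flatten_mapP; exists (last v1 s); rewrite ?mem_enum //; apply/mapP; exists (rev_tail v1 s).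
Qed.

Section OnePath.
Variables (v0 v1 : G) (s : seq G).
Hypotheses (v01 : v1 \in nbhd v0) (sP : s \in cpaths v0 v1).
Let c := v1 :: s.
Let R0 := ~: [set v0; v1].
Let T := nbhd v0.
Let tot := ccost v1 v0 s + ccost (last v1 s) v0 (rev_tail v1 s).

Lemma cpath_uniq : uniq c.
Proof. by have /(cpathsP _ v01) [_ _ _ []] := sP. Qed.

Lemma last_takeE j : j <= size s -> last v1 (take j s) = nth v1 c j.
Proof.
case: j => [|j] js; first by rewrite take0.
by rewrite (take_nth v1) // last_rcons.
Qed.

(** Double counting by the symmetry of balls: the path vertices are distinct, so w is charged
    boundedly often when the local costs of all stages are added. *)
Lemma sum_ball_le l r w : uniq l -> {in l, forall j, j < size c} ->
  \sum_(j <- l) (w \in ball r (nth v1 c j)) <= D.+1 ^ r.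
Proof.
move=> ul lc; apply: leq_trans (card_ball r w degD).
apply: leq_trans (_ : \sum_(j <- l) (nth v1 c j \in ball r w) <= _).
  apply: leq_sum => j _; case: (boolP (w \in ball r _)) => // h.
  by rewrite ball_sym.
apply: card_uniq_le => // i j il jl /eqP; rewrite nth_uniq ?cpath_uniq ?lc //.
by move=> /eqP.
Qed.

Let steps tau := [seq j <- iota 0 tau | j < size s].

Lemma steps_uniq tau : uniq (steps tau).
Proof. by rewrite filter_uniq ?iota_uniq. Qed.

Lemma steps_lt tau : {in steps tau, forall j, j < size c}.
Proof. by move=> j; rewrite mem_filter => /andP [js _]; apply: leqW. Qed.

Lemma local_cost_le tau r :
  \sum_(j <- iota 0 tau) (j < size s) * cost (ind (ball r (last v1 (take j s)))) T
     (residual R0 v1 (take j s)) (last v1 (take j s)) (drop j s) <= D.+1 ^ r * ccost v1 v0 s.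
Proof.
apply: leq_trans (_ : \sum_(j <- steps tau) cost (ind (ball r (nth v1 c j))) T R0 v1 s <= _).
  rewrite [leqRHS]big_filter [leqRHS]big_mkcond; apply: leq_sum => j _; case: (boolP (_ < _)) => // js.
  rewrite mul1n (last_takeE (ltnW js)) -[X in _ <= cost _ _ _ _ X](cat_take_drop j s).
  rewrite -(last_takeE (ltnW js)); apply: cost_cat; first by rewrite cat_take_drop.
  by rewrite -size_eq0 size_drop subn_eq0 -ltnNge.
rewrite -cost_scale cost_sum; apply: leq_cost => w.
exact: sum_ball_le (steps_uniq tau) (@steps_lt tau).
Qed.

Lemma short_tail_le tau m0 :
  \sum_(j <- iota 0 tau) (j < size s) * (size (drop j s) < m0) <= m0.
Proof.
apply: leq_trans (_ : \sum_(j <- iota 0 tau) (j \in iota (size s - m0) m0) <= _).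
  apply: leq_sum => j _; rewrite size_drop mem_iota; case: (boolP (j < size s)) => js //.
  rewrite mul1n; case: (boolP (_ < m0)) => // jm; rewrite lt0b; lia.
by apply: leq_trans (sum_mem_le _ (iota_uniq _ _)) _; rewrite size_iota.
Qed.

Let cross w := \sum_(t <- iota 1 (size s)) (w \in crossing c t).

Lemma gap_le_cross j w : j < size s -> gap (last v1 (take j s)) (drop j s) w <= cross w.
Proof.
move=> js; rewrite /gap.
rewrite -(big_mkord predT (fun k => (has (edge w) (last v1 (take j s) :: take k (drop j s)) &&
  has (edge w) (drop k (drop j s))) : nat)) size_drop /index_iota subn0.
apply: leq_trans (_ : \sum_(k <- iota 0 (size s - j)) (w \in crossing c (j.+1 + k)) <= _).
  apply: leq_sum => k _.
  have tE : take (j.+1 + k) c = (v1 :: take j s) ++ take k (drop j s) by rewrite /= takeD.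
  have dE : drop (j.+1 + k) c = drop k (drop j s) by rewrite /= drop_drop addnC.
  rewrite inE tE dE; case: (has _ (drop _ _)); rewrite ?andbF ?andbT // has_cat.
  rewrite -[_ :: take k _]cat1s has_cat; case: (has _ (take k _)); rewrite ?orbT // !orbF.
  case: (boolP (has _ [:: _])) => // /hasP [x]; rewrite inE => /eqP -> wl; rewrite lt0b.
  by apply/hasP; exists (last v1 (take j s)); rewrite ?mem_last.
rewrite -(big_map (addn j.+1) predT (fun t => (w \in crossing c t) : nat)) -iotaDl addn0.
apply: sum_sub_uniq; first exact: iota_uniq.
by move=> t; rewrite !mem_iota => /andP [jt ts]; lia.
Qed.

Lemma sum_cross_le : \sum_w cross w <= size s * (7 + (D + 4) * tot).
Proof.
rewrite exchange_big /= -[X in X * _](size_iota 1) -sum_const_seq.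
rewrite big_seq [leqRHS]big_seq; apply: leq_sum => t; rewrite mem_iota => /andP [t0 ts].
rewrite sum_mem; apply: (card_crossing degD v01 sP).
by rewrite t0 -ltnS.
Qed.

(** A gap is at most the number of cuts that the vertex crosses. Up to costs, boundedly many
    vertices cross each cut, and there are at most n cuts. *)
Lemma gap_sum_le tau r :
  \sum_(j <- iota 0 tau) (j < size s) *
    \sum_(w in residual R0 v1 (take j s) :&: ball r (last v1 (take j s)))
       gap (last v1 (take j s)) (drop j s) w
  <= D.+1 ^ r * (#|G| * (7 + (D + 4) * tot)).
Proof.
apply: leq_trans (_ : \sum_(j <- steps tau) \sum_w (w \in ball r (nth v1 c j)) * cross w <= _).
  rewrite [leqRHS]big_filter [leqRHS]big_mkcond; apply: leq_sum => j _; case: (boolP (_ < _)) => // js.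
  rewrite mul1n big_mkcond; apply: leq_sum => w _; rewrite inE (last_takeE (ltnW js)).
  case: (w \in ball _ _); rewrite ?andbF // andbT mul1n; case: ifP => // _.
  by rewrite -(last_takeE (ltnW js)) gap_le_cross.
rewrite exchange_big /=; apply: leq_trans (_ : \sum_w D.+1 ^ r * cross w <= _).
  apply: leq_sum => w _; rewrite -big_distrl leq_mul2r; apply/orP; right.
  exact: sum_ball_le (steps_uniq tau) (@steps_lt tau).
rewrite -big_distrr leq_mul2l; apply/orP; right; apply: leq_trans sum_cross_le _.
rewrite leq_mul2r; apply/orP; right; apply: leq_trans (leqnSn _) _.
by rewrite -[(size s).+1]/(size c) -(card_uniqP cpath_uniq) max_card.
Qed.

(** Apart from v0 and v1, such a vertex has neighbours on both sides of the cut. *)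
Lemma outside_le j : j < size s ->
  #|[set w | (w \notin residual R0 v1 (take j s)) && has (edge w) (drop j s)]| <= 9 + (D + 4) * tot.
Proof.
move=> js; have h := @card_crossing G D degD v0 v1 s j.+1 v01 sP.
apply: leq_trans (_ : 2 + #|crossing c j.+1| <= _); last by have := h js; rewrite -/c -/tot; lia.
apply: leq_trans (_ : #|[set v0; v1] :|: crossing c j.+1| <= _).
  apply/subset_leq_card/subsetP => w; rewrite !inE mem_residual negb_and negbK !inE negbK.
  case/andP=> /orP [->//|hw] hd; apply/orP; right; rewrite /= hd andbT.
  by move: hw => /hasP [x /mem_belast xb wx]; apply/(hasP (s := v1 :: take j s)); exists x.
apply: leq_trans (leq_card_setU _ _) _; rewrite leq_add2r cards2.
by case: (_ != _).
Qed.

Lemma outside_sum_le tau :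
  \sum_(j <- iota 0 tau) (j < size s) *
    #|[set w | (w \notin residual R0 v1 (take j s)) && has (edge w) (drop j s)]|
  <= tau * (9 + (D + 4) * tot).
Proof.
rewrite -[X in X * _](size_iota 0) -sum_const_seq; apply: leq_sum => j _.
by case: (boolP (j < size s)) => // js; rewrite mul1n outside_le.
Qed.

Lemma size_cpath_ge : #|G| <= 2 + 3 * size s + D.+1 * ccost v1 v0 s.
Proof.
have := @residual_card_le G D degD T R0 v1 s [::]; rewrite cats0 => /(_ sP).
have := residual_waste sP; rewrite -/T -/R0 => h1 h2.
have : #|G| <= 2 + #|R0|.
  rewrite -(cardsC [set v0; v1]) leq_add2r cards2; by case: (_ != _).
by rewrite /ccost -/T -/R0 mulSn; lia.
Qed.

End OnePath.
End Degree.
End Averaging.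

(** * Existence of a stretch *)

Local Arguments ball : simpl never.

(* Weighing the three conditions defining a good node, some node at depth less than n/12
   satisfies all of them, since the total weights over all nodes are linear in n. *)
Lemma exists_stretch D L : exists n0, forall (G : sgraph) (v0 : G),
  (forall x : G, #|nbhd x| <= D) -> n0 <= #|G| ->
  maxprod #|G| <= 6 * #|[set S : {set G} | induced_cycle S && (v0 \in S)]| ->
  exists2 B : nat -> {set G}, stretch L B & forall i, i <= L -> #|B i| = 3.
Proof.
(* 168 = 28 * 6, since smoothprod is at most 28 maxprod, and maxprod at most 6 D F. [K0] bounds the
   average cost of a path, [K1] that of a path and its reversal. The factors 8 in [L3], 192 = 8 * 24
   in [L2] and 8 in the bound on n make each of the three weights at most an eighth of tau Xi F. *)
pose kap := 168 * D; pose K0 := 84 * kap; pose K1 := K0 * D.+1.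
pose c3 := 9 + (D + 4) * K1; pose L3 := 8 * c3.
pose M := L.+1 * (200 * L3 * D).+1; pose E := D.+1 ^ M.+2 * c3; pose L2 := 192 * E.
have [L1 [r ext]] := good_stretch D L L2 L3; rewrite -/M in ext.
pose A := D.+1 ^ r * K1 + M.+3.
exists (12 + 24 * (8 * L1 * A) + 24 + 4 * (2 * D.+1 * K0) + 8) => G v0 degD nG thru.
set n := #|G| in nG thru; pose tau := n %/ 12.
have n24 : n <= 24 * tau by rewrite /tau; lia.
have tauA : 8 * L1 * A <= tau.
  by move: nG; rewrite /tau; move: (8 * L1 * A) (2 * D.+1 * K0) => x y; lia.
have tauS : 2 * D.+1 * K0 < n - 2 - 3 * tau.
  by move: nG; rewrite /tau; move: (8 * L1 * A) (2 * D.+1 * K0) => x y; lia.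
have cthru := leq_trans thru (leq_mul (leqnn 6) (card_cycles_through v0)).
have [w0 w0N] : exists w, w \in nbhd v0.
  apply/set0Pn; apply: contraTneq cthru => ->; rewrite big_set0 muln0 -ltnNge.
  exact: maxprod_gt0.
have [v1 v01 vmax] := arg_maxnP (fun v => size (cpaths v0 v)) w0N.
set F := size (cpaths v0 v1) in vmax.
have cF : maxprod n <= 6 * (D * F).
  apply: leq_trans cthru _; rewrite leq_mul2l; apply/orP; right.
  apply: leq_trans (_ : \sum_(v in nbhd v0) F <= _); first by apply: leq_sum => v vN; apply: vmax.
  by rewrite sum_nat_const leq_mul2r degD orbT.
have F0 : 0 < F.
  by rewrite lt0n; apply: contraTneq cF => ->; rewrite !muln0 -ltnNge maxprod_gt0.
have smF v : smoothprod #|~: [set v0; v]| <= kap ^ 2 * F.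
  apply: leq_trans (smoothprod_le _) _.
  have le := leq_trans (maxprod_mono (max_card (mem (~: [set v0; v])))) cF.
  apply: leq_trans (leq_mul (leqnn 28) le) _; rewrite -/kap (_ : 28 * (6 * (D * F)) = kap * F); last first.
    by rewrite /kap; lia.
  rewrite leq_mul2r; apply/orP; right; have [->|k0] := posnP kap; first by [].
  by rewrite expnS expn1 leq_pmulr.
have costF v : v \in nbhd v0 -> \sum_(s <- cpaths v0 v) ccost v v0 s <= K0 * F.
  by move=> vN; apply: tcost_le (smF v); apply: vmax.
pose tot s := ccost v1 v0 s + ccost (last v1 s) v0 (rev_tail v1 s).
have totF : \sum_(s <- cpaths v0 v1) tot s <= K1 * F.
  rewrite big_split /= /K1 mulnS mulnDl leq_add ?costF //.
  apply: leq_trans (sum_rev_cost v01) _.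
  apply: leq_trans (_ : \sum_(v in nbhd v0) K0 * F <= _); first exact: leq_sum.
  by rewrite sum_nat_const mulnAC mulnC leq_mul2l degD orbT.
have AE : A = D.+1 ^ r * K1 + M.+3 by [].
have EE : E = D.+1 ^ M.+2 * c3 by [].
have [L2E L3E c3E] : [/\ L2 = 192 * E, L3 = 8 * c3 & c3 = 9 + (D + 4) * K1] by [].
clearbody A L2 E M L3 c3.
pose R0 := ~: [set v0; v1]; pose T := nbhd v0.
have [Xi XiE] : exists Xi, Xi = L2 * L3 by exists (L2 * L3).
(* As Xi = L2 L3, an average of X below Xi yields both averages in [good] and the hypothesis of
   [good_stretch] on outside vertices. *)
pose X R' u s := L1 * Xi * (cost (ind (ball r u)) T R' u s + (size s < M.+3)) +
  L3 * (\sum_(w in R' :&: ball M.+2 u) gap u s w) +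
  L2 * #|[set w | (w \notin R') && has (edge w) s]|.
pose node j s := (residual R0 v1 (take j s), last v1 (take j s)).
pose tX R' u := \sum_(s <- ipaths T R' u) X R' u s.
case: (boolP (has (fun j => has (fun s => (j < size s) &&
  (tX (node j s).1 (node j s).2 < Xi * npaths T (node j s).1 (node j s).2)) (cpaths v0 v1)) (iota 0 tau))).
  case/hasP => j _ /hasP [s sP /andP [js lt]].
  move: lt; rewrite /tX; move: (node j s).1 (node j s).2 => R' u.
  rewrite !big_split /= -!big_distrr /=; set a := \sum_(t <- _) (_ + _); set b := \sum_(t <- _) _.
  set d := \sum_(t <- _) _; set F' := npaths _ _ _ => lt.
  have Xi0 : 0 < Xi by case: (Xi) lt; rewrite ?ltn0.
  have [L20 L30] : 0 < L2 /\ 0 < L3 by move: Xi0; rewrite XiE muln_gt0 => /andP [].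
  apply: (ext G T R' u degD); last first.
    by rewrite -(leq_pmul2l L20) mulnA -XiE; apply: leq_trans (ltnW lt); apply: leq_addl.
  split.
  - by rewrite -/F' lt0n; apply: contraTneq lt => ->; rewrite muln0.
  - rewrite -(leq_pmul2l Xi0) mulnA [Xi * L1]mulnC; apply: leq_trans (ltnW lt).
    by rewrite -addnA leq_addr.
  - rewrite -(leq_pmul2l L30) mulnA [L3 * L2]mulnC -XiE; apply: leq_trans (ltnW lt).
    by rewrite -addnA addnCA leq_addr.
move=> /hasPn none; exfalso.
have avg j : j \in iota 0 tau -> Xi * \sum_(s <- cpaths v0 v1) (j < size s) <=
    \sum_(s <- cpaths v0 v1) (j < size s) * X (node j s).1 (node j s).2 (drop j s).
  move=> /none /hasPn nonej; apply: depth_avg => al be sP be0 sal.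
  have := nonej _ sP; rewrite size_cat -sal -{1}[size al]addn0 ltn_add2l lt0n size_eq0 be0 /=.
  by rewrite /node take_size_cat // -leqNgt.
(* At least half of the paths have tau or more steps, because the cost of a shorter one is linear in
   n. *)
have lower : tau * Xi * F <= 2 * (Xi * \sum_(j <- iota 0 tau) \sum_(s <- cpaths v0 v1) (j < size s)).
  have short : 2 * \sum_(s <- cpaths v0 v1) (size s < tau) <= F.
    have h : (n - 2 - 3 * tau) * \sum_(s <- cpaths v0 v1) (size s < tau) <= D.+1 * (K0 * F).
      apply: leq_trans (leq_mul (leqnn D.+1) (costF _ v01)); rewrite !big_distrr /=.
      rewrite big_seq [leqRHS]big_seq; apply: leq_sum => s sP.
      have := size_cpath_ge degD v01 sP; rewrite -/n; case: (boolP (size s < tau)) => st; rewrite ?muln0 ?muln1 // => h1.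
      by move: (D.+1 * ccost v1 v0 s) h1 => x; rewrite /= in st *; lia.
    move: h tauS; move: (n - _ - _) (\sum_(s <- _) _) => m sh h tauS.
    rewrite leqNgt; apply/negP => lt.
    have h1 : m * F.+1 <= m * (2 * sh) by rewrite leq_mul2l lt orbT.
    have h2 : 2 * D.+1 * K0 * F.+1 < m * F.+1 by rewrite ltn_pmul2r.
    by move: h h1 h2; move: (D.+1) => d; rewrite !mulnS; nia.
  have ge : tau * F <= \sum_(s <- cpaths v0 v1) (\sum_(j <- iota 0 tau) (j < size s) + tau * (size s < tau)).
    rewrite mulnC /F -sum_const_seq; apply: leq_sum => s _; case: (leqP tau (size s)) => st.
      rewrite muln0 addn0 big_seq (eq_bigr (fun=> 1)) -?big_seq ?sum1_size ?size_iota // => j.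
      by rewrite mem_iota add0n => /(leq_trans)/(_ st) ->.
    by rewrite muln1 leq_addl.
  move: ge; rewrite big_split /= -big_distrr /= exchange_big /=.
  move: short; move: (\sum_(j <- _) _) (\sum_(s <- _) (size s < tau)) => P sh short ge.
  have : tau * (2 * sh) <= tau * F by rewrite leq_mul2l short orbT.
  rewrite mulnCA => h; have P2 : tau * F <= 2 * P by lia.
  by rewrite mulnAC [2 * _]mulnCA mulnC leq_mul2l P2 orbT.
have upper : \sum_(j <- iota 0 tau) \sum_(s <- cpaths v0 v1) (j < size s) * X (node j s).1 (node j s).2 (drop j s)
    <= F * (L1 * Xi * A + L3 * (n * E) + L2 * (tau * c3)).
  rewrite exchange_big /=.
  pose bd s := L1 * Xi * (D.+1 ^ r * ccost v1 v0 s + M.+3) +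
    L3 * (D.+1 ^ M.+2 * (n * (7 + (D + 4) * tot s))) + L2 * (tau * (9 + (D + 4) * tot s)).
  apply: leq_trans (_ : \sum_(s <- cpaths v0 v1) bd s <= _).
    rewrite big_seq [leqRHS]big_seq; apply: leq_sum => s sP.
    under eq_bigr => j _ do rewrite /X !mulnDr !(mulnCA (_ < _ : nat)).
    rewrite !big_split /= -!big_distrr /= -mulnDr; apply: leq_add; first apply: leq_add.
    - rewrite leq_mul2l; apply/orP; right; apply: leq_add.
        by have h := local_cost_le degD v01 sP tau r; apply: h.
      by have h := short_tail_le v01 sP tau M.+3; apply: h.
    - rewrite leq_mul2l; apply/orP; right; by have h := gap_sum_le degD v01 sP tau M.+2; apply: h.
    - rewrite leq_mul2l; apply/orP; right; by have h := outside_sum_le degD v01 sP tau; apply: h.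
  rewrite /bd; under eq_bigr do rewrite !mulnDr.
  rewrite !big_split /= !sum_const_seq -!big_distrr /= -/F.
  have cF1 : \sum_(s <- cpaths v0 v1) ccost v1 v0 s <= K1 * F.
    by apply: leq_trans totF; apply: leq_sum => s _; apply: leq_addr.
  move: totF; rewrite big_split /=; set a := \sum_(s <- _) ccost v1 v0 s in cF1 *.
  set b := \sum_(s <- _) ccost (last _ _) _ _ => abF.
  have t1 : L1 * Xi * (D.+1 ^ r * a) <= L1 * Xi * (D.+1 ^ r * (K1 * F)) by rewrite !leq_mul2l cF1 !orbT.
  have t2 : L3 * (D.+1 ^ M.+2 * (n * ((D + 4) * (a + b)))) <= L3 * (D.+1 ^ M.+2 * (n * ((D + 4) * (K1 * F)))).
    by rewrite !leq_mul2l abF !orbT.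
  have t3 : L2 * (tau * ((D + 4) * (a + b))) <= L2 * (tau * ((D + 4) * (K1 * F))).
    by rewrite !leq_mul2l abF !orbT.
  rewrite AE EE c3E; move: t1 t2 t3; clear; move: (D.+1 ^ r) (D.+1 ^ M.+2) (D + 4) => P P0 d.
  by move: (M.+3) => m3; lia.
have c30 : 0 < c3 by rewrite c3E.
have E0 : 0 < E by rewrite EE muln_gt0 expn_gt0 c30.
have Xi0 : 0 < Xi by rewrite XiE L2E L3E !muln_gt0 E0 c30.
have low : tau * Xi * F <= 2 * (F * (L1 * Xi * A + L3 * (n * E) + L2 * (tau * c3))).
  apply: leq_trans lower _; rewrite leq_mul2l; apply: leq_trans upper.
  by rewrite big_distrr /= big_seq [leqRHS]big_seq; apply: leq_sum.
have e1 : Xi * (8 * L1 * A) <= Xi * tau by rewrite leq_mul2l tauA orbT.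
have e2 : 8 * (L3 * (n * E)) <= Xi * tau.
  have : L3 * E * n <= L3 * E * (24 * tau) by rewrite leq_mul2l n24 orbT.
  by rewrite XiE L2E; lia.
have e3 : 8 * (L2 * (tau * c3)) = Xi * tau by rewrite XiE L3E; lia.
have tau0 : 0 < tau by rewrite /tau; lia.
have XtF : 0 < Xi * tau * F by rewrite !muln_gt0 Xi0 tau0.
set sm := _ + _ + _ in low.
have : 8 * sm <= 3 * (Xi * tau) by rewrite /sm; move: (L3 * _) (L2 * _) e1 e2 e3 => x y; lia.
move=> h; have : F * (8 * sm) <= F * (3 * (Xi * tau)) by rewrite leq_mul2l h orbT.
by move: XtF low; clear; lia.
Qed.

(** * Counting cycles crudely *)

Section Counting.
Variable G : sgraph.
Implicit Types (S T R U : {set G}) (u v w x y a : G) (c s : seq G).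

Definition cycles_in U := [set S : {set G} | induced_cycle S && (S \subset U)].

Lemma induced_cycle_card S : induced_cycle S -> 2 < #|S|.
Proof. by case/andP. Qed.

(* A cycle through v is given by the two neighbours of v on it and by a path
   avoiding the other neighbours of v. *)
Lemma ends_at_middle v c : ends_at v c ->
  exists v1 vl s, [/\ c = v1 :: rcons s vl, v1 \in nbhd v, vl \in nbhd v &
    forall U, {subset s <= U} -> s != [::] -> s \in ipaths (nbhd vl) (U :\: (v |: nbhd v)) v1].
Proof.
case=> sz vc ends ip; case: c sz vc ends ip => // v1 c; case/lastP: c => // s vl _ vc ends ip.
have e1 : v1 \in nbhd v by rewrite inE ends ?mem_head //= eqxx.
have e2 : vl \in nbhd v by rewrite inE ends ?inE ?mem_rcons ?mem_head ?orbT //= last_rcons eqxx orbT.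
exists v1, vl, s; split=> // U sU s0.
have [/= /andP [v1s us] _] := ip; rewrite mem_rcons inE negb_or in v1s.
have [_ v1s'] := andP v1s; rewrite rcons_uniq in us; have [vls us'] := andP us.
have := ipath_rev ip; rewrite -rcons_cons rev_rcons -rev_tailE => /ipath_cons [_ lv nt ip'].
have ips : ipath (v1 :: s) by rewrite -[v1 :: s]revK -rev_tailE; apply: ipath_rev.
apply/mem_ipaths; first by rewrite !inE; move: e1; rewrite inE => ->; rewrite orbT.
have sc x : x \in s -> x \in v1 :: rcons s vl by move=> xs; rewrite inE mem_rcons inE xs !orbT.
split=> // x xs.
  rewrite !inE sU // ends ?sc //= last_rcons andbT !negb_or; apply/and3P; split.
  - by apply: contraNneq vc => <-; apply: sc.
  - by apply: contraTneq xs => ->.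
  - by apply: contraTneq xs => ->.
rewrite inE; case: eqP => [->|ne]; first exact: lv.
apply/negbTE/nt; have : x \in rev (v1 :: s) by rewrite mem_rev inE xs orbT.
by rewrite -rev_tailE inE => /predU1P [].
Qed.

(** The summand 1 is for triangles, whose middle part is empty. *)
Lemma card_cycles_through_le U v : v \in U ->
  #|[set S in cycles_in U | v \in S]| <= #|nbhd v :&: U| ^ 2 * (1 + maxprod #|U :\: (v |: nbhd v)|).
Proof.
move=> vU; set N := nbhd v :&: U; pose R := U :\: (v |: nbhd v).
pose l := flatten [seq flatten [seq [seq (a, b, s) | s <- [::] :: ipaths (nbhd b) R a]
                                | b <- enum N] | a <- enum N].
apply: leq_trans (_ : size l <= _).
  apply: (card_le_list (g := fun t => [set x in v :: t.1.1 :: rcons t.2 t.1.2])) => S.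
  rewrite !inE => /andP [/andP [icS SU] vS]; have [c ic SE] := icycle_from icS vS.
  have [a [b [s [cE aN bN sP]]]] := ends_at_middle (icycle_ends_at ic).
  have cU x : x \in v :: c -> x \in U by move=> xc; apply: (subsetP SU); rewrite SE inE.
  apply/mapP; exists (a, b, s); last by rewrite SE cE.
  have aNU : a \in N by rewrite inE aN cU // cE !inE eqxx orbT.
  have bNU : b \in N by rewrite inE bN cU // cE !inE mem_rcons mem_head !orbT.
  apply/flatten_mapP; exists a; rewrite ?mem_enum //.
  apply/flatten_mapP; exists b; rewrite ?mem_enum //.
  apply/mapP; exists s => //; rewrite inE; case: eqVneq => //= s0; apply: sP => // x xs.
  by apply: cU; rewrite cE !inE mem_rcons inE xs !orbT.
rewrite size_flatten /shape -map_comp sumnE big_map big_enum /=.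
rewrite expnS expn1 -mulnA -sum_nat_const; apply: leq_sum => a _.
rewrite size_flatten /shape -map_comp sumnE big_map big_enum /=.
rewrite -sum_nat_const; apply: leq_sum => b _.
by rewrite size_map add1n ltnS; apply: npaths_maxprod.
Qed.

(** There are d^2 choices for the two neighbours of v, and losing d vertices divides maxprod by at
    least (4/3)^d. The vertex v itself is kept in the count, as [maxprod_grow] needs a positive
    argument. *)
Lemma cycles_through_pow U v : v \in U ->
  4 ^ #|nbhd v :&: U| * #|[set S in cycles_in U | v \in S]| <=
  2 * #|nbhd v :&: U| ^ 2 * 3 ^ #|nbhd v :&: U| * maxprod #|U|.
Proof.
move=> vU; have := card_cycles_through_le vU; set d := #|nbhd v :&: U|; set k := #|U :\: _|.
have kE : d + k.+1 = #|U|.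
  rewrite -(cardsID (v |: nbhd v) U) -/k -addSnnS; congr (_ + _).
  have -> : U :&: (v |: nbhd v) = v |: (nbhd v :&: U).
    by apply/setP => x; rewrite !inE; case: eqP => [->|_]; rewrite ?vU //= andbC.
  by rewrite cardsU1 !inE edgexx.
move=> h; have g := @maxprod_grow d k.+1 isT; rewrite kE in g.
have m := maxprod_mono (leqnSn k); have m0 := maxprod_gt0 k.
have h1 : #|[set S in cycles_in U | v \in S]| <= d ^ 2 * (2 * maxprod k.+1).
  by apply: leq_trans h _; rewrite leq_mul2l; apply/orP; right; lia.
apply: leq_trans (leq_mul (leqnn _) h1) _.
have : 2 * d ^ 2 * (4 ^ d * maxprod k.+1) <= 2 * d ^ 2 * (3 ^ d * maxprod #|U|) by rewrite leq_mul2l g orbT.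
lia.
Qed.

Lemma cycles_through_const U v : v \in U ->
  #|[set S in cycles_in U | v \in S]| <= 14 * maxprod #|U|.
Proof.
move=> vU; have := cycles_through_pow vU; set d := #|nbhd v :&: U| => h.
rewrite -(@leq_pmul2l (4 ^ d)) ?expn_gt0 //; apply: leq_trans h _.
by rewrite mulnA [4 ^ d * 14]mulnC leq_mul2r sqr_pow_le orbT.
Qed.

Lemma cycles_in_split U v :
  #|cycles_in U| = #|[set S in cycles_in U | v \in S]| + #|cycles_in (U :\ v)|.
Proof.
rewrite -(cardsID [set S : {set G} | v \in S] (cycles_in U)); congr (_ + _).
  by congr #|pred_of_set _|; apply/setP => S; rewrite !inE.
congr #|pred_of_set _|; apply/setP => S; rewrite !inE subsetD1.
by case: (induced_cycle S); case: (v \in S); rewrite ?andbF ?andbT.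
Qed.

Lemma cycles_in_small U : #|U| < 3 -> #|cycles_in U| = 0.
Proof.
move=> U3; apply/eqP; rewrite cards_eq0; apply/eqP/setP => S; rewrite !inE.
apply/negbTE/negP => /andP [/induced_cycle_card S3 /subset_leq_card]; lia.
Qed.

(** Deleting one vertex after another works since 14 + 60 * 3/4 = 59 <= 60. *)
Lemma cycles_in_le U : #|cycles_in U| <= 60 * maxprod #|U|.
Proof.
have [n] := ubnP #|U|; elim: n U => // n IH U Un.
have [U3|U3] := ltnP #|U| 3; first by rewrite cycles_in_small.
have [v vU] : exists v, v \in U by apply/set0Pn; rewrite -card_gt0; lia.
have cU : #|U| = #|U :\ v|.+1 by rewrite (cardsD1 v U) vU.
have := cycles_through_const vU; rewrite (cycles_in_split U v).
have := IH (U :\ v) _; rewrite cU => /(_ ltac:(lia)).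
by have := @maxprod_step #|U :\ v| _; lia.
Qed.

Lemma cycles_in_setT : #|cycles_in [set: G]| = num_induced_cycles G.
Proof. by congr #|pred_of_set _|; apply/setP => S; rewrite !inE subsetT andbT. Qed.

Definition cycles_at v := [set S : {set G} | induced_cycle S && (v \in S)].

Lemma cycles_at_setT v : [set S in cycles_in [set: G] | v \in S] = cycles_at v.
Proof. by apply/setP => S; rewrite !inE subsetT andbT. Qed.

(** The hypothesis gives 1/6 <= 2 d^2 (3/4)^d, which [sqr_pow_lt] with c = 12 excludes from d = 162
    * 12 + 10 = 1954 on. *)
Lemma degree_le v : maxprod #|G| <= 6 * #|cycles_at v| -> #|nbhd v| <= 1954.
Proof.
move=> h; rewrite leqNgt; apply/negP => dl.
have := cycles_through_pow (in_setT v); rewrite setIT cycles_at_setT cardsT.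
have := @sqr_pow_lt 12 #|nbhd v| _; rewrite (_ : 162 * 12 + 10 <= _) => [/(_ isT)|]; last by lia.
have m0 := maxprod_gt0 #|G|.
move: #|cycles_at v| (maxprod _) (3 ^ _) (4 ^ _) (_ ^ 2) h m0 => t m a b d h m0 h1 h2.
have h3 : 12 * d * a * m < b * m by rewrite ltn_pmul2r.
have h4 : b * m <= b * (6 * t) by rewrite leq_mul2l h orbT.
lia.
Qed.

End Counting.

(** * Nearly optimal path counts *)

Section Optimal.
Variable G : sgraph.
Implicit Types (S T R U : {set G}) (u v w x y a b : G) (c s : seq G).

(* The number of paths is larger than (1 - k/2000) times its maximum possible value. *)
Definition nearly_opt k T R u :=
  2000 * maxprod #|R| < 2000 * npaths T R u + k * maxprod #|R|.

Lemma npaths_card_le T R u : npaths T R u <= #|nbhd u :&: R| * maxprod #|R :\: nbhd u|.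
Proof.
rewrite npathsE -sum_nat_const; apply: leq_sum => a _.
by apply: npaths_via_le; [apply: maxprod_gt0 | apply: mul_maxprod].
Qed.

Lemma card_nbhd_split R u : #|nbhd u :&: R| + #|R :\: nbhd u| = #|R|.
Proof. by rewrite -(cardsID (nbhd u) R) setIC. Qed.

Lemma nearly_opt_gt0 k T R u : k <= 2000 -> nearly_opt k T R u -> 0 < npaths T R u.
Proof.
rewrite /nearly_opt => k2; case: (npaths T R u) => // h; move: h; rewrite muln0 add0n ltnNge.
by rewrite leq_mul2r k2 orbT.
Qed.

(** Five or more choices lose 1/6 of the optimum, more than the allowed 300/2000. *)
Lemma nearly_opt_card k T R u : k <= 300 -> nearly_opt k T R u -> #|nbhd u :&: R| <= 4.
Proof.
rewrite /nearly_opt => k3 h; rewrite leqNgt; apply/negP => d5.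
have := mul_maxprod_big #|R :\: nbhd u| d5; rewrite card_nbhd_split.
have := npaths_card_le T R u; move: h; have := maxprod_gt0 #|R|.
have : k * maxprod #|R| <= 300 * maxprod #|R| by rewrite leq_mul2r k3 orbT.
by move: (k * _) (_ * maxprod #|_ :\: _|) => x y; lia.
Qed.

(** At worst the whole loss falls on one of at most four choices. *)
Lemma nearly_opt_via k T R u a : k <= 300 -> nearly_opt k T R u -> a \in nbhd u :&: R ->
  2000 * maxprod #|R :\: nbhd u| < 2000 * npaths_via T R u a + 4 * k * maxprod #|R :\: nbhd u|.
Proof.
move=> k3 h aA; have d4 := nearly_opt_card k3 h; move: h; rewrite /nearly_opt.
set p := maxprod #|R|; set p1 := maxprod #|R :\: nbhd u|; set d := #|nbhd u :&: R| in d4 *.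
have dp : d * p1 <= p by rewrite /p -(card_nbhd_split R u) mul_maxprod.
have d0 : 0 < d by rewrite card_gt0; apply/set0Pn; exists a.
have Fle : npaths T R u <= npaths_via T R u a + d.-1 * p1.
  rewrite npathsE (bigD1 a) //= leq_add2l.
  apply: leq_trans (_ : \sum_(b in nbhd u :&: R | b != a) p1 <= _).
    by apply: leq_sum => b _; apply: npaths_via_le; [apply: maxprod_gt0 | apply: mul_maxprod].
  rewrite sum_nat_const leq_mul2r; apply/orP; right.
  have -> : d.-1 = #|(nbhd u :&: R) :\ a| by rewrite /d (cardsD1 a (nbhd u :&: R)) aA.
  by apply/subset_leq_card/subsetP => b /andP [bA ba]; apply/setD1P; split.
move: Fle; move: (npaths _ _ _) (npaths_via _ _ _ _) => F f Fle h.
have h1 : (2000 - k) * (d * p1) <= (2000 - k) * p by rewrite leq_mul2l dp orbT.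
have h2 : d.-1 * p1 + p1 = d * p1 by rewrite -mulSnr prednK.
have h3 : k * (d * p1) <= 4 * k * p1 by rewrite mulnA leq_mul2r [4 * k]mulnC leq_mul2l d4 !orbT.
rewrite !mulnBl in h1; have h4 : k * p <= 2000 * p by rewrite leq_mul2r (leq_trans k3) ?orbT.
have h5 : k * (d * p1) <= 2000 * (d * p1) by rewrite leq_mul2r (leq_trans k3) ?orbT.
move: h1 h2 h3 h4 h5 Fle h; move: (k * p) (d * p1) (d.-1 * p1) => x y z.
by move: (k * y) (4 * k * p1) => t r; lia.
Qed.

Lemma nearly_opt_child k T R u a : k <= 300 -> nearly_opt k T R u -> a \in nbhd u :&: R ->
  a \notin T -> nearly_opt (4 * k) T (R :\: nbhd u) a.
Proof.
move=> k3 h aA aT; have := nearly_opt_via k3 h aA.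
by rewrite /nearly_opt /npaths_via (negPf aT).
Qed.

(** A path that stops counts 1 where maxprod of the remainder would be possible. Two or more
    vertices left lose at least half of this; a single one left allows only d paths instead of
    maxprod (d + 1), a loss of at least a quarter for d <= 4. *)
Lemma nearly_opt_end k T R u a : k <= 200 -> nearly_opt k T R u -> a \in nbhd u :&: R ->
  a \in T -> R :\: nbhd u = set0.
Proof.
move=> k2 h aA aT; have k3 : k <= 300 by apply: leq_trans k2 _.
have := nearly_opt_via k3 h aA; have d4 := nearly_opt_card k3 h.
rewrite /npaths_via aT; have := npaths_card_le T R u; move: h; rewrite /nearly_opt.
rewrite -(card_nbhd_split R u); have d0 : 0 < #|nbhd u :&: R| by rewrite card_gt0; apply/set0Pn; exists a.
move=> h F p1; apply/eqP; rewrite -cards_eq0; move: h F p1 d0 d4.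
move: (npaths _ _ _) #|nbhd u :&: R| #|R :\: nbhd u| => F d [|r] // h Fd p1 d0 d4.
have p2 : maxprod r.+1 < 2.
  rewrite ltnNge; apply/negP => p2.
  have : 4 * k * maxprod r.+1 <= 800 * maxprod r.+1 by rewrite leq_mul2r; apply/orP; right; lia.
  by lia.
have r0 : r = 0 by case: r p2 {h Fd p1} => // r p2; have := maxprod_mono (isT : 2 <= r.+2); move: p2; rewrite /maxprod -/maxprod; lia.
rewrite r0 /= muln1 addn1 in h Fd.
have : k * maxprod d.+1 <= 200 * maxprod d.+1 by rewrite leq_mul2r k2 orbT.
by case: d d0 d4 h Fd => [|[|[|[|[|d]]]]] // _ _ /=; lia.
Qed.

(** By averaging, some choice loses no more than the whole, so k need not grow along a path. *)
Lemma nearly_opt_best k T R u : k <= 2000 -> nearly_opt k T R u ->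
  exists2 a, a \in nbhd u :&: R &
    2000 * maxprod #|R :\: nbhd u| < 2000 * npaths_via T R u a + k * maxprod #|R :\: nbhd u|.
Proof.
move=> k2 h; set p1 := maxprod _.
case: (pickP (fun a => (a \in nbhd u :&: R) && (2000 * p1 < 2000 * npaths_via T R u a + k * p1))).
  by move=> a /andP [aA ha]; exists a.
move=> none; exfalso; move: h; rewrite /nearly_opt ltnNge => /negP [].
have dp : #|nbhd u :&: R| * p1 <= maxprod #|R| by rewrite -(card_nbhd_split R u) mul_maxprod.
have : 2000 * npaths T R u + k * (#|nbhd u :&: R| * p1) <= 2000 * (#|nbhd u :&: R| * p1).
  rewrite npathsE -!sum_nat_const !big_distrr -big_split /=; apply: leq_sum => a aA.
  by have := none a; rewrite aA /= ltnNge => /negbFE.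
move: dp; move: (_ * p1) (maxprod _) (npaths _ _ _) => x p F xp h.
have : (2000 - k) * x <= (2000 - k) * p by rewrite leq_mul2l xp orbT.
rewrite !mulnBl; have : k * p <= 2000 * p by rewrite leq_mul2r k2 orbT.
have : k * x <= 2000 * x by rewrite leq_mul2r k2 orbT.
by move: h; move: (k * x) (k * p) => t r; lia.
Qed.

(** * Cycles along a stretch *)

Lemma cycle_nbrs S x : induced_cycle S -> 4 < #|S| -> x \in S ->
  exists y z, [/\ nbhd x :&: S = [set y; z], y != z, ~~ edge y z &
    forall w, w \in S -> w != x -> edge w y -> edge w z -> False].
Proof.
move=> icS S5 xS; have [c ic SE] := icycle_from icS xS.
have [_ /= /andP [xc uc] _] := ic; have [sz _ ends [_ adj]] := icycle_ends_at ic.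
have sc : 3 < size c.
  by move: S5; rewrite SE cardsE (card_uniqP _) //= xc.
case: c ic SE xc uc sz ends adj sc => // y c; case/lastP: c => // c z ic SE xc uc _ ends adj sc.
rewrite /= last_rcons in ends; move: sc; rewrite /= size_rcons ltnS => sc.
have nthz : nth x (y :: rcons c z) (size c).+1 = z by rewrite /= nth_rcons ltnn eqxx.
have ltz : (size c).+1 < size (y :: rcons c z) by rewrite /= size_rcons.
exists y, z; split.
- apply/setP => w; rewrite in_set2; apply/idP/idP => [/setIP []|wyz].
    rewrite inE => xw wS; have wc : w \in y :: rcons c z.
      move: wS; rewrite SE inE inE => /predU1P [e|//].
      by rewrite e edgexx in xw.
    by rewrite -(ends w wc).
  have wc : w \in y :: rcons c z.
    by case/orP: wyz => /eqP ->; rewrite !inE ?mem_rcons ?inE eqxx ?orbT.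
  by rewrite in_setI inE ends // wyz SE inE inE wc orbT.
- by move: uc => /= /andP []; rewrite mem_rcons inE negb_or => /andP [].
- by have := adj x 0 (size c).+1 isT ltz; rewrite nthz /= => ->; rewrite eqSS; case: (size c) sc.
move=> w wS wx wy wz; have wc : w \in y :: rcons c z by move: wS; rewrite SE inE inE (negPf wx).
have iw : index w (y :: rcons c z) < size (y :: rcons c z) by rewrite index_mem.
have nw := nth_index x wc; set i := index w _ in iw nw.
have i0 : i != 0 by apply: contraTneq wy => e; rewrite -nw e /= edgexx.
have iz : i != (size c).+1 by apply: contraTneq wz => e; rewrite -nw e nthz edgexx.
have i1 : i = 1.
  have := adj x 0 i _ iw; rewrite lt0n i0 nw /= edgeC wy => /(_ isT) /esym/eqP; lia.
have := adj x i (size c).+1 _ ltz; rewrite nw nthz wz i1 => /(_ _) /esym/eqP.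
by move: iw iz i1; rewrite /= size_rcons; lia.
Qed.

Section Along.
Variables (L : nat) (B : nat -> {set G}).
Hypothesis st : stretch L B.

Lemma stretch_disj i j x : i <= L -> j <= L -> x \in B i -> x \in B j -> i = j.
Proof.
move=> iL jL xi xj; have [_ dj _ _] := st; have [lt|lt|//] := ltngtP i j.
  have d : [disjoint B i & B j] by apply: dj; rewrite lt.
  by rewrite (disjointFr d xi) in xj.
have d : [disjoint B j & B i] by apply: dj; rewrite lt.
by rewrite (disjointFr d xj) in xi.
Qed.

Lemma stretch_edge i x y : i < L -> x \in B i -> y \in B i.+1 -> edge x y.
Proof. by have [_ _ e _] := st; apply: e. Qed.

Lemma stretch_edge_pred i x y : 0 < i <= L -> x \in B i.-1 -> y \in B i -> edge x y.
Proof. by case: i => // i /= iL; apply: stretch_edge. Qed.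

Lemma stretch_neq i j x y : i <= L -> j <= L -> i != j -> x \in B i -> y \in B j -> x != y.
Proof.
move=> iL jL ij xi yj; apply: contraNneq ij => e; apply/eqP.
by apply: stretch_disj iL jL xi _; rewrite e.
Qed.

Lemma stretch_nbhd i x y : 0 < i < L -> x \in B i -> edge x y ->
  [\/ y \in B i.-1, y \in B i | y \in B i.+1].
Proof.
have [_ _ _ h] := st => iL xi xy; have := h i x y iL xi xy.
by rewrite !inE -orbA => /or3P.
Qed.

Lemma stretch_nonedge i j x y : 0 < i < L -> j <= L -> x \in B i -> y \in B j ->
  j != i.-1 -> j != i -> j != i.+1 -> ~~ edge x y.
Proof.
move=> iL jL xi yj n1 n2 n3; apply/negP => /(stretch_nbhd iL xi).
case/andP: iL => i0 iL.
case=> yj'; [case/negP: n1|case/negP: n2|case/negP: n3]; apply/eqP;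
  by apply: stretch_disj yj yj' => //; lia.
Qed.

(** Consecutive clusters are completely joined, so p, x, q is then a piece of the cycle. *)
Definition passes i S := exists x p q,
  [/\ x \in B i :&: S, p \in B i.-1 :&: S & q \in B i.+1 :&: S].

(** The second neighbour of q on S must lie in the next cluster: in B i it would share the
    neighbours p and q with x, and in B (i + 1) it would be a third neighbour of x. *)
Lemma passes_step i S x p q : induced_cycle S -> 4 < #|S| -> 0 < i -> i.+1 < L ->
  x \in B i :&: S -> p \in B i.-1 :&: S -> q \in B i.+1 :&: S ->
  exists w, w \in B i.+2 :&: S.
Proof.
move=> icS S5 i0 iL /setIP [xi xS] /setIP [pi pS] /setIP [qi qS].
have [y [z [nx yz _ n4]]] := cycle_nbrs icS S5 xS.
have iL' : i < L := ltnW iL.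
have iLp : 0 < i <= L by rewrite i0 ltnW.
have pL : i.-1 <= L := leq_trans (leq_pred i) (ltnW iL').
have xq : edge x q := stretch_edge iL' xi qi.
have px : edge p x := stretch_edge_pred iLp pi xi.
have pq : p != q by apply: (stretch_neq pL iL' _ pi qi); clear -i0; lia.
have inx w : w \in S -> edge x w -> w = p \/ w = q.
  have [pyz qyz] : p \in [set y; z] /\ q \in [set y; z] by rewrite -nx !inE pS qS edgeC px xq.
  move=> wS xw; have : w \in [set y; z] by rewrite -nx !inE xw wS.
  by move: pyz qyz pq; rewrite !inE => /orP [] /eqP -> /orP [] /eqP ->; rewrite ?eqxx // => _ /orP [] /eqP ->; auto.
have n4' w : w \in S -> w != x -> edge w p -> edge w q -> False.
  have [pyz qyz] : p \in [set y; z] /\ q \in [set y; z] by rewrite -nx !inE pS qS edgeC px xq.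
  move=> wS wx wp wq; apply: (n4 w wS wx); move: pyz qyz pq wp wq;
  by rewrite !inE => /orP [] /eqP -> /orP [] /eqP ->; rewrite ?eqxx.
have [y' [z' [nq yz' _ _]]] := cycle_nbrs icS S5 qS.
have xq' : x \in [set y'; z'] by rewrite -nq !inE xS edgeC xq.
have [w [wS qw wx]] : exists w, [/\ w \in S, edge q w & w != x].
  have wq w : w \in [set y'; z'] -> w \in S /\ edge q w by rewrite -nq !inE => /andP [].
  move: xq'; rewrite !inE => /orP [] /eqP e.
    by exists z'; have [? ?] := wq z' (set22 _ _); rewrite e eq_sym.
  by exists y'; have [? ?] := wq y' (set21 _ _); rewrite e.
have iq : 0 < i.+1 < L by rewrite iL.
have [wi|wi|wi] := stretch_nbhd iq qi qw.
- exfalso; apply: (n4' w wS wx); last by rewrite edgeC.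
  by rewrite edgeC; apply: stretch_edge_pred iLp pi wi.
- exfalso; have [e|e] := inx w wS (stretch_edge iL' xi wi).
    have : w != p by apply: (stretch_neq iL' pL _ wi pi); clear -i0; lia.
    by rewrite e eqxx.
  by rewrite e edgexx in qw.
- by exists w; rewrite inE wi.
Qed.

Lemma passes_next i S : induced_cycle S -> 4 < #|S| -> 0 < i -> i.+1 < L ->
  passes i S -> passes i.+1 S.
Proof.
move=> icS S5 i0 iL [x [p [q [xi pi qi]]]].
by have [w wi] := passes_step icS S5 i0 iL xi pi qi; exists q, x, w.
Qed.

(** If both neighbours y and z of x on S lay on the same side, the vertex after y would be adjacent
    to z, closing a square, or would be a third neighbour of x. *)
Lemma passes_start i S x : induced_cycle S -> 4 < #|S| -> 1 < i -> i.+1 < L -> #|B i| = 3 ->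
  x \in B i -> x \in S -> passes i S.
Proof.
move=> icS S5 i1 iL B3 xi xS; have i0 : 0 < i by lia.
have [y [z [nx yz nyz n4]]] := cycle_nbrs icS S5 xS.
have iL0 : i < L := ltnW iL.
have iL' : 0 < i < L by rewrite i0.
have iLp : 0 < i <= L by rewrite i0 ltnW.
have inx w : w \in S -> edge x w -> w = y \/ w = z.
  move=> wS xw; have : w \in [set y; z] by rewrite -nx !inE xw wS.
  by rewrite !inE => /orP [] /eqP; auto.
have [[yS xy] [zS xz]] : (y \in S /\ edge x y) /\ (z \in S /\ edge x z).
  have h w : w \in [set y; z] -> w \in S /\ edge x w by rewrite -nx !inE => /andP [].
  by split; apply: h; rewrite ?set21 ?set22.
have other u : u \in S -> edge x u -> exists w, [/\ w \in S, edge u w & w != x].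
  move=> uS xu; have [y' [z' [nu yz' _ _]]] := cycle_nbrs icS S5 uS.
  have wq w : w \in [set y'; z'] -> w \in S /\ edge u w by rewrite -nu !inE => /andP [].
  have : x \in [set y'; z'] by rewrite -nu !inE xS edgeC xu.
  rewrite !inE => /orP [] /eqP e.
    by exists z'; have [? ?] := wq z' (set22 _ _); rewrite e eq_sym.
  by exists y'; have [? ?] := wq y' (set21 _ _); rewrite e.
(* a neighbour of x in its own cluster forces the whole cluster on the cycle *)
have own u v : u \in S -> v \in S -> edge x u -> edge x v -> u != v -> ~~ edge u v ->
    (forall w, w \in S -> edge x w -> w = u \/ w = v) -> u \in B i -> False.
  move=> uS vS xu xv uv nuv nbx ui.
  have vi : v \in B i.
    have [vi|//|vi] := stretch_nbhd iL' xi xv; case/negP: nuv.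
      by rewrite edgeC; apply: stretch_edge_pred iLp vi ui.
    exact: stretch_edge iL0 ui vi.
  have Bi : B i = [set x; u; v].
    apply/esym/eqP; rewrite eqEcard; apply/andP; split.
      by apply/subsetP => w; rewrite !inE => /orP [/orP [] |] /eqP ->.
    rewrite B3; have -> : [set x; u; v] = x |: [set u; v] by rewrite setUA.
    rewrite cardsU1 cards2 uv !inE negb_or.
    have ne w : edge x w -> x != w by move=> xw; apply: contraTneq xw => ->; rewrite edgexx.
    by rewrite !ne.
  have [w [wS uw wx]] := other u uS xu.
  have wi : w \notin B i.
    rewrite Bi !inE (negPf wx) /= negb_or; apply/andP; split; apply: contraTneq uw => ->.
      by rewrite edgexx.
    exact: nuv.
  have xw : edge x w.
    have [wi'|wi'|wi'] := stretch_nbhd iL' ui uw.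
    - by rewrite edgeC; apply: stretch_edge_pred iLp wi' xi.
    - by rewrite wi' in wi.
    - exact: stretch_edge iL0 xi wi'.
  have [e|e] := nbx w wS xw; first by rewrite e edgexx in uw.
  by rewrite e (negPf nuv) in uw.
have side k : 0 < k < L -> (forall w, w \in B k -> edge x w) -> y \in B k -> z \in B k -> False.
  move=> kL xk yk zk; have [k0 kL0] := andP kL.
  have kLp : 0 < k <= L by rewrite k0 ltnW.
  have [w [wS yw wx]] := other y yS xy.
  have clash : edge w z -> False by move=> wz; apply: (n4 w wS wx) => //; rewrite edgeC.
  have [wk|wk|wk] := stretch_nbhd kL yk yw.
  - by apply: clash; apply: stretch_edge_pred kLp wk zk.
  - have [e|e] := inx w wS (xk w wk); first by rewrite e edgexx in yw.
    by rewrite e (negPf nyz) in yw.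
  - by apply: clash; rewrite edgeC; apply: stretch_edge kL0 zk wk.
have sideL : 0 < i.-1 < L by apply/andP; split; [case: (i) i1 => [|[]] | apply: leq_ltn_trans (leq_pred i) iL0].
have sideR : 0 < i.+1 < L by rewrite iL.
have edgeL w : w \in B i.-1 -> edge x w by move=> wi; rewrite edgeC; apply: stretch_edge_pred iLp wi xi.
have edgeR w : w \in B i.+1 -> edge x w by move=> wi; apply: stretch_edge iL0 xi wi.
have nbx' w : w \in S -> edge x w -> w = z \/ w = y by move=> wS /(inx w wS) []; auto.
have zy : z != y by rewrite eq_sym.
have nzy : ~~ edge z y by rewrite edgeC.
have [y0|y0|y0] := stretch_nbhd iL' xi xy; have [z0|z0|z0] := stretch_nbhd iL' xi xz.
- by exfalso; apply: side sideL edgeL y0 z0.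
- by exfalso; apply: own zS yS xz xy zy nzy nbx' z0.
- by exists x, y, z; rewrite !inE xi xS y0 yS z0 zS.
- by exfalso; apply: own yS zS xy xz yz nyz inx y0.
- by exfalso; apply: own yS zS xy xz yz nyz inx y0.
- by exfalso; apply: own yS zS xy xz yz nyz inx y0.
- by exists x, z, y; rewrite !inE xi xS y0 yS z0 zS.
- by exfalso; apply: own zS yS xz xy zy nzy nbx' z0.
- by exfalso; apply: side sideR edgeR y0 z0.
Qed.

End Along.
End Optimal.

(** * Extending a stretch *)

Section Extension.
Variable G : sgraph.
Implicit Types (S T R U : {set G}) (u v w x y a b : G) (c s : seq G).

Lemma npaths_eq0 T R u : u \notin T ->
  (forall v a, v \in u |: R -> v \notin T -> a \in T :&: R -> ~~ edge v a) -> npaths T R u = 0.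
Proof.
have [n] := ubnP #|R|; elim: n R u => // n IH R u Rn uT h.
rewrite npathsE big1 // => a /[dup] aA /setIP []; rewrite inE => ua aR.
have aT : a \notin T.
  by apply: contraTN ua => aT; apply: h; rewrite ?setU11 // inE aT.
rewrite /npaths_via (negPf aT); apply: IH => //.
  by apply: leq_trans (card_residual aA) _; rewrite -ltnS.
move=> v b vR vT /setIP [bT /setDP [bR _]]; apply: h => //; last by rewrite inE bT.
by move: vR; rewrite !inE => /orP [/eqP -> | /andP [_ ->]]; rewrite ?aR orbT.
Qed.

(** A closed-up [stretch]: edges inside a cluster are still unrestricted. *)
Definition ring k (B : nat -> {set G}) : Prop :=
  [/\ forall i, i < k -> B i != set0,
      forall v, exists2 i, i < k & v \in B i,
      forall i j v, i < k -> j < k -> v \in B i -> v \in B j -> i = j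
    & forall i j x y, i < k -> j < k -> i != j -> x \in B i -> y \in B j ->
        edge x y = cyc_adj k i j].

Variables (M : nat) (B : nat -> {set G}).
Hypotheses (st : stretch M.+4 B) (M0 : 0 < M).

Let b1 := B M.+1.
Let b2 := B M.+2.
Let b3 := B M.+3.
Let b4 := B M.+4.

Let nonedge i j x y : 0 < i < M.+4 -> j <= M.+4 -> (j < i.-1) || (i.+1 < j) ->
  x \in B i -> y \in B j -> edge x y = false.
Proof.
move=> iL jL ij xi yj; apply/negbTE; apply: (stretch_nonedge st iL jL xi yj);
  by apply: contraTneq ij => ->; clear -iL; lia.
Qed.

Let nbhd_b2 x y : x \in b2 -> edge x y -> [|| y \in b1, y \in b2 | y \in b3].
Proof. by move=> xb xy; case: (stretch_nbhd st _ xb xy) => [|->|->|->]; rewrite ?orbT // !ltnS ?leqnSn ?leqnn. Qed.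

Let nbhd_b3 x y : x \in b3 -> edge x y -> [|| y \in b2, y \in b3 | y \in b4].
Proof. by move=> xb xy; case: (stretch_nbhd st _ xb xy) => [|->|->|->]; rewrite ?orbT // !ltnS ?leqnSn ?leqnn. Qed.

Let nonempty i : i <= M.+4 -> exists x, x \in B i.
Proof. by case: st => h _ _ _ iL; apply/set0Pn/h. Qed.

(** The exploration has come round to y next to the far end of the stretch. The target is reached
    only through b4, b3, b2 in this order, so a choice outside b4 at y, or outside b3 after that,
    has no completions, while leftover vertices contradict [nearly_opt_end]. The bound k <= 4 leaves
    room for the further steps. *)
Lemma forced_end k R y : k <= 4 -> nearly_opt k b2 R y -> [disjoint R & b1] ->
  b2 \subset R -> b3 \subset R -> b4 \subset R ->
  y \notin b1 -> y \notin b2 -> y \notin b3 -> y \notin b4 -> ~~ [disjoint nbhd y & b4] ->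
  nbhd y :&: R = b4 /\ R = b4 :|: b3 :|: b2.
Proof.
move=> k4 opt Rb1 sb2 sb3 sb4 yb1 yb2 yb3 yb4.
have k1 : k <= 300 by clear -k4; lia.
have k2 : 4 * k <= 300 by clear -k4; lia.
have k3 : 4 * (4 * k) <= 200 by clear -k4; lia.
have k3' : 4 * (4 * k) <= 300 by clear -k4; lia.
have [g1 g2 g3] : [/\ 4 * k <= 2000, 4 * (4 * k) <= 2000 & 4 * (4 * (4 * k)) <= 2000].
  by split; clear -k4; lia.
have ynb2 w : w \in b2 -> edge y w = false.
  move=> wb; apply/negbTE/negP; rewrite edgeC => /(nbhd_b2 wb).
  by rewrite (negPf yb1) (negPf yb2) (negPf yb3).
have ynb3 w : w \in b3 -> edge y w = false.
  move=> wb; apply/negbTE/negP; rewrite edgeC => /(nbhd_b3 wb).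
  by rewrite (negPf yb2) (negPf yb3) (negPf yb4).
have T4 w : w \in b4 -> w \notin b2.
  move=> wb; apply/negP => /(stretch_disj st _ _ wb); clear; lia.
have T3 w : w \in b3 -> w \notin b2.
  move=> wb; apply/negP => /(stretch_disj st _ _ wb); clear; lia.
case/pred0Pn => a /andP [/=]; rewrite inE => ya ab4.
set R1 := R :\: nbhd y; set R2 := R1 :\: nbhd a.
have R1b1 w : w \in R1 -> w \notin b1 by case/setDP => wR _; rewrite (disjointFr Rb1).
have sR1 w : w \in b2 :|: b3 -> w \in R1.
  rewrite !inE => /orP [] wb; first by rewrite ynb2 ?(subsetP sb2).
  by rewrite ynb3 ?(subsetP sb3).
have aR : a \in nbhd y :&: R by rewrite !inE ya (subsetP sb4).
have opt1 := nearly_opt_child k1 opt aR (T4 a ab4).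
have [b bb3] := @nonempty M.+3 (leqnSn _); rewrite -/b3 in bb3.
have [c cb2] := @nonempty M.+2 (leqW (leqnSn _)); rewrite -/b2 in cb2.
have ab3 w : w \in b3 -> edge a w.
  by move=> wb; rewrite edgeC; apply: (stretch_edge st (leqnn _) wb ab4).
have ab2 w : w \in b2 -> edge a w = false.
  by move=> wb; rewrite edgeC; apply: (nonedge _ (leqnn _) _ wb ab4); clear; lia.
have bR : b \in nbhd a :&: R1 by apply/setIP; split; [rewrite inE ab3 | apply: sR1; rewrite inE bb3 orbT].
have opt2 := nearly_opt_child k2 opt1 bR (T3 b bb3).
have sR2 w : w \in b2 -> w \in R2 by move=> wb; apply/setDP; split; [apply: sR1; rewrite inE wb | rewrite inE ab2].
have cR : c \in nbhd b :&: R2.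
  by rewrite in_setI sR2 // andbT inE edgeC; apply: (stretch_edge st (leqnSn _) cb2 bb3).
have R2b : R2 \subset nbhd b by rewrite -setD_eq0; apply/eqP/(nearly_opt_end k3 opt2 cR cb2).
have R2b24 w : w \in R2 -> (w \in b2) || (w \in b4).
  move=> wR2; have := subsetP R2b _ wR2; rewrite inE => /(nbhd_b3 bb3).
  case/or3P=> [->//|wb|->]; last by rewrite orbT.
  by move: wR2; rewrite inE inE ab3.
have R2E : R2 = b2.
  apply/setP => e; apply/idP/idP; last exact: sR2.
  move=> eR2; case/orP: (R2b24 e eR2) => // eb4; exfalso.
  have eR : e \in nbhd b :&: R2 by rewrite inE (subsetP R2b).
  have := nearly_opt_gt0 g3 (nearly_opt_child k3' opt2 eR (T4 e eb4)).
  rewrite npathsE (_ : R2 :\: nbhd b = set0); last by apply/eqP; rewrite setD_eq0.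
  by rewrite setI0 big_set0.
have a1E w : w \in nbhd a :&: R1 -> w \in b3.
  move=> /[dup] wA /setIP []; rewrite inE => aw wR1.
  have wb2 : w \notin b2 by apply/negP => wb; rewrite ab2 in aw.
  apply/negPn/negP => wb3; have := nearly_opt_gt0 g2 (nearly_opt_child k2 opt1 wA wb2).
  rewrite npaths_eq0 //.
  move=> v e; rewrite -/R2 R2E setIid !inE => /orP [/eqP -> _ eb|-> //].
  apply/negP; rewrite edgeC => /(nbhd_b2 eb).
  by rewrite (negPf wb2) (negPf wb3) (negPf (R1b1 w wR1)).
have R1E : R1 = b3 :|: b2.
  apply/setP => w; apply/idP/idP; last by rewrite setUC; apply: sR1.
  move=> wR1; rewrite inE; case aw: (w \in nbhd a); first by rewrite a1E // inE aw.
  by rewrite -R2E [w \in R2]inE aw wR1 orbT.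
have yE : nbhd y :&: R = b4.
  apply/setP => w; apply/idP/idP => [/[dup] wA /setIP []|wb4].
    rewrite inE => yw wR.
    have wb2 : w \notin b2 by apply/negP => wb; rewrite ynb2 in yw.
    have wb3 : w \notin b3 by apply/negP => wb; rewrite ynb3 in yw.
    have wb1 : w \notin b1 by rewrite (disjointFr Rb1).
    apply/negPn/negP => wb4; have := nearly_opt_gt0 g1 (nearly_opt_child k1 opt wA wb2).
    rewrite npathsE (_ : _ :&: _ = set0).
      by rewrite big_set0.
    apply/setP => e; rewrite -/R1 R1E !inE; apply/negP => /andP [we /orP [] eb].
      by move: we; rewrite edgeC => /(nbhd_b3 eb); rewrite (negPf wb2) (negPf wb3) (negPf wb4).
    by move: we; rewrite edgeC => /(nbhd_b2 eb); rewrite (negPf wb2) (negPf wb3) (negPf wb1).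
  rewrite inE (subsetP sb4 _ wb4) andbT; apply/negPn/negP => yw.
  have : w \in R1 by rewrite inE yw (subsetP sb4).
  rewrite R1E !inE => /orP [] wb; last by move: (T4 w wb4); rewrite wb.
  by have := stretch_disj st _ _ wb wb4; clear; lia.
by split=> //; rewrite -(setID R (nbhd y)) [R :&: _]setIC yE -/R1 R1E setUA.
Qed.

(** The next cluster of the stretch, unless the braid closes up. *)
Definition outer := [set w | [&& w \notin b3, w \notin b4 & ~~ [disjoint nbhd w & b4]]].

Let b4_edge w e : w \in b2 -> e \in b4 -> edge w e = false.
Proof. by move=> wb eb; apply: (nonedge _ (leqnn _) _ wb eb); clear; lia. Qed.

(** Best choices keep k = 1 until a vertex next to b4 is reached. A vertex of [outer] discarded on
    the way is another choice at some step, so it is nearly optimal with k = 4, and [forced_end]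
    applies to it too. *)
Lemma outer_complete R u : nearly_opt 1 b2 R u -> [disjoint R & b1] ->
  b2 \subset R -> b3 \subset R -> b4 \subset R ->
  u \notin b1 -> u \notin b2 -> u \notin b3 -> u \notin b4 ->
  {in outer :&: (u |: R), forall w, b4 \subset nbhd w} /\ outer :&: (u |: R) != set0.
Proof.
have [n] := ubnP #|R|; elim: n R u => // n IH R u Rn opt Rb1 sb2 sb3 sb4 ub1 ub2 ub3 ub4.
case du: [disjoint nbhd u & b4]; last first.
  have [uE RE] := forced_end (isT : 1 <= 4) opt Rb1 sb2 sb3 sb4 ub1 ub2 ub3 ub4 (negbT du).
  split.
    move=> w; rewrite in_setI => /andP [/[!inE] /and3P [wb3 wb4 wd]].
    rewrite RE !inE (negPf wb3) (negPf wb4) /= => /orP [/eqP ->|wb2].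
      by have := subsetIl (nbhd u) R; rewrite uE.
    case/pred0Pn: wd => e /andP [/=]; rewrite inE => we eb.
    by rewrite b4_edge in we.
  by apply/set0Pn; exists u; rewrite inE setU11 inE ub3 ub4 du.
have ub3N w : w \in b3 -> edge u w = false.
  move=> wb; apply/negbTE/negP; rewrite edgeC => /(nbhd_b3 wb).
  by rewrite (negPf ub2) (negPf ub3) (negPf ub4).
have ub2N w : w \in b2 -> edge u w = false.
  move=> wb; apply/negbTE/negP; rewrite edgeC => /(nbhd_b2 wb).
  by rewrite (negPf ub1) (negPf ub2) (negPf ub3).
have ub4N w : w \in b4 -> edge u w = false.
  by move=> wb; have := disjointFl du wb; rewrite inE.
have sub (b : {set G}) : b \subset R -> (forall w, w \in b -> edge u w = false) -> b \subset R :\: nbhd u.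
  by move=> bR bN; apply/subsetP => w wb; rewrite inE (subsetP bR) // inE bN.
have child a : a \in nbhd u :&: R -> [/\ a \notin b1, a \notin b2, a \notin b3 & a \notin b4].
  case/setIP; rewrite inE => ua aR; split; first by rewrite (disjointFr Rb1).
  - by apply: contraTN ua => ab; rewrite ub2N.
  - by apply: contraTN ua => ab; rewrite ub3N.
  - by apply: contraTN ua => ab; rewrite ub4N.
have [a aA] := nearly_opt_best (isT : 1 <= 2000) opt.
have [ab1 ab2 ab3 ab4] := child a aA.
rewrite /npaths_via (negPf ab2) => opt1.
have d1 : [disjoint R :\: nbhd u & b1].
  by apply: disjointWl Rb1; apply: subsetDl.
have [s2 s3 s4] := And3 (sub _ sb2 ub2N) (sub _ sb3 ub3N) (sub _ sb4 ub4N).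
have [] := IH (R :\: nbhd u) a _ opt1 d1 s2 s3 s4 ab1 ab2 ab3 ab4.
  by apply: leq_trans (card_residual aA) _; rewrite -ltnS.
move=> all_c /set0Pn [w0 /setIP [w0o w0R]]; split; last first.
  apply/set0Pn; exists w0; rewrite inE w0o /=; case/setU1P: w0R => [->|/setDP [w0R _]].
    by apply/setU1P; right; case/setIP: aA.
  by apply/setU1P; right.
move=> w /setIP [wo /setU1P [e|wR]].
  by exfalso; move: wo; rewrite inE e du andbF andbF.
case uw: (w \in nbhd u); last first.
  by apply: all_c; rewrite inE wo; apply/setU1P; right; rewrite inE uw.
have wA : w \in nbhd u :&: R by rewrite inE uw.
have [wb1 wb2 wb3 wb4] := child w wA.
have opt4 := nearly_opt_child (isT : 1 <= 300) opt wA wb2.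
move: wo; rewrite inE => /and3P [_ _ wd].
have [wE _] := forced_end (isT : 4 * 1 <= 4) opt4 d1 s2 s3 s4 wb1 wb2 wb3 wb4 wd.
by have := subsetIl (nbhd w) (R :\: nbhd u); rewrite wE.
Qed.

Lemma extend_stretch : {in outer, forall w, b4 \subset nbhd w} -> outer != set0 ->
  [disjoint outer & B 0] -> stretch M.+4.+1 (fun i => if i <= M.+4 then B i else outer).
Proof.
move=> oc o0 od; have [ne dj ce nb] := st.
have oB i w : i <= M.+4 -> w \in outer -> w \notin B i.
  move=> iL /[dup] wo; rewrite inE => /and3P [wb3 wb4 wd].
  have [-> //|n4] := eqVneq i M.+4; have [-> //|n3] := eqVneq i M.+3.
  have [->|i0] := posnP i; first by rewrite (disjointFr od).
  apply/negP => wi; case/pred0Pn: wd => e /andP [/=]; rewrite inE => we eb.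
  by move: we; rewrite (nonedge _ (leqnn _) _ wi eb) //; clear -n4 n3 i0 iL; lia.
split.
- by move=> i iL; case: ifP => // iL'; apply: ne.
- move=> i j /andP [ij jL]; have iL : i <= M.+4 by rewrite -ltnS (leq_trans ij).
  rewrite iL; case: (leqP j M.+4) => jL'; first by apply: dj; rewrite ij.
  by rewrite disjoint_sym; apply/pred0P => w /=; apply/negbTE/negP => /andP [/(oB i w iL) /negPf ->].
- move=> i x y; rewrite ltnS => iL; rewrite iL; case: (ltnP i M.+4) => iL'; first exact: ce.
  move=> xi yo; have e : i = M.+4 by apply/eqP; rewrite eqn_leq iL.
  by rewrite edgeC; have := subsetP (oc y yo) x; rewrite inE; apply; rewrite /b4 -e.
move=> i x y /andP [i0]; rewrite ltnS => iL; rewrite iL (leq_trans (leq_pred i) iL) => xi xy.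
case: (ltnP i M.+4) => iL'; first by apply: nb xy => //; rewrite i0.
have e : i = M.+4 by apply/eqP; rewrite eqn_leq iL.
rewrite e /= in xi *; rewrite !inE; case y3: (y \in B M.+3); case y4: (y \in B M.+4) => //=.
by apply/pred0Pn; exists x; rewrite /= inE edgeC xy xi.
Qed.

(** What is available once the exploration has run down the stretch from B M to B j, with B (M + 1)
    excluded from the start. *)
Definition rest j := [set v | all (fun i => v \notin B i) (index_iota j M.+2)].

Let restP j v : reflect (forall i, j <= i < M.+2 -> v \notin B i) (v \in rest j).
Proof.
rewrite inE; apply: (iffP allP) => h i iL; apply: h; rewrite ?mem_index_iota //.
by rewrite mem_index_iota in iL.
Qed.

Let nbhd_rest j u : 0 < j <= M -> u \in B j ->
  nbhd u :&: rest j = B j.-1 /\ rest j :\: nbhd u = rest j.-1.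
Proof.
move=> jM uj; have [j0 jM'] := andP jM.
have jL : 0 < j < M.+4 by clear -jM; lia.
have jL' : 0 < j <= M.+4 by clear -jM; lia.
have E : nbhd u :&: rest j = B j.-1.
  apply/setP => v; rewrite in_setI inE; apply/idP/idP => [/andP [uv /restP vR]|vj].
    have [//|vj|vj] := stretch_nbhd st jL uj uv.
      by have := vR j; rewrite vj => /(_ ltac:(clear -jM; lia)).
    by have := vR j.+1; rewrite vj => /(_ ltac:(clear -jM; lia)).
  rewrite edgeC (stretch_edge_pred st jL' vj uj); apply/restP => i iL; apply/negP => vi.
  have := stretch_disj st _ _ vj vi; clear -iL jL j0; lia.
split=> //; apply/setP => v; apply/setDP/restP => [[/restP vR uv] i /andP [ji iM]|vR].
  have [lt|ge] := ltnP i j; last by apply: vR; rewrite ge.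
  have -> : i = j.-1 by clear -ji lt; lia.
  apply: contra uv => vi; have : v \in nbhd u :&: rest j by rewrite E.
  by case/setIP.
have vRj : v \in rest j by apply/restP => i iL; apply: vR; clear -iL; lia.
split=> //; apply/negP => uv; have : v \in nbhd u :&: rest j by rewrite inE uv.
by rewrite E; apply/negP/vR; clear -jM; lia.
Qed.

Lemma descend x : x \in B M -> nearly_opt 1 b2 (rest M) x ->
  exists2 u, u \in B 1 & nearly_opt 1 b2 (rest 1) u.
Proof.
move=> xM opt; have h m : m < M -> exists2 u, u \in B (M - m) & nearly_opt 1 b2 (rest (M - m)) u.
  elim: m => [|m IH] mM; first by exists x; rewrite ?subn0.
  have [u uB uopt] := IH (ltnW mM).
  have jM : 0 < M - m <= M by clear -mM; lia.
  have e : (M - m).-1 = M - m.+1 by rewrite subnS.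
  have [nE rE] := nbhd_rest jM uB; rewrite e in nE rE.
  have [a] := nearly_opt_best (isT : 1 <= 2000) uopt.
  rewrite nE /npaths_via rE => aB.
  case: ifP => [ab2 _|_ aopt]; last exact: (ex_intro2 _ _ a aB aopt).
  exfalso; have := stretch_disj st _ _ aB ab2; clear; lia.
have e : M - M.-1 = 1 by clear -M0; lia.
by have := h M.-1; rewrite ltn_predL => /(_ M0); rewrite e.
Qed.

(** The exploration runs down to a vertex of B 0 that is adjacent to the last cluster. By
    [forced_end] only b2, b3 and b4 are then left, so the clusters cover the graph. *)
Lemma close_ring x : x \in B M -> nearly_opt 1 b2 (rest M) x ->
  {in outer, forall w, b4 \subset nbhd w} -> ~~ [disjoint outer & B 0] -> ring M.+4.+1 B.
Proof.
move=> xM opt oc; case/pred0Pn => y /andP [/= yo y0].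
have [u u1 uopt] := descend xM opt.
have [nE rE] := nbhd_rest (M0 : 0 < 1 <= M) u1.
have opt4 w : w \in B 0 -> nearly_opt 4 b2 (rest 0) w.
  move=> w0; have wA : w \in nbhd u :&: rest 1 by rewrite nE.
  rewrite -rE; apply: (nearly_opt_child (isT : 1 <= 300) uopt wA).
  by apply/negP => wb2; have := stretch_disj st _ _ w0 wb2; clear; lia.
have B0 w i : 0 < i <= M.+4 -> w \in B 0 -> w \notin B i.
  move=> iL w0; apply/negP => wi; have := stretch_disj st _ _ w0 wi; clear -iL; lia.
have nB w : w \in B 0 -> [/\ w \notin b1, w \notin b2, w \notin b3 & w \notin b4].
  by move=> w0; split; apply: B0 w0; clear; lia.
have rB i w : M.+1 < i <= M.+4 -> w \in B i -> w \in rest 0.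
  move=> iL wi; apply/restP => j jM; apply/negP => wj.
  by have := stretch_disj st _ _ wi wj; clear -iL jM; lia.
have d1 : [disjoint rest 0 & b1].
  by apply/pred0P => w /=; apply/negbTE/negP => /andP [/restP /(_ M.+1 (leqnn _)) /negPf ->].
have [s2 s3 s4] : [/\ b2 \subset rest 0, b3 \subset rest 0 & b4 \subset rest 0].
  by split; apply/subsetP => w; apply: rB; clear; lia.
have yd : ~~ [disjoint nbhd y & b4] by move: yo; rewrite inE => /and3P [].
have [y1 y2 y3 y4] := nB y y0.
have [_ RE] := forced_end (isT : 4 <= 4) (opt4 y y0) d1 s2 s3 s4 y1 y2 y3 y4 yd.
have B0o w : w \in B 0 -> w \in outer.
  move=> w0; have [w1 w2 w3 w4] := nB w w0; rewrite inE w3 w4 /=; apply/negP => dw.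
  have := nearly_opt_gt0 (isT : 4 <= 2000) (opt4 w w0).
  rewrite npathsE (_ : _ :&: _ = set0) ?big_set0 //; apply/setP => e; rewrite RE !inE.
  apply/negP => /andP [we /orP [/orP [] eb|eb]].
  - by move: we; have := disjointFl dw eb; rewrite inE => ->.
  - by move: we; rewrite edgeC => /(nbhd_b3 eb); rewrite (negPf w2) (negPf w3) (negPf w4).
  - by move: we; rewrite edgeC => /(nbhd_b2 eb); rewrite (negPf w1) (negPf w2) (negPf w3).
have cover v : exists2 i, i < M.+4.+1 & v \in B i.
  case vR: (v \in rest 0).
    move: vR; rewrite RE !inE => /orP [/orP [] vb|vb]; [exists M.+4|exists M.+3|exists M.+2] => //;
    by clear; lia.
  case: (pickP (fun i : 'I_M.+4.+1 => v \in B i)) => [i vi|none]; first by exists i.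
  case/negP: (negbT vR); apply/restP => i iM.
  have iL : i < M.+4.+1 by clear -iM; lia.
  by have := none (Ordinal iL) => /= ->.
have ringE i j v w : i < j -> j < M.+4.+1 -> v \in B i -> w \in B j -> edge v w = cyc_adj M.+4.+1 i j.
  move=> ij jL vi wj; rewrite cyc_adjE //; last by apply: ltn_trans jL.
  have [i0|i0] := posnP i; last first.
    have iL : 0 < i < M.+4 by clear -i0 ij jL; lia.
    have [ji|ji] := eqVneq j i.+1.
      rewrite (stretch_edge st _ vi) -?ji //; clear -jL ji ij; lia.
    rewrite (nonedge iL _ _ vi wj); clear -ji ij jL i0; lia.
  rewrite i0 in vi ij *; have [j4|j4] := eqVneq j M.+4.
    by rewrite j4 in wj *; rewrite eqxx orbT; have := subsetP (oc v (B0o v vi)) w wj; rewrite inE.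
  have jL' : 0 < j < M.+4 by clear -j4 jL ij; lia.
  have [j1|j1] := eqVneq j 1.
    by rewrite j1 in wj *; rewrite (stretch_edge st _ vi wj).
  rewrite edgeC (nonedge jL' _ _ wj vi) //; clear -j1 j4 jL ij; lia.
split=> //.
- by move=> i iL; apply/set0Pn/nonempty.
- by move=> i j v iL jL vi vj; apply: (stretch_disj st _ _ vi vj).
move=> i j v w iL jL ij vi wj; case: (ltngtP i j) ij => // lt _; first exact: ringE.
by rewrite edgeC (ringE _ _ _ _ lt) // /cyc_adj orbC.
Qed.

Lemma restM : rest M = ~: (B M :|: b1).
Proof.
apply/setP => v; rewrite in_setC in_setU negb_or; apply/restP/andP => [h|[h0 h1] i iM].
  by split; apply: h; clear; lia.
by have [->|->] : i = M \/ i = M.+1 by clear -iM; lia.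
Qed.

(** A cycle along the stretch is explored from x in B M away from B (M + 1): it runs down to B 0,
    and comes back through b4 and b3 to its target b2. *)
Lemma stretch_step x : x \in B M -> nearly_opt 1 b2 (~: (B M :|: b1)) x ->
  (exists2 B', stretch M.+4.+1 B' & forall i, i <= M.+4 -> B' i = B i) \/ ring M.+4.+1 B.
Proof.
rewrite -restM => xM opt.
have [oc o0] : {in outer, forall w, b4 \subset nbhd w} /\ outer != set0.
  have rB i : M.+1 < i <= M.+4 -> B i \subset rest M.
    move=> iL; apply/subsetP => w wi; apply/restP => j jM; apply/negP => wj.
    by have := stretch_disj st _ _ wi wj; clear -iL jM; lia.
  have xB i : M < i <= M.+4 -> x \notin B i.
    move=> iL; apply/negP => xi; have := stretch_disj st _ _ xM xi; clear -iL; lia.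
  have d1 : [disjoint rest M & b1].
    apply/pred0P => w /=; apply/negbTE/negP => /andP [/restP h wb].
    by have := h M.+1; rewrite -/b1 wb => /(_ ltac:(clear; lia)).
  have [|||||||h0 /set0Pn [w /setIP [wo _]]] := outer_complete opt d1;
    do ?[by apply: rB; clear; lia | by apply: xB; clear; lia].
  split; last by apply/set0Pn; exists w.
  move=> v vo; apply: h0; rewrite inE vo; apply/setU1P.
  have [->|vx] := eqVneq v x; [by left | right]; apply/restP => i iM; apply/negP => vi.
  move: vo; rewrite inE => /and3P [_ _ /pred0Pn [e /andP [/=]]]; rewrite inE => ve eb.
  by move: ve; rewrite (nonedge _ (leqnn _) _ vi eb) //; clear -iM M0; lia.
case dB: [disjoint outer & B 0]; last by right; apply: close_ring xM opt oc (negbT dB).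
left; exists (fun i => if i <= M.+4 then B i else outer); first exact: extend_stretch.
by move=> i ->.
Qed.
End Extension.

(** * Closing up the stretch *)

(** The product form keeps unary numerals small; the uses need 4000 * 60 <= 3 ^ 12. *)
Lemma pow3_12_ge : 500 * 1000 <= 3 ^ 12.
Proof.
have e : 3 ^ 6 = 729 by [].
rewrite (expnM 3 6 2) e -mulnn; lia.
Qed.

Section Root.
Variable G : sgraph.
Implicit Types (S T R U : {set G}) (u v w x y a b : G) (c s : seq G).

Lemma cycle_ends_at S q x : induced_cycle S -> q \in S -> x \in S -> edge q x ->
  exists2 s, ends_at q (x :: s) & S = [set z in [:: q, x & s]].
Proof.
move=> icS qS xS qx; have [c [ic SE lc]] := icycle_from_last icS qS xS qx.
have := ends_at_rev (icycle_ends_at ic); have : rev c =i c by move=> z; rewrite mem_rev.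
have hc : c != [::] by case: (c) ic => // -[].
case: (lastP c) hc lc SE {ic} => // s z _; rewrite last_rcons => -> SE; rewrite rev_rcons => m e.
by exists (rev s) => //; rewrite SE; apply/setP => y; rewrite !inE -m inE.
Qed.

Definition short_cycles := [set S : {set G} | induced_cycle S && (#|S| <= 4)].

Section Stretch.
Variables (L : nat) (B : nat -> {set G}).
Hypothesis st : stretch L B.

(** The cycle is cut open at q. No other vertex of S lies in the clusters of x and q: in B i it
    would share p and q with x, in B (i + 1) it would be a third neighbour of x. *)
Lemma through_path i S x p q : induced_cycle S -> 4 < #|S| -> 0 < i -> i.+1 < L ->
  x \in B i :&: S -> p \in B i.-1 :&: S -> q \in B i.+1 :&: S ->
  exists2 s, s \in ipaths (B i.+2) (~: (B i :|: B i.+1)) x & S = [set z in [:: q, x & s]].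
Proof.
move=> icS S5 i0 iL xi pi qi; have [q' /setIP [q'i q'S]] := passes_step st icS S5 i0 iL xi pi qi.
case/setIP: xi => xi xS; case/setIP: pi => pi pS; case/setIP: qi => qi qS.
have iL' : i < L := ltnW iL.
have iLp : 0 < i <= L by rewrite i0 ltnW.
have pL : i.-1 <= L := leq_trans (leq_pred i) (ltnW iL').
have xq : edge x q := stretch_edge st iL' xi qi.
have px : edge p x := stretch_edge_pred st iLp pi xi.
have qq' : edge q q' := stretch_edge st iL qi q'i.
have two u v v' w : u \in S -> v \in S -> v' \in S -> v != v' -> edge u v -> edge u v' ->
    (w \in S) && edge u w = (w == v) || (w == v').
  move=> uS vS v'S vv' uv uv'; have [y [z [nu yz _ _]]] := cycle_nbrs icS S5 uS.
  have : (v \in [set y; z]) && (v' \in [set y; z]) by rewrite -nu !inE vS v'S uv uv'.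
  have -> : (w \in S) && edge u w = (w \in [set y; z]) by rewrite -nu !inE andbC.
  by rewrite !inE => /andP [/orP [] /eqP e /orP [] /eqP e']; move: vv'; rewrite e e' ?eqxx // orbC.
have pq : p != q by apply: (stretch_neq st pL iL' _ pi qi); clear -i0; lia.
have xq' : x != q' by apply: (stretch_neq st (ltnW iL') iL _ xi q'i); clear; lia.
have xS2 w := two x p q w xS pS qS pq _ xq; rewrite edgeC px in xS2.
have qS2 w := two q x q' w qS xS q'S xq' _ qq'; rewrite edgeC xq in qS2.
have Bi w : w \in S -> w \in B i -> w = x.
  move=> wS wi; apply/eqP/negPn/negP => wx.
  have [y [z [nx yz _ n4]]] := cycle_nbrs icS S5 xS.
  have wyz v : (v == y) || (v == z) -> edge w v.
    move=> vyz; have : v \in [set y; z] by rewrite !inE.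
    rewrite -nx !inE => /andP [xv vS]; have := xS2 isT v; rewrite vS xv => /esym/orP [] /eqP ->.
      by rewrite edgeC; exact: (stretch_edge_pred st iLp pi wi).
    exact: (stretch_edge st iL' wi qi).
  by apply: (n4 w wS wx); apply: wyz; rewrite eqxx ?orbT.
have Bi1 w : w \in S -> w \in B i.+1 -> w = q.
  move=> wS wi; have := xS2 isT w; rewrite wS (stretch_edge st iL' xi wi) => /esym/orP [] /eqP // e.
  have := stretch_neq st pL iL' _ pi wi; rewrite e eqxx => /(_ ltac:(clear -i0; lia)) //.
have qx : edge q x by rewrite edgeC.
have [s [sz qs ends ip] SE] := cycle_ends_at icS qS xS qx.
have sS z : z \in s -> z \in S by move=> zs; rewrite SE !inE zs !orbT.
have xs : x \notin s by case: ip => /= /andP [].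
exists s => //; apply/mem_ipaths; first by rewrite !inE xi.
split=> //; first by case: (s) sz.
- move=> z zs; rewrite !inE negb_or; apply/andP; split; apply/negP => zi.
    by move: xs; rewrite -(Bi z (sS z zs) zi) zs.
  by move: qs; rewrite -(Bi1 z (sS z zs) zi) inE zs orbT.
have zE z : z \in s -> edge q z = (z == last x s).
  move=> zs; rewrite ends ?inE ?zs ?orbT //= (negPf (memPn xs z zs)) //.
have q's : q' \in s.
  move: q'S; rewrite SE !inE [q' == x]eq_sym (negPf xq') /= => /orP [/eqP e|//].
  by rewrite e edgexx in qq'.
move=> z zs; rewrite -zE //; apply/idP/idP => [zi|qz]; first exact: (stretch_edge st iL qi zi).
have := qS2 isT z; rewrite sS // qz => /esym/orP [/eqP e|/eqP -> //].
by rewrite -e zs in xs.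
Qed.

Lemma through_count i (A : {set {set G}}) : 0 < i -> i.+1 < L ->
  (forall S, S \in A -> [/\ induced_cycle S, 4 < #|S| & passes B i S]) ->
  #|A| <= \sum_(x in B i) #|B i.+1| * npaths (B i.+2) (~: (B i :|: B i.+1)) x.
Proof.
move=> i0 iL AP; pose P x := ipaths (B i.+2) (~: (B i :|: B i.+1)) x.
pose l := flatten [seq flatten [seq [seq [:: q, x & s] | s <- P x] | q <- enum (B i.+1)] | x <- enum (B i)].
have -> : \sum_(x in B i) #|B i.+1| * npaths (B i.+2) (~: (B i :|: B i.+1)) x = size l.
  rewrite size_flatten /shape -map_comp sumnE big_map big_enum /=; apply: eq_bigr => x _.
  rewrite size_flatten /shape -map_comp sumnE big_map big_enum /= -sum_nat_const.
  by apply: eq_bigr => q _; rewrite size_map.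
apply: (card_le_list (g := fun c => [set z in c])) => S /AP [icS S5 [x [p [q [xi pi qi]]]]].
have [s sP ->] := through_path icS S5 i0 iL xi pi qi.
case/setIP: xi => xi _; case/setIP: qi => qi _.
apply/mapP; exists [:: q, x & s] => //; apply/flatten_mapP; exists x; rewrite ?mem_enum //.
by apply/flatten_mapP; exists q; rewrite ?mem_enum //; apply/mapP; exists s.
Qed.

(** If no x were nearly optimal, A would have at most 1999/2000 maxprod #|G| cycles. *)
Lemma through_opt i (A : {set {set G}}) r : 0 < i -> i.+1 < L ->
  (forall S, S \in A -> [/\ induced_cycle S, 4 < #|S| & passes B i S]) ->
  maxprod #|G| <= #|A| + r -> 2000 * r < maxprod #|G| ->
  exists2 x, x \in B i & nearly_opt 1 (B i.+2) (~: (B i :|: B i.+1)) x.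
Proof.
move=> i0 iL AP NA r0; set R := ~: _.
case: (pickP (fun x => (x \in B i) && (2000 * maxprod #|R| < 2000 * npaths (B i.+2) R x + 1 * maxprod #|R|))).
  by move=> x /andP [xi h]; exists x.
move=> none; exfalso; have := through_count i0 iL AP; rewrite -/R => hA.
have cR : #|B i| + (#|B i.+1| + #|R|) = #|G|.
  rewrite addnA -cardsUI (_ : B i :&: B i.+1 = set0) ?cards0 ?addn0 ?cardsC //.
  apply/setP => v; rewrite !inE; apply/negP => /andP [vi vj].
  by have := stretch_disj st (ltnW (ltnW iL)) (ltnW iL) vi vj; clear; lia.
have pR : #|B i| * (#|B i.+1| * maxprod #|R|) <= maxprod #|G|.
  by rewrite -cR; apply: leq_trans (mul_maxprod _ _); rewrite leq_mul2l mul_maxprod orbT.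
have : 2000 * #|A| <= 1999 * maxprod #|G|.
  apply: leq_trans (leq_mul (leqnn 2000) hA) _.
  apply: leq_trans (leq_mul (leqnn 1999) pR).
  rewrite mulnCA -sum_nat_const big_distrr /=; apply: leq_sum => x xi.
  rewrite mulnCA [leqRHS]mulnCA leq_mul2l; apply/orP; right.
  by have := none x; rewrite xi /= ltnNge => /negbFE; clear; lia.
by move: NA r0; clear; lia.
Qed.

Lemma card_clusters k j : k + j <= L -> (forall i, i <= k + j -> #|B i| = 3) ->
  #|\bigcup_(i < j) B (k + i)| = 3 * j.
Proof.
elim: j => [|j IH] kL sz; first by rewrite big_ord0 cards0.
have kj : k + j <= k + j.+1 by rewrite addnS.
rewrite big_ord_recr cardsU /= IH ?sz //; last 2 first.
- by apply: leq_trans kL.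
- by move=> i ij; apply: sz; apply: leq_trans kj.
rewrite (_ : _ :&: _ = set0) ?cards0 ?subn0 ?mulnS 1?addnC //.
apply/setP => v; rewrite !inE; apply/negP => /andP [/bigcupP [i _ vi] vj].
have ij := ltn_ord i.
by have := stretch_disj st _ _ vi vj; clear -kL ij; lia.
Qed.

Lemma passes_up i j S : induced_cycle S -> 4 < #|S| -> 0 < i -> i + j < L ->
  passes B i S -> passes B (i + j) S.
Proof.
move=> icS S5 i0; elim: j => [|j IH] jL h; first by rewrite addn0.
rewrite addnS; apply: (passes_next st) => //; first by rewrite addn_gt0 i0.
  by rewrite -addnS.
by apply: IH h; apply: leq_trans jL; rewrite addnS.
Qed.

(* Cycles avoiding the 12 clusters B 2, ..., B 13 of size 3 are negligible since 60 < 3 ^ 12. *)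
Lemma stretch_root M : L = M.+4 -> 13 < M -> (forall i, i <= 17 -> #|B i| = 3) ->
  4000 * #|short_cycles| < maxprod #|G| -> maxprod #|G| <= num_induced_cycles G ->
  exists2 x, x \in B M & nearly_opt 1 (B M.+2) (~: (B M :|: B M.+1)) x.
Proof.
move=> LM M13 sz sh N; pose U := ~: \bigcup_(i < 12) B (2 + i).
have cU : 3 * 12 + #|U| = #|G|.
  rewrite -(@card_clusters 2 12); [by rewrite cardsC | by rewrite LM; clear -M13; lia|].
  by move=> i i14; apply: sz; clear -i14; lia.
have hU : 4000 * #|cycles_in U| <= maxprod #|G|.
  have := leq_trans (leq_mul pow3_12_ge (leqnn _)) (maxprod_drop3 12 #|U|); rewrite cU.
  by have := cycles_in_le U; move: (maxprod #|U|) #|cycles_in U| (maxprod _); clear; lia.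
pose A := [set S : {set G} | [&& induced_cycle S, 4 < #|S| & S \notin cycles_in U]].
apply: (@through_opt M A (#|short_cycles| + #|cycles_in U|)).
- by clear -M13; lia.
- by rewrite LM; clear; lia.
- move=> S; rewrite !inE => /and3P [icS S5]; rewrite icS /= => SU; split=> //.
  have [x xS xU] : exists2 x, x \in S & x \notin U by apply/subsetPn.
  move: xU; rewrite inE negbK => /bigcupP [i _ xi].
  have iM := ltn_ord i.
  have e : 2 + i + (M - (2 + i)) = M by clear -iM M13; lia.
  rewrite -e; apply: passes_up => //; first by rewrite e LM; clear; lia.
  apply: (passes_start st) xi xS => //; first by rewrite LM; clear -iM M13; lia.
  by apply: sz; clear -iM; lia.
- apply: leq_trans N _; rewrite -cycles_in_setT; set C := cycles_in _.
  have : C \subset A :|: (short_cycles :|: cycles_in U).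
    apply/subsetP => S; rewrite !inE subsetT andbT => -> /=.
    by case: ltnP => //= _; case: (S \subset U); rewrite ?orbT.
  move/subset_leq_card/leq_trans; apply; apply: leq_trans (leq_card_setU _ _) _.
  by rewrite leq_add2l leq_card_setU.
by move: hU sh; clear; lia.
Qed.

End Stretch.

(** The length of a stretch is bounded by #|G|, so extending it must end in a ring. Clusters found
    on the way may have any size; only the first 18 are known to have size 3. *)
Lemma stretch_ring L (B : nat -> {set G}) : stretch L B -> 18 <= L -> (forall i, i <= 17 -> #|B i| = 3) ->
  4000 * #|short_cycles| < maxprod #|G| -> maxprod #|G| <= num_induced_cycles G ->
  exists k (B' : nat -> {set G}), [/\ ring k B', 18 <= k & forall i, i <= 17 -> #|B' i| = 3].
Proof.
have [n] := ubnP (#|G| - L); elim: n L B => // n IH L B Ln st L18 sz sh N.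
have LG : L < #|G|.
  have pick i : i < L.+1 -> {x | x \in B i}.
    move=> iL; case: (pickP (mem (B i))) => [x xi|no]; first by exists x.
    exfalso; have [ne _ _ _] := st; case/set0Pn: (ne i iL) => x xi.
    by have := no x; rewrite /= xi.
  pose f (i : 'I_L.+1) := sval (pick i (ltn_ord i)).
  have fP i : f i \in B i := svalP (pick i (ltn_ord i)).
  have inj : injective f.
    move=> i j e; apply/val_inj; have iL := ltn_ord i; have jL := ltn_ord j.
    by apply: (stretch_disj st _ _ (fP i)) => //; rewrite e.
  by have := leq_card f inj; rewrite card_ord.
have [M LM] : exists M, L = M.+4 by exists (L - 4); clear -L18; lia.
have M13 : 13 < M by clear -LM L18; lia.
have [x xM opt] := stretch_root st LM M13 sz sh N.
rewrite LM in st LG Ln *; have M0 : 0 < M by clear -M13; lia.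
case: (stretch_step st M0 xM opt) => [[B' st' BB]|rg]; last first.
  by exists M.+4.+1, B; split=> //; clear -M13; lia.
apply: (IH _ B' _ st') => //; [by clear -Ln LG; lia | by clear -M13; lia |].
by move=> i i17; rewrite BB ?sz //; clear -i17 M13; lia.
Qed.
End Root.

(** * Transport and vertex deletion *)

Section Transport.
Variables (G H : sgraph) (f : G -> H).
Hypotheses (injf : injective f) (edgef : forall x y, edge (f x) (f y) = edge x y).

Lemma icycle_map (c : seq G) : icycle (map f c) <-> icycle c.
Proof.
rewrite /icycle size_map (map_inj_uniq injf); split=> -[c3 uc adj]; split=> // x0 i j ic jc.
  by rewrite -(adj (f x0) i j ic jc) !(nth_map x0) // edgef.
case: c c3 uc adj ic jc => // y c c3 uc adj ic jc.
by rewrite !(nth_map y) // edgef adj.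
Qed.

Lemma induced_cycle_imset (S : {set G}) : induced_cycle (f @: S) = induced_cycle S.
Proof.
apply/induced_cycleP/induced_cycleP => -[c ic SE]; last first.
  exists (map f c); first exact/icycle_map.
  rewrite SE; apply/setP => y; rewrite inE; apply/imsetP/mapP => -[x xc ->]; exists x => //;
  by move: xc; rewrite inE.
have [c' cE] : exists c', c = map f c'.
  have: {subset c <= f @: S} by move=> y; rewrite SE inE.
  elim: c {ic SE} => [|y c IH] sub; first by exists [::].
  have [c' ->] := IH (fun z zc => sub z (mem_behead (s := y :: c) zc)).
  by have /imsetP [x _ ->] := sub y (mem_head y c); exists (x :: c').
exists c'; first by apply/icycle_map; rewrite -cE.
by apply/setP => x; rewrite inE -(mem_imset _ _ injf) SE inE cE (mem_map injf).
Qed.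

Lemma num_cycles_in_imset (U : {set G}) : #|cycles_in (f @: U)| = #|cycles_in U|.
Proof.
rewrite -(card_imset _ (imset_inj injf)); apply: eq_card => S; rewrite !inE.
apply/andP/imsetP => [[icS SU]|[S' /[!inE] /andP [icS SU] ->]]; last first.
  by rewrite induced_cycle_imset icS imsetS.
have e : S = f @: (f @^-1: S).
  apply/setP => y; apply/idP/imsetP => [yS|[x /[!inE] xS -> //]].
  by have /imsetP [x _ e] := subsetP SU y yS; exists x; rewrite ?inE -?e.
exists (f @^-1: S) => //; rewrite inE -induced_cycle_imset -e icS /=.
by apply/subsetP => x; rewrite inE => /(subsetP SU); rewrite (mem_imset _ _ injf).
Qed.
End Transport.

Lemma isomorphic_num_cycles (G H : sgraph) : isomorphic G H ->
  num_induced_cycles G = num_induced_cycles H.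
Proof.
case=> f bf ef; rewrite -!cycles_in_setT -(num_cycles_in_imset (bij_inj bf) ef).
congr #|pred_of_set (cycles_in _)|; apply/setP => y; rewrite !inE.
by have [g _ gK] := bf; apply/imsetP; exists (g y).
Qed.

Lemma num_cycles_le_m (G : sgraph) : num_induced_cycles G <= m #|G|.
Proof.
pose E : {set 'I_#|G| * 'I_#|G|} := [set p | edge (enum_val p.1) (enum_val p.2)].
have iso : isomorphic G (graph_of_pairs E).
  exists (@enum_rank G); first exact: enum_rank_bij.
  move=> x y; rewrite /= /pair_edge !inE /= !enum_rankK (inj_eq enum_rank_inj) [edge y x]edgeC orbb.
  by case: eqP => [->|//]; rewrite edgexx.
rewrite (isomorphic_num_cycles iso).
by apply: (@leq_bigmax _ (fun E => num_induced_cycles (graph_of_pairs E)) E).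
Qed.

Section Induced.
Variables (G : sgraph) (U : {set G}).

Definition induced_edge : rel {x : G | x \in U} := fun x y => edge (val x) (val y).

Lemma induced_edge_sym : symmetric induced_edge.
Proof. by move=> x y; apply: edgeC. Qed.

Lemma induced_edge_irrefl : irreflexive induced_edge.
Proof. by move=> x; apply: edgexx. Qed.

Definition induced : sgraph := SGraph induced_edge_sym induced_edge_irrefl.

Lemma card_induced : #|induced| = #|U|.
Proof. by rewrite card_sig; apply: eq_card. Qed.

Lemma num_cycles_induced : num_induced_cycles induced = #|cycles_in U|.
Proof.
rewrite -cycles_in_setT -(@num_cycles_in_imset induced G val val_inj) //.
congr #|pred_of_set (cycles_in _)|; apply/setP => x; apply/imsetP/idP => [[y _ ->]|xU]; first exact: valP.
by exists (exist _ x xU).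
Qed.
End Induced.

Lemma num_cycles_le (G : sgraph) : num_induced_cycles G <= 60 * maxprod #|G|.
Proof. by rewrite -cycles_in_setT -cardsT cycles_in_le. Qed.

Lemma card_short_cycles (G : sgraph) : #|short_cycles G| <= #|G| ^ 4.
Proof.
rewrite -[X in _ ^ X]card_ord -card_ffun -cardsT.
pose img (f : {ffun 'I_4 -> G}) := [set f i | i : 'I_4].
apply: leq_trans (leq_imset_card img _); apply/subset_leq_card/subsetP => S.
rewrite inE => /andP [icS S4]; have S2 := induced_cycle_card icS.
have [x xS] : exists x, x \in S by apply/set0Pn; rewrite -card_gt0; apply: ltn_trans S2.
(* For a triangle the fourth value is the default x, again a vertex of S. *)
apply/imsetP; exists [ffun i : 'I_4 => nth x (enum S) i] => //.
apply/setP => y; apply/idP/imsetP => [yS|[i _ ->]].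
  have iy : index y (enum S) < 4 by apply: leq_trans S4; rewrite cardE index_mem mem_enum.
  by exists (Ordinal iy); rewrite // ffunE /= nth_index ?mem_enum.
rewrite ffunE; have [lt|ge] := ltnP i (size (enum S)); last by rewrite nth_default.
by rewrite -mem_enum mem_nth.
Qed.

(** * Cycles of a braid *)

Lemma val_iter_ordS k (i : 'I_k) j : val (iter j (@ordS k) i) = (i + j) %% k.
Proof.
elim: j => [|j IH] /=; first by rewrite addn0 modn_small.
by rewrite IH -addn1 modnDml addn1 addnS.
Qed.

Lemma iter_ordS_neq k (i : 'I_k) j : 0 < j < k -> iter j (@ordS k) i != i.
Proof.
move=> jk; rewrite -val_eqE val_iter_ordS; have ik := ltn_ord i.
have [lt|ge] := ltnP (i + j) k; first by rewrite modn_small // -[X in _ != X]addn0 eqn_add2l; lia.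
rewrite -(subnK ge) modnDr modn_small /=; clear -jk ik ge; lia.
Qed.

Lemma cycle_connected (G : sgraph) (S P : {set G}) x : induced_cycle S -> x \in S -> x \in P ->
  (forall y z, y \in S -> z \in S -> y \in P -> edge y z -> z \in P) -> S \subset P.
Proof.
move=> icS xS xP cl; have [c [_ _ adj] SE] := icycle_from icS xS.
have nS i : i < size (x :: c) -> nth x (x :: c) i \in S by move=> ic; rewrite SE inE mem_nth.
have nP i : i < size (x :: c) -> nth x (x :: c) i \in P.
  elim: i => // i IH ic; have ic' := ltnW ic.
  apply: (cl _ _ (nS i ic') (nS i.+1 ic) (IH ic')).
  by rewrite adj // cyc_adjE // eqxx.
by apply/subsetP => y; rewrite SE inE => yc; rewrite -(nth_index x yc) nP // index_mem.
Qed.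

Section Braid.
Variables (G : sgraph) (k : nat) (cl : G -> 'I_k).
Implicit Types (S T : {set G}) (x y z w : G) (i j : 'I_k).

(* The map cl sends a vertex to the index of its cluster. *)
Definition clu i := [set x | cl x == i].

Definition braided := (forall i, clu i != set0) /\
  (forall x y, cl x != cl y -> edge x y = cyclic_adj (cl x) (cl y)).

Hypotheses (br : braided) (k6 : 5 < k).

Let nS1 i : ordS i != i. Proof. by apply: (@iter_ordS_neq _ i 1); lia. Qed.
Let nS2 i : ordS (ordS i) != i. Proof. by apply: (@iter_ordS_neq _ i 2); lia. Qed.
Let nS3 i : ordS (ordS (ordS i)) != i. Proof. by apply: (@iter_ordS_neq _ i 3); lia. Qed.
Let nS4 i : ordS (ordS (ordS (ordS i))) != i. Proof. by apply: (@iter_ordS_neq _ i 4); lia. Qed.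
Let nP1 i : ord_pred i != i. Proof. by rewrite -(inj_eq (can_inj (@ordSK k))) ord_predK eq_sym nS1. Qed.
Let nP2 i : ord_pred i != ordS i. Proof. by rewrite -(inj_eq (can_inj (@ordSK k))) ord_predK eq_sym nS2. Qed.

Lemma braid_edge_next x y : cl y = ordS (cl x) -> edge x y.
Proof. by have [_ h] := br => e; rewrite h /cyclic_adj e ?eqxx // eq_sym nS1. Qed.

Lemma braid_edge_pred x y : cl y = ord_pred (cl x) -> edge x y.
Proof. by move=> e; rewrite edgeC braid_edge_next // e ord_predK. Qed.

Lemma braid_edge_cases x y : edge x y ->
  [\/ cl y = cl x, cl y = ordS (cl x) | cl y = ord_pred (cl x)].
Proof.
have [_ h] := br; have [e|ne] := eqVneq (cl x) (cl y); first by constructor 1.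
rewrite h // /cyclic_adj => /orP [] /eqP e; first by constructor 2.
by constructor 3; rewrite -e ordSK.
Qed.

(** Two neighbours of x on S are not adjacent, whereas y, being in the cluster of x, is adjacent to
    all of the two neighbouring clusters. *)
Lemma own_nbrs S x y z : induced_cycle S -> 4 < #|S| -> x \in S -> y \in S -> z \in S ->
  edge x y -> edge x z -> cl y = cl x -> cl z = cl x.
Proof.
move=> icS S5 xS yS zS xy xz e; have [u [v [nx uv nuv _]]] := cycle_nbrs icS S5 xS.
have yuv : y \in [set u; v] by rewrite -nx !inE xy yS.
have zuv : z \in [set u; v] by rewrite -nx !inE xz zS.
have [->|zy] := eqVneq z y; first by [].
have nyz : ~~ edge y z.
  by move: yuv zuv zy; rewrite !inE => /orP [] /eqP -> /orP [] /eqP ->; rewrite ?eqxx // edgeC.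
case: (braid_edge_cases xz) => // ez; case/negP: nyz.
  by apply: braid_edge_next; rewrite e.
by apply: braid_edge_pred; rewrite e.
Qed.

(** If one edge of S lies inside a cluster, then by [own_nbrs] all do. Otherwise each vertex has one
    neighbour in the next and one in the previous cluster, so S winds around; a second vertex in a
    cluster would share both neighbours with the first. *)
Lemma long_cycle S : induced_cycle S -> 4 < #|S| ->
  (exists i, S \subset clu i) \/ (forall i, #|S :&: clu i| = 1).
Proof.
move=> icS S5; case: (pickP (fun p : G * G => [&& p.1 \in S, p.2 \in S, edge p.1 p.2 & cl p.1 == cl p.2])).
  move=> [x y] /and4P [/= xS yS xy /eqP e]; left; exists (cl x).
  have own u : u \in S -> exists2 v, v \in S & edge u v.
    move=> uS; have [v [w [nu _ _ _]]] := cycle_nbrs icS S5 uS.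
    have : v \in nbhd u :&: S by rewrite nu set21.
    by rewrite !inE => /andP [uv vS]; exists v.
  pose P := [set u in clu (cl x) | [exists v in S, edge u v && (cl v == cl u)]].
  apply: subset_trans (_ : P \subset _); last by apply/subsetP => u; rewrite inE => /andP [].
  apply: (cycle_connected icS xS).
    by rewrite !inE eqxx; apply/existsP; exists y; rewrite yS xy e eqxx.
  move=> u v uS vS; rewrite !inE => /andP [/eqP ux /existsP [w /and3P [wS uw /eqP wu]]] uv.
  have vu := own_nbrs icS S5 uS wS vS uw uv wu.
  by rewrite vu ux eqxx; apply/existsP; exists u; rewrite uS edgeC uv -ux eqxx.
move=> none; right.
have nown x y : x \in S -> y \in S -> edge x y -> cl y != cl x.
  by move=> xS yS xy; have := none (x, y); rewrite /= xS yS xy eq_sym => /= ->.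
have two x : x \in S -> exists y z, [/\ y \in S, z \in S, cl y = ordS (cl x), cl z = ord_pred (cl x) &
    forall w, w \in S -> w != x -> edge w y -> edge w z -> False].
  move=> xS; have [y [z [nx yz nyz n4]]] := cycle_nbrs icS S5 xS.
  have : (y \in nbhd x :&: S) && (z \in nbhd x :&: S) by rewrite nx set21 set22.
  rewrite !inE => /andP [/andP [xy yS] /andP [xz zS]].
  have same : cl y != cl z.
    apply/eqP => e; have [w [w' [ny ww' _ _]]] := cycle_nbrs icS S5 yS.
    have : x \in [set w; w'] by rewrite -ny !inE edgeC xy xS.
    have [v [vS yv vx]] : exists v, [/\ v \in S, edge y v & v != x].
      have wP v : v \in [set w; w'] -> v \in S /\ edge y v by rewrite -ny !inE => /andP [].
      have [[wS yw] [w'S yw']] := (wP w (set21 _ _), wP w' (set22 _ _)).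
      have [e'|] := eqVneq w x; last by exists w.
      by exists w'; split=> //; rewrite -e' eq_sym.
    move=> _; have := nown y v yS vS yv => vy.
    apply: (n4 v vS vx); first by rewrite edgeC.
    case: (braid_edge_cases yv) => ev; first by rewrite ev eqxx in vy.
      by rewrite edgeC; apply: braid_edge_next; rewrite -e.
    by rewrite edgeC; apply: braid_edge_pred; rewrite -e.
  have [yx zx] := (nown x y xS yS xy, nown x z xS zS xz).
  case: (braid_edge_cases xy) yx => ey; rewrite ?ey ?eqxx // => _;
  case: (braid_edge_cases xz) zx => ez; rewrite ?ez ?eqxx // => _.
  - by rewrite ey ez eqxx in same.
  - by exists y, z; split.
  - by exists z, y; split=> // w wS wx wz wy; apply: (n4 w).
  - by rewrite ey ez eqxx in same.
move=> i; have [x xS xi] : exists2 x, x \in S & cl x = i.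
  have [x0 x0S] : exists x, x \in S by apply/set0Pn; rewrite -card_gt0; apply: leq_trans S5.
  have h (j : nat) : exists2 x, x \in S & cl x = iter j (@ordS k) (cl x0).
    elim: j => [|j [x xS e]]; first by exists x0.
    by have [y [_ [yS _ ey _ _]]] := two x xS; exists y; rewrite // ey e.
  have [x xS e] := h (i + (k - cl x0)); exists x; rewrite // e; apply/val_inj.
  rewrite val_iter_ordS addnCA (subnKC (ltnW (ltn_ord _))) modnDr modn_small //.
apply/eqP/cards1P; exists x; apply/setP => w; rewrite !inE; apply/andP/eqP => [[wS /eqP wi]|->].
  have [y [z [yS zS ey ez n4]]] := two x xS; apply/eqP/negPn/negP => wx.
  by apply: (n4 w wS wx); [apply: braid_edge_next | apply: braid_edge_pred]; rewrite wi -xi.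
by rewrite xS xi.
Qed.

Definition transversals : {set {set G}} :=
  [set [set f i | i : 'I_k] | f : {ffun 'I_k -> G} in [set f : {ffun 'I_k -> G} | [forall i, f i \in clu i]]].

Lemma card_transversals : #|transversals| = \prod_i #|clu i|.
Proof.
rewrite card_in_imset.
  have := card_family (rT := fun _ : 'I_k => G) (fun i : 'I_k => mem (clu i)).
  rewrite foldrE big_image /= => <-; apply: eq_card => f; rewrite inE.
  by apply/forallP/familyP.
move=> f g /[!inE] /forallP fc /forallP gc e; apply/ffunP => i.
have : f i \in [set g i | i : 'I_k] by rewrite -e imset_f.
case/imsetP => j _ fj; have := fc i; have := gc j; rewrite fj !inE => /eqP -> /eqP ij.
by rewrite ij.
Qed.

Lemma transversalP S : (forall i, #|S :&: clu i| = 1) -> S \in transversals.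
Proof.
move=> h; have [x0 _] : exists x0 : G, x0 \in S.
  have i0 : 'I_k by apply: (@Ordinal k 0); lia.
  have /eqP/cards1P [x xE] := h i0; exists x.
  by have := set11 x; rewrite -xE => /setIP [].
pose f := [ffun i => odflt x0 [pick x in S :&: clu i]].
have fS i : S :&: clu i = [set f i].
  have /eqP/cards1P [x xE] := h i; rewrite {1}xE ffunE; congr [set _].
  by case: pickP => [y|/(_ x)] /=; rewrite xE inE ?eqxx // => /eqP.
have fP i : f i \in S :&: clu i by rewrite fS inE.
apply/imsetP; exists f; first by rewrite inE; apply/forallP => i; case/setIP: (fP i).
apply/setP => y; apply/idP/imsetP => [yS|[i _ ->]]; last by case/setIP: (fP i).
by exists (cl y) => //; apply/set1P; rewrite -fS !inE yS eqxx.
Qed.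

Lemma transversal_cycle S : S \in transversals -> induced_cycle S /\ #|S| = k.
Proof.
case/imsetP => f /[!inE] /forallP fc ->.
have clf i : cl (f i) = i by have := fc i; rewrite inE => /eqP.
have inj : injective f by move=> i j e; rewrite -[i]clf e clf.
split; last by rewrite card_imset // card_ord.
have [e [se ue ne ein]] : exists e : seq 'I_k, [/\ size e = k, uniq e,
    forall (a : nat) i0, a < k -> nth i0 e a = a :> nat & forall i, i \in e].
  exists (enum 'I_k); split; [exact: size_enum_ord | exact: enum_uniq | | by move=> i; rewrite mem_enum].
  by move=> a i0 ak; rewrite nth_enum_ord.
apply/induced_cycleP; exists (map f e); last first.
  by apply/setP => y; rewrite inE; apply/imsetP/mapP => -[i _ ->]; exists i.
split; rewrite ?size_map ?se; first by rewrite (leq_trans _ k6).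
  by rewrite map_inj_uniq.
move=> x0 i j ik jk; rewrite !(nth_map (Ordinal ik)) ?se //.
have -> : nth (Ordinal ik) e i = Ordinal ik by apply/val_inj; rewrite /= ne.
have -> : nth (Ordinal ik) e j = Ordinal jk by apply/val_inj; rewrite /= ne.
have [_ h] := br; have [eij|nij] := eqVneq (Ordinal ik) (Ordinal jk); last first.
  by rewrite h ?clf // /cyclic_adj -!val_eqE.
rewrite eij edgexx; case: eij => ->; rewrite cyc_adjE //; clear -k6; lia.
Qed.

Lemma num_cycles_braid : num_induced_cycles G <=
  #|short_cycles G| + \prod_i #|clu i| + #|[set S : {set G} | [&& induced_cycle S, 4 < #|S| & [exists i, S \subset clu i]]]|.
Proof.
rewrite -card_transversals.
apply: leq_trans (leq_trans (leq_card_setU _ _) (leq_add (leq_card_setU _ _) (leqnn _))).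
apply/subset_leq_card/subsetP => S; rewrite inE => icS; apply/setUP.
have [Sle|S5] := leqP #|S| 4; first by left; apply/setUP; left; rewrite inE icS.
have [[i Si]|h] := long_cycle icS S5; last by left; apply/setUP; right; apply: transversalP.
by right; rewrite inE icS S5; apply/existsP; exists i.
Qed.

(* With clusters of size at most 4 the only long induced cycles are the transversals. *)
Lemma num_cycles_braid_small : (forall i, #|clu i| <= 4) ->
  num_induced_cycles G <= #|short_cycles G| + \prod_i #|clu i|.
Proof.
move=> c4; have := num_cycles_braid; set E := [set S : {set G} | _].
rewrite (_ : E = set0) ?cards0 ?addn0 //; apply/setP => S; rewrite !inE.
apply/negP => /and3P [_ S5 /existsP [i /subset_leq_card Si]].
by have := leq_ltn_trans (leq_trans Si (c4 i)) S5; rewrite ltnn.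
Qed.

Lemma short_prod_le : #|short_cycles G| + \prod_i #|clu i| <= num_induced_cycles G.
Proof.
rewrite -card_transversals -cardsUI (_ : _ :&: _ = set0) ?cards0 ?addn0.
  apply/subset_leq_card/subsetP => S; rewrite !inE => /orP [/andP [] //|].
  by case/transversal_cycle.
apply/setP => S; rewrite !inE; apply/negP => /andP [/andP [_ Sle] /transversal_cycle [_ Sk]].
by move: Sle; rewrite Sk leqNgt (ltnW k6).
Qed.

(** * Short cycles in a braid *)

Definition pairs i := [set P : {set G} | P \subset clu i & #|P| == 2].

Lemma card_pairs i : #|pairs i| = 'C(#|clu i|, 2).
Proof. exact: cards_draws. Qed.

Definition joined (P : {set G}) := [exists x in P, [exists y in P, edge x y]].

(* A short cycle meeting a cluster i in at least two vertices, but not the preceding one,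
   is one of these extensions of a pair P of vertices of that cluster. *)
Definition extensions i (P : {set G}) :=
  if joined P then
    [set y |: P | y in clu (ord_pred i) :|: clu (ordS i) :|: (clu i :\: P)]
      :|: (if #|clu i| == 4 then [set clu i] else set0)
  else [set P :|: Q | Q in pairs (ordS i)]
    :|: [set P :|: [set y; z] | y in clu (ord_pred i), z in clu (ordS i)].

Lemma card_extensions_joined i (P : {set G}) : P \in pairs i -> joined P ->
  #|extensions i P| <= #|clu (ord_pred i)| + #|clu (ordS i)| + (#|clu i| - 2) + (#|clu i| == 4).
Proof.
rewrite inE /extensions => /andP [Pi /eqP P2] ->.
apply: leq_trans (leq_card_setU _ _) (leq_add _ _); last first.
  by case: eqP => _; rewrite ?cards1 ?cards0.
apply: leq_trans (leq_imset_card _ _) _; apply: leq_trans (leq_card_setU _ _) _.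
by rewrite leq_add ?leq_card_setU // cardsD (setIidPr Pi) P2.
Qed.

Lemma card_extensions_free i (P : {set G}) : ~~ joined P ->
  #|extensions i P| <= 'C(#|clu (ordS i)|, 2) + #|clu (ord_pred i)| * #|clu (ordS i)|.
Proof.
rewrite /extensions => /negPf ->; apply: leq_trans (leq_card_setU _ _) (leq_add _ _).
  by rewrite -card_pairs leq_imset_card.
by rewrite curry_imset2X -cardsX leq_imset_card.
Qed.

Lemma triangle_extension x y z : x != y -> cl x = cl y -> edge x y -> edge x z -> edge y z ->
  [set x; y; z] \in extensions (cl x) [set x; y].
Proof.
move=> xy e exy exz eyz; rewrite /extensions.
have -> : joined [set x; y].
  by apply/existsP; exists x; rewrite set21; apply/existsP; exists y; rewrite set22.
apply/setUP; left; apply/imsetP; exists z; last by rewrite setUC.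
rewrite !inE; have zx : z != x by apply: contraTneq exz => ->; rewrite edgexx.
have zy : z != y by apply: contraTneq eyz => ->; rewrite edgexx.
by rewrite (negPf zx) (negPf zy) /=; case: (braid_edge_cases exz) => ->; rewrite eqxx ?orbT.
Qed.

Lemma pair_in x y i : cl x = i -> cl y = i -> x != y -> [set x; y] \in pairs i.
Proof.
by move=> ex ey xy; rewrite inE cards2 xy; apply/andP; split=> //;
  apply/subsetP => z; rewrite !inE => /orP [] /eqP ->; rewrite ?ex ?ey.
Qed.

(** Three different clusters are not pairwise consecutive, as k > 3. *)
Lemma triangle_cover x y z : edge x y -> edge x z -> edge y z ->
  exists i P, P \in pairs i /\ [set x; y; z] \in extensions i P.
Proof.
move=> xy xz yz.
have ne u v : edge u v -> u != v by move=> uv; apply: contraTneq uv => ->; rewrite edgexx.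
have [exy|nxy] := eqVneq (cl x) (cl y).
  exists (cl x), [set x; y]; rewrite pair_in ?ne //; split=> //.
  by apply: triangle_extension; rewrite ?ne.
have [exz|nxz] := eqVneq (cl x) (cl z).
  exists (cl x), [set x; z]; rewrite pair_in ?ne // setUAC; split=> //.
  by apply: triangle_extension; rewrite ?ne // edgeC.
have [eyz|nyz] := eqVneq (cl y) (cl z).
  exists (cl y), [set y; z]; rewrite pair_in ?ne // -setUA setUC; split=> //.
  by apply: triangle_extension; rewrite ?ne // edgeC.
have far u v w : edge v w -> cl v = ordS (cl u) -> cl w = ord_pred (cl u) -> False.
  move=> vw ev ew; case: (braid_edge_cases vw); rewrite ev ew => e.
  - by have := nP2 (cl u); rewrite e eqxx.
  - by have := nS3 (cl u); rewrite -e ord_predK eqxx.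
  - by have := nP1 (cl u); rewrite e ordSK eqxx.
exfalso; case: (braid_edge_cases xy) => ey; first by rewrite ey eqxx in nxy.
  case: (braid_edge_cases xz) => ez; first by rewrite ez eqxx in nxz.
    by rewrite ey ez eqxx in nyz.
  exact: (far x y z).
case: (braid_edge_cases xz) => ez; first by rewrite ez eqxx in nxz.
  by apply: (far x z y); rewrite 1?edgeC.
by rewrite ey ez eqxx in nyz.
Qed.

(** As k > 4, two opposite vertices share a cluster. The bound on sizes enters for a square inside
    one cluster, which must be the whole cluster. *)
Lemma square_cover x y z w : (forall i, #|clu i| <= 4) ->
  [/\ edge x y, edge y z, edge z w & edge w x] -> x != z -> y != w -> ~~ edge x z -> ~~ edge y w ->
  exists i P, P \in pairs i /\ [set x; y; z; w] \in extensions i P.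
Proof.
move=> c4; suff main u v u' v' : cl u = cl u' -> [/\ edge u v, edge v u', edge u' v' & edge v' u] ->
    u != u' -> v != v' -> ~~ edge u u' -> ~~ edge v v' ->
    exists i P, P \in pairs i /\ [set u; v; u'; v'] \in extensions i P.
  move=> [xy yz zw wx] xz yw nxz nyw.
  have [e|ne] := eqVneq (cl x) (cl z); first exact: main.
  have [e|ne'] := eqVneq (cl y) (cl w).
    have -> : [set x; y; z; w] = [set y; z; w; x].
      by apply/setP => t; rewrite !inE; case: (t == x); case: (t == y); case: (t == z); case: (t == w).
    by apply: main => //; rewrite 1?eq_sym 1?edgeC.
  have yx : cl y != cl x.
    apply/eqP => e; case: (braid_edge_cases yz); rewrite e => e'; first by rewrite e' eqxx in ne.
      by case/negP: nxz; apply: braid_edge_next.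
    by case/negP: nxz; apply: braid_edge_pred.
  have wx' : cl w != cl x.
    have wz : edge w z by rewrite edgeC.
    apply/eqP => e; case: (braid_edge_cases wz); rewrite e => e'; first by rewrite e' eqxx in ne.
      by case/negP: nxz; apply: braid_edge_next.
    by case/negP: nxz; apply: braid_edge_pred.
  have far a b : edge x a -> edge a z -> cl a = b (cl x) -> b = @ordS k \/ b = @ord_pred k -> cl z = b (b (cl x)).
    move=> xa az ea; case=> eb; rewrite eb in ea *; case: (braid_edge_cases az); rewrite ea // => ez.
    - by case/negP: nxz; apply: braid_edge_next.
    - by rewrite ordSK in ez; rewrite ez eqxx in ne.
    - by case/negP: nxz; apply: braid_edge_pred.
    - by rewrite ord_predK in ez; rewrite ez eqxx in ne.
  have xw : edge x w by rewrite edgeC.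
  have wz : edge w z by rewrite edgeC.
  have opp i : ordS (ordS i) = ord_pred (ord_pred i) -> False.
    by move=> e; have := nS4 i; rewrite e !ord_predK eqxx.
  exfalso; case: (braid_edge_cases xy) => ey; first by rewrite ey eqxx in yx.
    case: (braid_edge_cases xw) => ew; first by rewrite ew eqxx in wx'.
      by rewrite ey ew eqxx in ne'.
    by apply: (opp (cl x)); rewrite -(far y (@ordS k)) // ?(far w (@ord_pred k)); auto.
  case: (braid_edge_cases xw) => ew; first by rewrite ew eqxx in wx'.
    by apply: (opp (cl x)); rewrite -(far w (@ordS k)) // ?(far y (@ord_pred k)); auto.
  by rewrite ey ew eqxx in ne'.
move=> e [uv vu u'v v'u] uu vv nuu nvv; have uv' : edge u v' by rewrite edgeC.
have notj a b : ~~ edge a b -> ~~ joined [set a; b].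
  move=> nab; apply/existsP => -[s /andP [sP /existsP [t /andP [tP]]]]; move: sP tP.
  by rewrite !inE => /orP [] /eqP -> /orP [] /eqP ->; rewrite ?edgexx ?(negPf nab) // edgeC (negPf nab).
have free : cl v = ordS (cl u) -> cl v' = ordS (cl u) -> exists i P,
    P \in pairs i /\ [set u; v; u'; v'] \in extensions i P.
  move=> ev ev'; exists (cl u), [set u; u']; rewrite pair_in //; split=> //.
  rewrite /extensions (negPf (notj _ _ nuu)); apply/setUP; left; apply/imsetP; exists [set v; v'].
    by rewrite pair_in.
  by apply/setP => t; rewrite !inE; case: (t == u); case: (t == v); case: (t == u'); case: (t == v').
have mid a b : cl a = ord_pred (cl u) -> cl b = ordS (cl u) ->
    [set u; u'] :|: [set a; b] \in extensions (cl u) [set u; u'].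
  move=> ea eb; rewrite /extensions (negPf (notj _ _ nuu)); apply/setUP; right.
  by apply/imset2P; exists a b; rewrite ?inE ?ea ?eb.
case: (braid_edge_cases uv) => ev.
- have ev' : cl v' = cl u.
    case: (braid_edge_cases uv') => // ev'; case/negP: nvv.
      by apply: braid_edge_next; rewrite ev.
    by apply: braid_edge_pred; rewrite ev.
  have ne a b : edge a b -> a != b by move=> ab; apply: contraTneq ab => ->; rewrite edgexx.
  exists (cl u), [set u; v]; rewrite pair_in ?ne //; split=> //; rewrite /extensions.
  have -> : joined [set u; v].
    by apply/existsP; exists u; rewrite set21; apply/existsP; exists v; rewrite set22.
  apply/setUP; right.
  have card4 : #|[set u; v; u'; v']| = 4.
    rewrite (_ : [set u; v; u'; v'] = [set t in [:: u; v; u'; v']]); last first.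
      by apply/setP => t; rewrite !inE !orbA.
    apply/eqP; rewrite cardsE (card_uniqP _) //= !inE !negb_or uu vv !ne //.
  have c : [set u; v; u'; v'] = clu (cl u).
    apply/eqP; rewrite eqEcard card4 c4 andbT; apply/subsetP => t.
    by rewrite !inE => /orP [/orP [/orP []|]|] /eqP ->; rewrite ?ev ?ev' ?e.
  rewrite -c card4 eqxx.
  by rewrite inE.
- case: (braid_edge_cases uv') => ev'; last 1 first.
  + exists (cl u), [set u; u']; rewrite pair_in //; split=> //.
    have -> : [set u; v; u'; v'] = [set u; u'] :|: [set v'; v].
      by apply/setP => t; rewrite !inE; case: (t == u); case: (t == v); case: (t == u'); case: (t == v').
    exact: mid.
  + by case/negP: nvv; rewrite edgeC; apply: braid_edge_next; rewrite ev'.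
  + exact: free.
case: (braid_edge_cases uv') => ev'.
+ by case/negP: nvv; rewrite edgeC; apply: braid_edge_pred; rewrite ev'.
+ exists (cl u), [set u; u']; rewrite pair_in //; split=> //.
  have -> : [set u; v; u'; v'] = [set u; u'] :|: [set v; v'].
    by apply/setP => t; rewrite !inE; case: (t == u); case: (t == v); case: (t == u'); case: (t == v').
  exact: mid.
exists (cl v), [set v; v']; rewrite pair_in // ?ev ?ev' //; split=> //.
rewrite /extensions (negPf (notj _ _ nvv)); apply/setUP; left; apply/imsetP; exists [set u; u'].
  by rewrite pair_in // ord_predK.
by apply/setP => t; rewrite !inE; case: (t == u); case: (t == v); case: (t == u'); case: (t == v').
Qed.

Lemma short_cover S : (forall i, #|clu i| <= 4) -> S \in short_cycles G ->
  exists i P, P \in pairs i /\ S \in extensions i P.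
Proof.
move=> c4; rewrite inE => /andP [/induced_cycleP [c [c3 uc adj] SE]].
have -> : #|S| = size c by rewrite SE cardsE (card_uniqP uc).
case: c c3 uc adj SE => [|x [|y [|z [|w [|t c]]]]] // _ uc adj -> _.
  have -> : [set t in [:: x; y; z]] = [set x; y; z] by apply/setP => t; rewrite !inE orbA.
  by apply: triangle_cover; [have := adj x 0 1 | have := adj x 0 2 | have := adj x 1 2] => /= ->.
have -> : [set t in [:: x; y; z; w]] = [set x; y; z; w] by apply/setP => t; rewrite !inE !orbA.
move: uc; rewrite /= !inE !negb_or => /andP [/and3P [_ xz _] /andP [/andP [_ yw] _]].
apply: square_cover => //.
- by split; [have := adj x 0 1 | have := adj x 1 2 | have := adj x 2 3 | have := adj x 3 0] => /= ->.
- by have := adj x 0 2 => /= ->.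
by have := adj x 1 3 => /= ->.
Qed.

Lemma card_short_le : (forall i, #|clu i| <= 4) ->
  #|short_cycles G| <= \sum_i \sum_(P in pairs i) #|extensions i P|.
Proof.
move=> c4; apply: leq_trans (_ : #|\bigcup_i \bigcup_(P in pairs i) extensions i P| <= _).
  apply/subset_leq_card/subsetP => S /(short_cover c4) [i [P [Pi SP]]].
  by apply/bigcupP; exists i => //; apply/bigcupP; exists P.
have sub (I : finType) (Q : pred I) (F : I -> {set {set G}}) :
    #|\bigcup_(i | Q i) F i| <= \sum_(i | Q i) #|F i|.
  elim/big_rec2: _ => [|i A n _ IH]; first by rewrite cards0.
  by apply: leq_trans (leq_card_setU _ _) _; rewrite leq_add2l.
by apply: leq_trans (sub _ _ _) _; apply: leq_sum => i _; apply: sub.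
Qed.

(** Counts the squares of an empty braid by a pair of opposite vertices in cluster i, the other two
    being both in cluster i + 1 or one on each side. Two in cluster i - 1 are counted there. *)
Definition short_bound := \sum_i 'C(#|clu i|, 2) *
  ('C(#|clu (ordS i)|, 2) + #|clu (ord_pred i)| * #|clu (ordS i)|).

Lemma square_cycle x y z w : [/\ edge x y, edge y z, edge z w & edge w x] ->
  x != z -> y != w -> ~~ edge x z -> ~~ edge y w -> induced_cycle [set x; y; z; w].
Proof.
move=> [xy yz zw wx] xz yw nxz nyw.
have ne a b : edge a b -> a != b by move=> ab; apply: contraTneq ab => ->; rewrite edgexx.
apply/induced_cycleP; exists [:: x; y; z; w]; last by apply/setP => t; rewrite !inE !orbA.
split=> //.
  by rewrite /= !inE !negb_or xz yw !ne // edgeC.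
move=> x0 [|[|[|[|i]]]] [|[|[|[|j]]]] // _ _ /=; rewrite ?edgexx //;
by rewrite ?xy ?yz ?zw ?wx ?(negPf nxz) ?(negPf nyw) // edgeC ?xy ?yz ?zw ?wx ?(negPf nxz) ?(negPf nyw).
Qed.

(* In an empty braid the extensions of the pairs are distinct cycles. *)
Lemma short_bound_le : (forall x y, edge x y -> cl x != cl y) -> short_bound <= #|short_cycles G|.
Proof.
move=> emp.
(* Requiring fewer than two vertices in the preceding cluster makes these families disjoint. *)
pose base i := [set S in short_cycles G | [&& #|S :&: clu i| == 2, #|S :&: clu (ord_pred i)| < 2
   & S \subset clu (ord_pred i) :|: clu i :|: clu (ordS i)]].
have disj i j : i != j -> forall S, S \in base i -> S \in base j -> False.
  move=> ij S; rewrite !inE => /and4P [_ i2 ip /subsetP iS] /and4P [_ j2 jp _].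
  have [x xj] : exists x, x \in S :&: clu j by apply/set0Pn; rewrite -card_gt0 (eqP j2).
  case/setIP: xj => xS; rewrite inE => /eqP xj.
  move: (iS x xS); rewrite !inE xj -orbA => /or3P [] /eqP e.
  - by rewrite -e (eqP j2) in ip.
  - by rewrite e eqxx in ij.
  - by rewrite e ordSK (eqP i2) in jp.
apply: leq_trans (_ : \sum_i #|base i| <= _); last first.
  rewrite -[X in _ <= X]sum1_card; under eq_bigr do rewrite -sum1_card.
  rewrite (exchange_big_dep (mem (short_cycles G))) /=; last by move=> i S _; rewrite inE => /andP [].
  apply: leq_sum => S _; case: (pickP (fun i => S \in base i)) => [i Si|none].
    rewrite (bigD1 i) //= big1 // => j /andP [Sj ji].
    by case: (disj _ _ ji _ Sj Si).
  by rewrite big_pred0.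
apply: leq_sum => i _.
apply: leq_trans (_ : \sum_(P in pairs i) #|[set S in base i | S :&: clu i == P]| <= _); last first.
  rewrite -[X in _ <= X]sum1_card [X in _ <= X](partition_big (fun S => S :&: clu i) (fun P => P \in pairs i)) /=.
    apply: leq_sum => P _; rewrite -sum1_card; apply: eq_leq; apply: eq_bigl => S.
    by rewrite !inE.
  by move=> S; rewrite !inE subsetIr => /and3P [].
rewrite -card_pairs -sum_nat_const; apply: leq_sum => P; rewrite inE => /andP [Pi /cards2P [x [x' [xx' PE]]]].
have [xi xi'] : cl x = i /\ cl x' = i.
  by split; apply/eqP; have := subsetP Pi; rewrite PE => h; [have := h x | have := h x']; rewrite !inE eqxx ?orbT => ->.
have nP a b : cl a = cl b -> ~~ edge a b by move=> e; apply/negP => /emp; rewrite e eqxx.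
pose D := [set P :|: Q | Q in pairs (ordS i)].
pose E := [set P :|: [set p.1; p.2] | p in setX (clu (ord_pred i)) (clu (ordS i))].
have PD j : i != j -> P :&: clu j = set0.
  move=> ij; apply/setP => t; rewrite !inE; apply/andP => -[/(subsetP Pi)]; rewrite inE => /eqP -> /eqP e.
  by rewrite e eqxx in ij.
have Sj (y : G) j : cl y = j -> [set y] :&: clu j = [set y].
  by move=> e; apply/setIidPl; rewrite sub1set inE e.
have Sn (y : G) j : cl y != j -> [set y] :&: clu j = set0.
  by move=> e; apply/setP => t; rewrite !inE; apply/andP => -[/eqP ->]; apply/negP.
have i1 : i != ordS i by rewrite eq_sym.
have ip : i != ord_pred i by rewrite eq_sym.
have cD : #|D| = 'C(#|clu (ordS i)|, 2).
  rewrite card_in_imset ?card_pairs // => Q Q'; rewrite !inE => /andP [Qi _] /andP [Q'i _].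
  move/(congr1 (fun S => S :&: clu (ordS i))).
  by rewrite !setIUl PD // !set0U (setIidPl Qi) (setIidPl Q'i).
have cE : #|E| = #|clu (ord_pred i)| * #|clu (ordS i)|.
  rewrite card_in_imset ?cardsX // => -[y z] [y' z']; rewrite !inE /= => /andP [/eqP ey /eqP ez] /andP [/eqP ey' /eqP ez'].
  move=> e; congr (_, _).
    move/(congr1 (fun S => S :&: clu (ord_pred i))): e; rewrite !setIUl PD // !set0U.
    by rewrite !(Sj _ _ ey) !(Sj _ _ ey') !Sn ?ez ?ez' 1?eq_sym // !setU0 => /set1_inj.
  move/(congr1 (fun S => S :&: clu (ordS i))): e; rewrite !setIUl PD // !set0U.
  by rewrite !(Sj _ _ ez) !(Sj _ _ ez') !Sn ?ey ?ey' // !set0U => /set1_inj.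
have P2 : #|P| = 2 by rewrite PE cards2 xx'.
have PiE : P :&: clu i = P by apply/setIidPl.
rewrite -cD -cE -cardsUI (_ : D :&: E = set0) ?cards0 ?addn0; last first.
  apply/setP => S; rewrite !inE; apply/andP => -[/imsetP [Q]]; rewrite inE => /andP [Qi /eqP Q2] ->.
  case/imsetP => -[y z]; rewrite !inE /= => /andP [/eqP ey /eqP ez].
  move/(congr1 (fun S => #|S :&: clu (ordS i)|)); rewrite !setIUl PD // !set0U (setIidPl Qi) Q2.
  by rewrite (Sj _ _ ez) Sn ?ey // set0U cards1.
apply/subset_leq_card/subsetP => S /setUP [] /imsetP [].
  move=> Q; rewrite [Q \in _]inE => /andP [Qi /cards2P [y [y' [yy' QE]]]] ->.
  have [yi yi'] : cl y = ordS i /\ cl y' = ordS i.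
    by split; apply/eqP; have := subsetP Qi; rewrite QE => h; [have := h y | have := h y']; rewrite !inE eqxx ?orbT => ->.
  have SE : P :|: Q = [set x; y; x'; y'].
    by rewrite PE QE; apply/setP => t; rewrite !inE; case: (t == x); case: (t == y); case: (t == x'); case: (t == y').
  have QI j : ordS i != j -> Q :&: clu j = set0.
    by move=> ij; rewrite QE setIUl !Sn ?yi ?yi' // setU0.
  have hi : (P :|: Q) :&: clu i = P by rewrite setIUl PiE QI ?setU0 // eq_sym.
  have hp : (P :|: Q) :&: clu (ord_pred i) = set0 by rewrite setIUl PD // QI ?setU0 // eq_sym.
  rewrite inE hi eqxx andbT inE hi hp P2 cards0 /=; apply/andP; split; last first.
    by rewrite subUset (subset_trans Pi) ?(subset_trans Qi) ?subsetUr // -setUA setUCA subsetUl.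
  rewrite inE; apply/andP; split; last first.
    by apply: leq_trans (leq_card_setU _ _) _; rewrite P2 QE cards2; case: (_ != _).
  rewrite SE; apply: square_cycle => //; try by apply: nP; rewrite ?xi ?yi.
  by split; first [by apply: braid_edge_next; rewrite ?xi ?xi' | by rewrite edgeC; apply: braid_edge_next; rewrite ?xi ?xi'].
case=> y z /setXP [/= ypi zsi] ->; have ey : cl y = ord_pred i by move: ypi; rewrite inE => /eqP.
have ez : cl z = ordS i by move: zsi; rewrite inE => /eqP.
have SE : P :|: [set y; z] = [set x; y; x'; z].
  by rewrite PE; apply/setP => t; rewrite !inE; case: (t == x); case: (t == y); case: (t == x'); case: (t == z).
have ipS : ord_pred i != ordS i := nP2 i.
have hi : (P :|: [set y; z]) :&: clu i = P.
  by rewrite setIUl PiE setIUl !Sn ?ey ?ez ?setU0.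
have hp : (P :|: [set y; z]) :&: clu (ord_pred i) = [set y].
  by rewrite setIUl PD // setIUl (Sj y) // Sn ?ez 1?eq_sym // setU0 set0U.
rewrite inE hi eqxx andbT inE hi hp P2 cards1 /=; apply/andP; split; last first.
  rewrite subUset (subset_trans Pi) /=; last by rewrite -setUA setUCA subsetUl.
  by apply/subsetP => t; rewrite !inE => /orP [] /eqP ->; rewrite ?ey ?ez eqxx ?orbT.
rewrite inE; apply/andP; split; last first.
  by apply: leq_trans (leq_card_setU _ _) _; rewrite P2 cards2; case: (_ != _).
rewrite SE; apply: square_cycle => //; try by apply: nP; rewrite ?xi ?xi'.
- by split; first [by apply: braid_edge_next; rewrite ?xi ?xi' | by rewrite edgeC; apply: braid_edge_next; rewrite ?xi ?xi' |
    by apply: braid_edge_pred; rewrite ?xi ?xi' | by rewrite edgeC; apply: braid_edge_pred; rewrite ?xi ?xi'].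
- by apply: contraNneq ipS => e; rewrite -ey -ez e.
apply/negP => yz; case: (braid_edge_cases yz); rewrite ey ez => e.
- by move: ipS; rewrite e eqxx.
- by move: i1; rewrite e ord_predK eqxx.
- by have := nS3 i; rewrite e !ord_predK eqxx.
Qed.
End Braid.

(** * Cluster sizes *)

Section Sizes.
Variables (k : nat) (s : 'I_k -> nat).

Lemma prod_maxprod (P : pred 'I_k) : \prod_(i | P i) s i <= maxprod (\sum_(i | P i) s i).
Proof.
elim/big_rec2: _ => // i n p _ IH.
by apply: leq_trans (mul_maxprod _ _); rewrite leq_mul2l IH orbT.
Qed.

Hypotheses (k4 : 3 < k) (s0 : forall i, 0 < s i).
Hypothesis near : 1999 * maxprod (\sum_i s i) <= 2000 * \prod_i s i.

(** Size 1 costs a factor 3/4, size 5 or more a factor 5/6. *)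
Lemma size_bounds i : 1 < s i <= 4.
Proof.
move: near; rewrite (bigD1 i) //= (bigD1 i (P := xpredT)) //=.
have := prod_maxprod (fun j => j != i); set q := \prod_(j | _) _; set r := \sum_(j | _) _.
have r0 : 0 < r.
  have [j ji] : exists j, j != i.
    by have [e|ne] := eqVneq i (Ordinal (ltnW (ltnW (ltnW k4)))); [exists (Ordinal (ltnW (ltnW k4))); rewrite e | exists (Ordinal (ltnW (ltnW (ltnW k4)))); rewrite eq_sym].
  by rewrite /r (bigD1 j) //= ltn_addr.
have := s0 i; have p0 := maxprod_gt0 r; case: (s i) => [//|[|a]] _.
  by have := maxprod_step r0; rewrite add1n mul1n; lia.
have [a5|//] := ltnP 4 a.+2; have := mul_maxprod_big r a5 => big qp h; exfalso.
have m0 := maxprod_gt0 (a.+2 + r).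
have : a.+2 * q <= a.+2 * maxprod r by rewrite leq_mul2l qp orbT.
move: big h m0; move: (a.+2 * q) (a.+2 * maxprod r) (maxprod (a.+2 + r)) => x y z; clear; lia.
Qed.

(** 4 * 2 < 3 * 3 and 4 * 4 < 2 * 3 * 3. *)
Lemma four_alone i j : i != j -> s i = 4 -> s j = 3.
Proof.
move=> ij si; have := size_bounds j; have := near.
have ji : j != i by rewrite eq_sym.
have -> : \sum_l s l = s i + (s j + \sum_(l | (l != i) && (l != j)) s l).
  by rewrite (bigD1 i) //= (bigD1 j).
have -> : \prod_l s l = s i * (s j * \prod_(l | (l != i) && (l != j)) s l).
  by rewrite (bigD1 i) //= (bigD1 j).
rewrite si; have := prod_maxprod (fun l => (l != i) && (l != j)).
set q := \prod_(l | _) _; set r := \sum_(l | _) _.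
have p0 := maxprod_gt0 r; have := maxprod_drop3 2 r; have := mul_maxprod 2 (3 * 2 + r).
case: (s j) => [|[|[|[|[|a]]]]] // h1 h2 h3 h4 _; exfalso; move: h1 h2 h3 h4 p0.
  rewrite (_ : 4 + (2 + r) = 3 * 2 + r); last by rewrite addnA.
  by move: (maxprod _) (maxprod _) (maxprod _) => x y z; clear; lia.
rewrite (_ : 4 + (4 + r) = 2 + (3 * 2 + r)); last by rewrite !addnA.
by move: (maxprod r) (maxprod (2 + _)) (maxprod _) => x y z; clear; lia.
Qed.

(** 2 * 2 * 2 < 3 * 3, whereas 2 * 2 = 4 loses nothing. *)
Lemma two_twos i j l : i != j -> i != l -> j != l -> s i = 2 -> s j = 2 -> s l != 2.
Proof.
move=> ij il jl si sj; apply/eqP => sl; have := near.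
have ji : j != i by rewrite eq_sym.
have lij : (l != i) && (l != j) by rewrite ![l == _]eq_sym il.
have -> : \sum_t s t = s i + (s j + (s l + \sum_(t | (t != i) && (t != j) && (t != l)) s t)).
  by rewrite (bigD1 i) //= (bigD1 j) //= (bigD1 l).
have -> : \prod_t s t = s i * (s j * (s l * \prod_(t | (t != i) && (t != j) && (t != l)) s t)).
  by rewrite (bigD1 i) //= (bigD1 j) //= (bigD1 l).
rewrite si sj sl; have := prod_maxprod (fun t => (t != i) && (t != j) && (t != l)).
set q := \prod_(t | _) _; set r := \sum_(t | _) _.
have p0 := maxprod_gt0 r; have := maxprod_drop3 2 r; move: p0.
rewrite (_ : 2 + (2 + (2 + r)) = 3 * 2 + r); last by rewrite !addnA.
by move: (maxprod r) (maxprod _) => x y; clear; lia.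
Qed.

Lemma size_cases : [\/ forall i, s i = 3,
  exists i0, s i0 = 4 /\ forall i, i != i0 -> s i = 3,
  exists i0, s i0 = 2 /\ forall i, i != i0 -> s i = 3
| exists i0 j0, [/\ i0 != j0, s i0 = 2, s j0 = 2 & forall i, i != i0 -> i != j0 -> s i = 3]].
Proof.
have three i : s i != 2 -> s i != 4 -> s i = 3.
  by have := size_bounds i; case: (s i) => [|[|[|[|[|]]]]].
case: (pickP (fun i => s i == 4)) => [i0 /eqP s4|no4].
  by constructor 2; exists i0; split=> // i ii; apply: four_alone s4; rewrite eq_sym.
case: (pickP (fun i => s i == 2)) => [i0 /eqP s2|no2]; last first.
  by constructor 1 => i; apply: three; rewrite ?no2 ?no4.
case: (pickP (fun i => (i != i0) && (s i == 2))) => [j0 /andP [ji /eqP s2']|no2]; last first.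
  constructor 3; exists i0; split=> // i ii; apply: three; rewrite ?no4 //.
  by have := no2 i; rewrite ii => /= ->.
constructor 4; exists i0, j0; split=> //; first by rewrite eq_sym.
move=> i ii ij; apply: three; rewrite ?no4 //.
by apply: (@two_twos i0 j0); rewrite // eq_sym.
Qed.
End Sizes.

(** * Graphs with many cycles are braids *)

Lemma ring_braided (G : sgraph) k (B : nat -> {set G}) : 1 < k -> ring k B ->
  exists cl : G -> 'I_k, braided cl /\ forall i, clu cl i = B i.
Proof.
move=> k1 [ne cov dj ed].
have pick v : {i : 'I_k | v \in B i}.
  case: (pickP (fun i : 'I_k => v \in B i)) => [i vi|none]; first by exists i.
  by exfalso; have [i ik vi] := cov v; have := none (Ordinal ik); rewrite /= vi.
pose cl v := sval (pick v); have clP v : v \in B (cl v) := svalP (pick v).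
have E i : clu cl i = B i.
  apply/setP => v; rewrite inE; apply/eqP/idP => [<- //|vi].
  by apply/val_inj; apply: dj (clP v) vi.
exists cl; split=> //; split=> [i|x y ne'].
  by rewrite E ne.
by rewrite (ed (cl x) (cl y)) // /cyclic_adj -!val_eqE.
Qed.

Section Braid.
Variables (G : sgraph) (k : nat) (cl : G -> 'I_k).

Lemma card_clusters_pred (P : pred 'I_k) : #|[set v | P (cl v)]| = \sum_(i | P i) #|clu cl i|.
Proof.
rewrite -sum1_card (partition_big cl P) /=; last by move=> v; rewrite inE.
apply: eq_bigr => i Pi; rewrite -sum1_card; apply: eq_bigl => v; rewrite !inE.
by case: eqP => [->|]; rewrite ?Pi ?andbF.
Qed.

Lemma sum_clusters : \sum_i #|clu cl i| = #|G|.
Proof. by rewrite -(card_clusters_pred xpredT) -cardsT; apply: eq_card => v; rewrite !inE. Qed.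

(** Here r counts the longer cycles inside single clusters. They avoid the first 12 clusters, which
    have size 3, so they are negligible. *)
Lemma braid_bound : braided cl -> 18 <= k -> (forall i : 'I_k, i <= 17 -> #|clu cl i| = 3) ->
  exists2 r, 4000 * r <= maxprod #|G| &
    num_induced_cycles G <= #|short_cycles G| + \prod_i #|clu cl i| + r.
Proof.
move=> br k18 sz; have k6 : 5 < k by apply: leq_trans k18.
have := num_cycles_braid br k6; set E := [set S : {set G} | _] => h.
exists #|E| => //; pose U := [set v | ~~ (cl v < 12)].
have cU : 3 * 12 + #|U| = #|G|.
  rewrite -sum_clusters (bigID (fun i : 'I_k => i < 12)) /= -(card_clusters_pred (fun i => ~~ (i < 12))).
  congr (_ + _); rewrite (eq_bigr (fun=> 3)); last by move=> i i12; apply: sz; apply: leq_trans (ltnW i12) _.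
  rewrite -(big_ord_widen _ (fun=> 3)); last by apply: leq_trans k18.
  by rewrite sum_nat_const card_ord mulnC.
have EU : #|E| <= #|cycles_in U|.
  apply/subset_leq_card/subsetP => S; rewrite !inE => /and3P [-> S5 /existsP [i Si]] /=.
  apply/subsetP => v vS; rewrite inE; apply/negP => v12; have := subsetP Si v vS.
  rewrite inE => /eqP vi; have := subset_leq_card Si; rewrite sz; last first.
    by rewrite -vi; apply: leq_trans (ltnW v12) _.
  by move: S5; clear; lia.
have := leq_trans (leq_mul pow3_12_ge (leqnn _)) (maxprod_drop3 12 #|U|); rewrite cU.
by have := cycles_in_le U; move: EU; move: (maxprod #|U|) #|cycles_in U| (maxprod _); clear; lia.
Qed.

Lemma prod_clusters_le : \prod_i #|clu cl i| <= maxprod #|G|.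
Proof.
rewrite -sum_clusters; elim/big_rec2: _ => // i n p _ IH.
by apply: leq_trans (mul_maxprod _ _); rewrite leq_mul2l IH orbT.
Qed.
End Braid.

Definition long_braid (G : sgraph) := exists k (cl : G -> 'I_k),
  [/\ braided cl, 18 <= k & forall i : 'I_k, i <= 17 -> #|clu cl i| = 3].

Lemma short_small c : exists n0, forall G : sgraph, n0 <= #|G| -> c * #|short_cycles G| < maxprod #|G|.
Proof.
have [n0 h] := quartic_lt_maxprod c; exists n0 => G /h; apply: leq_ltn_trans.
rewrite leq_mul2l; apply/orP; right; apply: leq_trans (card_short_cycles G) _.
by rewrite leq_exp2r.
Qed.

Lemma regular_braid : exists n1, forall G : sgraph, n1 <= #|G| ->
  maxprod #|G| <= num_induced_cycles G ->
  (forall v : G, num_induced_cycles G <= 6 * #|cycles_at v|) -> long_braid G.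
Proof.
(* 1954 is the degree bound of [degree_le], and 18 the length from which [stretch_ring] starts. *)
have [n0 hs] := exists_stretch 1954 18; have [n1 hq] := short_small 4000.
exists (n0 + n1).+1 => G Gn N reg.
have [v _] : exists v : G, v \in G by apply/card_gt0P; apply: leq_trans Gn.
have NP w : maxprod #|G| <= 6 * #|cycles_at w| := leq_trans N (reg w).
have [|B st sz] := hs G v (fun w => degree_le (NP w)) _ (NP v).
  by apply: leq_trans Gn; rewrite leqW // leq_addr.
have sh : 4000 * #|short_cycles G| < maxprod #|G|.
  by apply: hq; apply: leq_trans Gn; rewrite leqW // leq_addl.
have sz' i : i <= 17 -> #|B i| = 3 by move=> i17; apply: sz; apply: leq_trans i17 _.
have [k [B' [rg k18 s3]]] := stretch_ring st (leqnn 18) sz' sh N.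
have [cl [br clE]] := ring_braided (leq_trans (isT : 1 < 18) k18) rg.
by exists k, cl; split=> // i i17; rewrite clE s3.
Qed.

Lemma num_cycles_del (G : sgraph) (v : G) :
  num_induced_cycles G = #|cycles_at v| + num_induced_cycles (induced [set~ v]).
Proof.
by rewrite num_cycles_induced -cycles_in_setT (cycles_in_split _ v) cycles_at_setT setTD.
Qed.

Lemma card_induced_del (G : sgraph) (v : G) : #|induced [set~ v]|.+1 = #|G|.
Proof. by rewrite card_induced cardsC1 prednK //; apply/card_gt0P; exists v. Qed.

(* Deleting a vertex lying on less than a sixth of the cycles increases the ratio to maxprod
   by a factor larger than 10 / 9. *)
Lemma improved_bound : exists n1, forall i (G : sgraph), n1 + i <= #|G| ->
  10 ^ i * num_induced_cycles G <= 9 ^ i * (60 * maxprod #|G|) \/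
  9 * num_induced_cycles G <= 10 * maxprod #|G|.
Proof.
have [n1 h1] := regular_braid; have [n2 h2] := short_small 4000; exists (n1 + n2).+1.
elim=> [|i IH] G Gn; first by left; rewrite !expn0 !mul1n num_cycles_le.
have Gn1 : n1 <= #|G| by apply: leq_trans Gn; rewrite addSn leqW // -addnA leq_addr.
have Gn2 : n2 <= #|G| by apply: leq_trans Gn; rewrite addSn leqW // addnAC leq_addl.
have [Np|pN] := ltnP (num_induced_cycles G) (maxprod #|G|); first by right; lia.
case: (pickP (fun v : G => 6 * #|cycles_at v| < num_induced_cycles G)) => [v lt|none]; last first.
  have [|k [cl [br k18 sz]]] := h1 G Gn1 pN.
    by move=> v; have := none v; rewrite ltnNge => /negbFE.
  have [r rp Nr] := braid_bound br k18 sz; have sh := h2 G Gn2; have pr := prod_clusters_le cl.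
  by right; move: Nr rp sh pr; move: (num_induced_cycles G) #|short_cycles G| (\prod_i _) (maxprod _); clear; lia.
have G'n : n1 + n2 + i < #|induced [set~ v]| by rewrite -ltnS card_induced_del -addnS.
have := IH (induced [set~ v]) G'n; move: lt; rewrite (num_cycles_del v) -(card_induced_del v).
have := @maxprod_step #|induced [set~ v]| (leq_trans _ G'n).
set N' := num_induced_cycles _; set p' := maxprod #|_|; set p := maxprod _.+1; set a := #|cycles_at v|.
move=> /(_ isT) pp lt [h|h]; [left | right]; last by lia.
rewrite !expnS; move: h; set x := 10 ^ i; set y := 9 ^ i.
have h5 : x * (5 * (a + N')) <= x * (6 * N') by rewrite leq_mul2l; apply/orP; right; lia.
have h6 : y * (4 * p') <= y * (3 * p) by rewrite leq_mul2l pp orbT.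
move: h5 h6; rewrite -(mulnA 10 x) -(mulnA 9 y) !(mulnCA y 60) (mulnCA x 5) (mulnCA x 6) (mulnCA y 4) (mulnCA y 3).
by move: (x * (a + N')) (x * N') (y * p') (y * p); clear; lia.
Qed.

(** 42 = 7 * 6, as (10/9)^7 >= 2 and 2^6 = 64 >= 60. *)
Lemma ratio_small : 9 ^ 42 * 60 <= 10 ^ 42.
Proof.
have gen a b : 2 * a <= b -> a ^ 6 * 60 <= b ^ 6.
  move=> h; have : (2 * a) ^ 6 <= b ^ 6 by rewrite leq_exp2r.
  rewrite expnMn (_ : 2 ^ 6 = 64) //; apply: leq_trans.
  by rewrite mulnC leq_mul2r orbT.
by rewrite -[42]/(7 * 6) !expnM; apply: gen; rewrite !expnS !expn0; lia.
Qed.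

(** Deleting a vertex on fewer than a sixth of the cycles would leave a ratio above 5/6 * 4/3 =
    10/9. But by [ratio_small], the first alternative of [improved_bound] with i = 42 gives a ratio
    of at most 1, and the second one of at most 10/9. *)
Lemma many_cycles_braid : exists n1, forall G : sgraph, n1 <= #|G| ->
  maxprod #|G| <= num_induced_cycles G -> long_braid G.
Proof.
have [n1 h1] := regular_braid; have [n2 h2] := improved_bound; exists (n1 + n2 + 42).+1 => G Gn N.
apply: h1 => // [|v]; first by apply: leq_trans Gn; rewrite leqW // -addnA leq_addr.
rewrite leqNgt; apply/negP => lt.
have G'n : n2 + 42 <= #|induced [set~ v]|.
  by rewrite -ltnS card_induced_del; apply: leq_trans Gn; rewrite ltnS -addnA leq_addl.
have h : 9 * num_induced_cycles (induced [set~ v]) <= 10 * maxprod #|induced [set~ v]|.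
  have := h2 42 _ G'n; have := ratio_small; have : 0 < 10 ^ 42 by rewrite expn_gt0.
  move: (10 ^ 42) (9 ^ 42) => x y x0 yx [h|//]; apply: leq_mul => //.
  by rewrite -(leq_pmul2l x0) (leq_trans h) // mulnA leq_mul2r yx orbT.
have := @maxprod_step #|induced [set~ v]| _; rewrite card_induced_del.
move=> /(_ (leq_trans _ G'n)); rewrite addnS => /(_ isT).
by move: N lt h; rewrite {1 2}(num_cycles_del v); clear; lia.
Qed.

(** * The extremal graphs *)

Section BraidGraph.
Variables (k : nat) (s : 'I_k -> nat).

Definition braid_cl (x : braid_graph s) : 'I_k := tag x.

Lemma card_braid_cl i : #|clu braid_cl i| = s i.
Proof. by rewrite -[RHS]card_cluster; apply: eq_card => x; rewrite !inE. Qed.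

Lemma braided_braid_graph : (forall i, 0 < s i) -> braided braid_cl.
Proof.
move=> s0; split=> [i|x y ne]; first by rewrite -card_gt0 card_braid_cl.
by rewrite /edge /= /braid_edge ne.
Qed.

Lemma card_braid_graph : #|braid_graph s| = \sum_i s i.
Proof. by rewrite -(sum_clusters braid_cl); apply: eq_bigr => i _; rewrite card_braid_cl. Qed.

Lemma isomorphic_braid_graph (G : sgraph) (cl : G -> 'I_k) :
  (forall i, #|clu cl i| = s i) ->
  (forall x y, edge x y = (cl x != cl y) && cyclic_adj (cl x) (cl y)) ->
  isomorphic G (braid_graph s).
Proof.
move=> sz ed; have pf x : index x (enum (clu cl (cl x))) < s (cl x).
  by rewrite -sz cardE index_mem mem_enum inE.
pose f x : braid_graph s := Tagged (fun j => 'I_(s j)) (Ordinal (pf x)).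
exists f; last by move=> x y; rewrite ed.
apply: inj_card_bij; last by rewrite card_braid_graph -(sum_clusters cl); apply: eq_leq; apply: eq_bigr => i _; rewrite sz.
move=> x y e; have ec : cl x = cl y := congr1 braid_cl e.
have := congr1 (fun u : braid_graph s => val (tagged u)) e; rewrite /= ec.
by move/(congr1 (nth x (enum (clu cl (cl y))))); rewrite !nth_index // mem_enum inE ?ec.
Qed.
End BraidGraph.

Section ExtremalGraph.
Variable n : nat.
Hypothesis n18 : 17 < n.
Let k := n.+1 %/ 3.

Let k6 : 5 < k. Proof. by rewrite /k; lia. Qed.

Let i0 : 'I_k := Ordinal (leq_trans (isT : 0 < 6) k6).

Lemma H_size_other i : i != i0 -> @H_size n i = 3.
Proof. by rewrite /H_size -val_eqE /= => ->; rewrite orbT. Qed.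

Lemma H_size_first : @H_size n i0 + 3 * k.-1 = n /\ @H_size n i0 * 3 ^ k.-1 = maxprod n.
Proof.
have n1 : 1 < n by apply: leq_trans n18.
rewrite /H_size /= orbF /k; have nE := divn_eq n 3.
case: (maxprodE n1) => -[-> e]; rewrite e /=; rewrite e ?addn0 in nE.
- have -> : n.+1 %/ 3 = n %/ 3 by clear -nE; lia.
  by split=> //; clear -nE n18; lia.
- have -> : n.+1 %/ 3 = n %/ 3 by clear -nE; lia.
  by split=> //; clear -nE n18; lia.
have -> : n.+1 %/ 3 = (n %/ 3).+1 by clear -nE; lia.
by split=> //; clear -nE n18; lia.
Qed.

Lemma sum_H_size : \sum_i @H_size n i = n.
Proof.
have [e _] := H_size_first; rewrite (bigD1 i0) //= (eq_bigr (fun=> 3)); last by move=> i; apply: H_size_other.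
by rewrite sum_nat_const cardC1 card_ord mulnC.
Qed.

Lemma prod_H_size : \prod_i @H_size n i = maxprod n.
Proof.
have [_ e] := H_size_first; rewrite (bigD1 i0) //= (eq_bigr (fun=> 3)); last by move=> i; apply: H_size_other.
by rewrite prod_nat_const cardC1 card_ord.
Qed.

Lemma card_H : #|H n| = n.
Proof. by rewrite card_braid_graph sum_H_size. Qed.

Let brH : braided (@braid_cl _ (@H_size n)).
Proof. by apply: braided_braid_graph => i; rewrite /H_size; case: ifP => // _; case: ifP. Qed.

Lemma H_cycles : maxprod n + short_bound (@braid_cl _ (@H_size n)) <= num_induced_cycles (H n).
Proof.
apply: leq_trans (short_prod_le brH k6); rewrite addnC leq_add //.
  apply: short_bound_le => // x y; rewrite /edge /= /braid_edge => /andP [] //.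
by rewrite -prod_H_size; apply: eq_leq; apply: eq_bigr => i _; rewrite card_braid_cl.
Qed.

Lemma maxprod_le_m : maxprod n <= m n.
Proof.
rewrite -{2}card_H; apply: leq_trans (num_cycles_le_m _).
by apply: leq_trans H_cycles; apply: leq_addr.
Qed.

(** All sizes are at least 3, so each cluster contributes at least 3 * (3 + 3 * 3) = 36 squares. *)
Lemma H_cycles_mod1 : n %% 3 = 1 -> maxprod n + 36 * k <= m n.
Proof.
move=> n1; rewrite -[in m n]card_H; apply: leq_trans (num_cycles_le_m _).
apply: leq_trans H_cycles; rewrite leq_add2l mulnC -[k in leqLHS]card_ord -sum_nat_const.
apply: leq_sum => i _; rewrite !card_braid_cl.
have s3 j : 2 < @H_size n j by rewrite /H_size n1 /=; case: ifP.
have c3 j : 3 <= 'C(@H_size n j, 2) by rewrite -[3]/'C(3, 2) leq_bin2l.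
apply: (@leq_mul 3 12) => //; apply: (@leq_add 3 9) => //; apply: (@leq_mul 3 3) => //.
Qed.
End ExtremalGraph.

(** * Comparing the short cycles of braids *)

Section Emptied.
Variables (G : sgraph) (k : nat) (cl : G -> 'I_k).

Definition emptied_edge : rel G := fun x y => (cl x != cl y) && cyclic_adj (cl x) (cl y).

Lemma emptied_edge_sym : symmetric emptied_edge.
Proof. by move=> x y; rewrite /emptied_edge /cyclic_adj eq_sym orbC. Qed.

Lemma emptied_edge_irrefl : irreflexive emptied_edge.
Proof. by move=> x; rewrite /emptied_edge eqxx. Qed.

Definition emptied : sgraph := SGraph emptied_edge_sym emptied_edge_irrefl.

Hypotheses (br : braided cl) (k6 : 5 < k).

Lemma emptied_cycles :
  short_bound cl + \prod_i #|clu cl i| <= num_induced_cycles emptied.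
Proof.
have br' : @braided emptied k cl.
  by case: br => ne _; split=> // x y xy; rewrite /edge /= /emptied_edge xy.
apply: leq_trans (short_prod_le br' k6); rewrite leq_add2r.
by apply: (short_bound_le br' k6) => x y /andP [].
Qed.

(* An edge inside a cluster destroys more squares than it creates short cycles. *)
Lemma inner_edge_loss : (forall i, 1 < #|clu cl i| <= 4) ->
  (forall i j, i != j -> #|clu cl i| != 3 -> #|clu cl j| = 3) ->
  (exists x y, edge x y /\ cl x = cl y) -> num_induced_cycles G < num_induced_cycles emptied.
Proof.
move=> sz exc [x0 [y0 [xy0 e0]]]; have c4 i : #|clu cl i| <= 4 by case/andP: (sz i).
apply: leq_trans emptied_cycles; apply: leq_ltn_trans (num_cycles_braid_small br k6 c4) _.
rewrite ltn_add2r; apply: leq_ltn_trans (card_short_le br k6 c4) _.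
pose w i := 'C(#|clu cl (ordS i)|, 2) + #|clu cl (ord_pred i)| * #|clu cl (ordS i)|.
(* At most one of the three sizes involved differs from 3; for sizes 3, 3, 3 the comparison is 7 <
   12. *)
have strict i (P : {set G}) : P \in pairs cl i -> joined P -> #|extensions cl i P| < w i.
  move=> Pi jP; apply: leq_ltn_trans (card_extensions_joined Pi jP) _; rewrite /w.
  have i1 : ordS i != i by apply: (@iter_ordS_neq _ i 1); clear -k6; lia.
  have i2 : ord_pred i != i.
    by rewrite -(inj_eq (can_inj (@ordSK k))) ord_predK eq_sym.
  have i3 : ord_pred i != ordS i.
    rewrite -(inj_eq (can_inj (@ordSK k))) ord_predK eq_sym.
    by apply: (@iter_ordS_neq _ i 2); clear -k6; lia.
  move: (sz i) (sz (ordS i)) (sz (ord_pred i)) (exc _ _ i1) (exc _ _ i2) (exc _ _ i3).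
  move: #|clu cl i| #|clu cl (ordS i)| #|clu cl (ord_pred i)|.
  by move=> [|[|[|[|[|a]]]]] // [|[|[|[|[|b]]]]] // [|[|[|[|[|c]]]]] // _ _ _ h1 h2 h3;
    first [by [] | by have := h1 isT | by have := h2 isT | by have := h3 isT].
have weak i (P : {set G}) : P \in pairs cl i -> #|extensions cl i P| <= w i.
  by move=> Pi; case jP: (joined P); [apply/ltnW/strict | apply: card_extensions_free; rewrite jP].
have xy : x0 != y0 by apply: contraTneq xy0 => ->; rewrite edgexx.
have Pi := pair_in (erefl (cl x0)) (esym e0) xy.
have jP : joined [set x0; y0].
  by apply/existsP; exists x0; rewrite set21; apply/existsP; exists y0; rewrite set22.
rewrite /short_bound; under [ltnRHS]eq_bigr do rewrite -card_pairs -sum_nat_const.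
rewrite (bigD1 (cl x0)) //= [ltnRHS](bigD1 (cl x0)) //= -addSn leq_add //; last first.
  by apply: leq_sum => i _; apply: leq_sum => P; apply: weak.
rewrite (bigD1 [set x0; y0]) //= [ltnRHS](bigD1 [set x0; y0]) //= -addSn leq_add //; first exact: strict.
by apply: leq_sum => P /andP [PP _]; apply: weak.
Qed.

(* Each pair in a cluster of size at most 3 has at most 12 extensions, and a cluster of size 2
   contains only one pair. *)
Lemma two_small_clusters i0 j0 : i0 != j0 -> #|clu cl i0| = 2 -> #|clu cl j0| = 2 ->
  (forall i, i != i0 -> i != j0 -> #|clu cl i| = 3) ->
  num_induced_cycles G < maxprod #|G| + 36 * k.-1.
Proof.
move=> ij s2 s2' s3.
have le3 i : 1 < #|clu cl i| <= 3.
  by have [->|n1] := eqVneq i i0; [rewrite s2 | have [->|n2] := eqVneq i j0; [rewrite s2' | rewrite s3]].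
have c4 i : #|clu cl i| <= 4 by have := le3 i; lia.
apply: leq_ltn_trans (num_cycles_braid_small br k6 c4) _; rewrite addnC.
apply: leq_ltn_trans (leq_add (prod_clusters_le cl) (leqnn _)) _; rewrite ltn_add2l.
apply: leq_ltn_trans (card_short_le br k6 c4) _.
apply: leq_ltn_trans (_ : \sum_i 'C(#|clu cl i|, 2) * 12 < _).
  apply: leq_sum => i _; rewrite -card_pairs -sum_nat_const; apply: leq_sum => P Pi.
  case jP: (joined P).
    apply: leq_trans (card_extensions_joined Pi jP) _.
    move: (le3 i) (le3 (ordS i)) (le3 (ord_pred i)).
    by case: eqP => /= e; lia.
  apply: leq_trans (card_extensions_free cl i (negbT jP)) _.
  move: (le3 (ordS i)) (le3 (ord_pred i)); move: #|clu cl (ordS i)| #|clu cl (ord_pred i)|.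
  by move=> [|[|[|[|a]]]] // [|[|[|[|b]]]].
have ji : j0 != i0 by rewrite eq_sym.
rewrite (bigD1 i0) //= (bigD1 j0) //= s2 s2' (eq_bigr (fun=> 36)).
  have -> : \sum_(i < k | (i != i0) && (i != j0)) 36 = 36 * (k - 2).
    rewrite sum_nat_const mulnC; congr (_ * _).
    have -> : #|[pred i : 'I_k | (i != i0) && (i != j0)]| = #|~: [set i0; j0]|.
      by apply: eq_card => i; rewrite !inE negb_or.
    by have := cardsC [set i0; j0]; rewrite cards2 ij card_ord; clear; lia.
  by rewrite binn; clear -k6; lia.
by move=> i /andP [ii ij']; rewrite s3.
Qed.
End Emptied.

Lemma iter_cancel (T : Type) (f g : T -> T) j : cancel f g -> cancel (iter j f) (iter j g).
Proof. by move=> fK; elim: j => // j IH x; rewrite iterSr /= fK IH. Qed.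

Lemma cyclic_adj_iter k j (a b : 'I_k) :
  cyclic_adj (iter j (@ord_pred k) a) (iter j (@ord_pred k) b) = cyclic_adj a b.
Proof.
elim: j => // j IH; rewrite iterS iterS -IH /cyclic_adj !ord_predK.
by rewrite -!(can2_eq (@ordSK k) (@ord_predK k)).
Qed.

(* Rotating the indices moves the exceptional cluster to index 0. *)
Lemma single_exception_iso n (G : sgraph) k (cl : G -> 'I_k) i0 : #|G| = n ->
  1 < #|clu cl i0| <= 4 -> (forall i, i != i0 -> #|clu cl i| = 3) ->
  (forall x y, edge x y = (cl x != cl y) && cyclic_adj (cl x) (cl y)) -> isomorphic G (H n).
Proof.
move=> Gn se s3 ed; have nE : n = #|clu cl i0| + 3 * k.-1.
  rewrite -Gn -(sum_clusters cl) (bigD1 i0) //= (eq_bigr (fun=> 3)) //.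
  by rewrite sum_nat_const cardC1 card_ord [_ * 3]mulnC.
have k0 : 0 < k by apply: leq_ltn_trans (ltn_ord i0).
have kE : k = n.+1 %/ 3 by clear -nE se k0; lia.
subst k; pose cl' x := iter i0 (@ord_pred _) (cl x).
have K := iter_cancel i0 (@ord_predK (n.+1 %/ 3)).
have K' := iter_cancel i0 (@ordSK (n.+1 %/ 3)).
apply: (@isomorphic_braid_graph _ _ G cl') => [i|x y]; last first.
  by rewrite ed /cl' cyclic_adj_iter (inj_eq (can_inj K)).
have -> : clu cl' i = clu cl (iter i0 (@ordS _) i).
  by apply/setP => x; rewrite !inE /cl' (can2_eq K K').
have e0 : (iter i0 (@ordS _) i == i0) = (i == 0 :> nat).
  rewrite -val_eqE val_iter_ordS /=; have ik := ltn_ord i; have i0k := ltn_ord i0.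
  have [lt|ge] := ltnP (i + i0) (n.+1 %/ 3); first by rewrite modn_small //; clear; lia.
  rewrite -(subnK ge) modnDr modn_small; last by clear -ik i0k ge; lia.
  by clear -ik i0k ge; lia.
rewrite /H_size -e0; case: (_ =P i0) => [->|/eqP ne] /=; last by rewrite orbT s3.
rewrite orbF {i e0}; move: nE se; move: #|clu cl i0| => e nE e4.
have [e2|[e3|e4']] : e = 2 \/ e = 3 \/ e = 4 by clear -e4; lia.
- by have -> : n %% 3 = 2 by clear -nE e2 k0; lia.
- by have -> : n %% 3 = 0 by clear -nE e3 k0; lia.
by have -> : n %% 3 = 1 by clear -nE e4' k0; lia.
Qed.

Lemma extremal_isomorphic : exists n0, forall n (G : sgraph), n0 <= n ->
  #|G| = n -> num_induced_cycles G = m n -> isomorphic G (H n).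
Proof.
have [n1 h1] := many_cycles_braid; have [n2 h2] := short_small 4000.
exists (n1 + n2 + 18) => n G ge Gn Nm.
have n18 : 17 < n by apply: leq_trans ge; rewrite leq_addl.
have pN : maxprod #|G| <= num_induced_cycles G by rewrite Nm Gn maxprod_le_m.
have [|k [cl [br k18 s18]]] := h1 G _ pN; first by rewrite Gn (leq_trans _ ge) // -addnA leq_addr.
have sh : 4000 * #|short_cycles G| < maxprod #|G|.
  by apply: h2; rewrite Gn (leq_trans _ ge) // addnAC leq_addl.
have k6 : 5 < k by apply: leq_trans k18.
have near : 1999 * maxprod (\sum_i #|clu cl i|) <= 2000 * \prod_i #|clu cl i|.
  have [r rp Nr] := braid_bound br k18 s18; rewrite sum_clusters.
  move: sh pN rp Nr; move: (num_induced_cycles G) #|short_cycles G| (\prod_i _) (maxprod _); clear; lia.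
have s0 i : 0 < #|clu cl i| by rewrite card_gt0; case: br.
have k4 : 3 < k by apply: leq_trans k18.
have sz := size_bounds k4 s0 near.
(* One argument for all cases with at most one exceptional cluster: an edge inside a cluster would
   give the emptied graph more than m n cycles. *)
have single i0 : (forall i, i != i0 -> #|clu cl i| = 3) -> isomorphic G (H n).
  move=> s3; apply: (single_exception_iso Gn (sz i0) s3) => x y.
  have [e|ne] := eqVneq (cl x) (cl y); last by have [_ ->] := br.
  apply/negbTE/negP => xy; have : num_induced_cycles G < num_induced_cycles (emptied cl).
    apply: (inner_edge_loss br k6 sz); last by exists x, y.
    move=> i j ij i3; have ei : i = i0 by apply: contraNeq i3 => ne; rewrite s3.
    by apply: s3; rewrite -ei eq_sym.
  by rewrite ltnNge Nm -Gn; have := num_cycles_le_m (emptied cl) => ->.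
case: (size_cases k4 s0 near).
- by move=> s3; apply: (single (Ordinal (leq_trans (isT : 0 < 6) k6))) => i _.
- by case=> i0 [_ s3]; apply: single s3.
- by case=> i0 [_ s3]; apply: single s3.
case=> i0 [j0 [ij s2 s2' s3]]; have := two_small_clusters br k6 ij s2 s2' s3; rewrite Nm Gn.
(* Two clusters of size 2 force n = 3 k - 2. Then H n has k - 1 clusters and the same product, and
   its 36 (k - 1) or more squares win. *)
have nE : n = 3 * (k - 2) + 4.
  have ji : j0 != i0 by rewrite eq_sym.
  rewrite -Gn -(sum_clusters cl) (bigD1 i0) //= (bigD1 j0) //= s2 s2' (eq_bigr (fun=> 3)); last first.
    by move=> i /andP [ii ij']; rewrite s3.
  rewrite sum_nat_const mulnC addnA addnC; congr (_ * _ + _).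
  have -> : #|[pred i : 'I_k | (i != i0) && (i != j0)]| = #|~: [set i0; j0]|.
    by apply: eq_card => i; rewrite !inE negb_or.
  by have := cardsC [set i0; j0]; rewrite cards2 ij card_ord; clear; lia.
rewrite ltnNge => /negP []; have -> : k.-1 = n.+1 %/ 3 by clear -nE k4; lia.
by apply: H_cycles_mod1 => //; clear -nE; lia.
Qed.

Theorem theorem1p2 :
  exists n0 : nat, forall n : nat, n0 <= n ->
    [/\ #|H n| = n,
        num_induced_cycles (H n) = m n
      & forall G : sgraph,
          #|G| = n -> num_induced_cycles G = m n -> isomorphic G (H n)].
Proof.
have [n0 h] := extremal_isomorphic; exists (n0 + 18) => n ge.
have n18 : 17 < n by apply: leq_trans ge; apply: leq_addl.
have ge0 : n0 <= n by apply: leq_trans ge; apply: leq_addr.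
split; [exact: card_H | | by move=> G; apply: h].
(* Some graph attains m n and is isomorphic to H n, so H n attains it without an exact count of its
   cycles. *)
have [E mE] : {E : {set 'I_n * 'I_n} | m n = num_induced_cycles (graph_of_pairs E)}.
  by apply: eq_bigmax; apply/card_gt0P; exists set0.
by rewrite mE; apply/esym/isomorphic_num_cycles/h; rewrite -?mE // card_ord.
Qed.
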